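(* Let $\underline\lambda=(\lambda^{(1)},\lambda^{(2)})$ be an arbitrary bipartition of $n$. Then $$f_{\underline\lambda}(v)=v^{\frac{n(n-1)}2}\,\frac{s_{\underline\lambda}(v,1)}{s_{\lambda^{(1)}}(v)\,s_{\lambda^{(2)}}(v)},$$ where $s_{\underline\lambda}(v,\tilde v)$ is the Schur element of the two-parameter type $B_n$ Hecke algebra corresponding to $\underline\lambda$, and $s_{\lambda^{(i)}}(v)$ is the type $A$ Schur element corresponding to $\lambda^{(i)}$.
   Context: $n=2m\ge4$ is even. Permutations act from the right; modules are right modules. $v,\tilde v$ are independent indeterminates, $\mathcal A=\mathbb Z[v^{\pm1}]$, $\widetilde{\mathcal A}=\mathbb Z[v^{\pm1},\tilde v^{\pm1}]$. A bipartition of $n$ is a pair of partitions of total size $n$; put $a=|\lambda^{(1)}|$. $\mathcal H_{v,\tilde v}(B_n)$ is the unital $\widetilde{\mathcal A}$-algebra with generators $T_0,\dots,T_{n-1}$ and relations $(T_0+1)(T_0-\tilde v)=0$, $T_0T_1T_0T_1=T_1T_0T_1T_0$, $(T_i+1)(T_i-v)=0$ for $i\ge1$, $T_iT_{i+1}T_i=T_{i+1}T_iT_{i+1}$ for $1\le i\le n-2$, $T_iT_j=T_jT_i$ for $|i-j|\ge2$. It has a basis $T_w$ ($w$ in the Weyl group of type $B_n$). $\mathcal H_v(B_n)$ is the $\mathcal A$-algebra obtained by setting $\tilde v=1$. $\mathcal H_v(\mathfrak S_k)$ is the type $A$ Hecke algebra generated by $T_1,\dots,T_{k-1}$ over $\mathcal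 A$, with basis $T_w$, $w\in\mathfrak S_k$; $s_i=(i,i+1)$; $\mathcal H_v(\mathfrak S_{(a,n-a)})\subseteq\mathcal H_v(\mathfrak S_n)$ is generated by the $T_i$ with $1\le i\le n-1$, $i\neq a$. Put $u_k^+=\prod_{i=1}^k(v^{i-1}+T_{i-1}\cdots T_1T_0T_1\cdots T_{i-1})$, $u_k^-=\prod_{i=1}^k(\tilde vv^{i-1}-T_{i-1}\cdots T_1T_0T_1\cdots T_{i-1})$ ($u_0^\pm=1$), $w_{a,b}=(s_a\cdots s_1)(s_{a+1}\cdots s_2)\cdots(s_{a+b-1}\cdots s_b)$ for $a,b\ge1$, $w_{a,b}=1$ if $a=0$ or $b=0$, $h_{a,b}=T_{w_{a,b}}$. For a partition $\lambda$ of $k$ with conjugate $\lambda'$: $\mathfrak S_\lambda$ is the Young subgroup, $x_\lambda=\sum_{w\in\mathfrak S_\lambda}T_w$, $y_\lambda=\sum_{w\in\mathfrak S_\lambda}(-v)^{-\ell(w)}T_w$, $w_\lambda\in\mathfrak S_k$ satisfies $\mathfrak t^\lambda w_\lambda=\mathfrak t_\lambda$, where $\mathfrak t^\lambda$ (resp. $\mathfrak t_\lambda$) is the $\lambda$-tableau with $1,\dots,k$ in order along rows (resp. columns). $z_\lambda=x_\lambda T_{w_\lambda}y_{\lambda'}$, the Specht module is $S^\lambda=z_\lambda\mathcal H_v(\mathfrak S_k)$, and the dual Specht module is $S_\lambda=y_{\lambda'}T_{w_{\lambda'}}x_\lambda\mathcal H_v(\mathfrak S_k)$. A hat on the second factor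 denotes the analogous object for $\mathcal H_v(\mathfrak S_{\{a+1,\dots,n\}})$, obtained by shifting indices by $a$. $S^{\underline\lambda}=u_{n-a}^-h_{n-a,a}u_a^+z_{\lambda^{(1)}}\widehat{z_{\lambda^{(2)}}}\,\mathcal H_{v,\tilde v}(B_n)$, which becomes simple over $\mathbb Q(v,\tilde v)$. Definition of $f_{\underline\lambda}(v)$: in $\mathcal H_v(B_n)$ (so $\tilde v=1$) there is a unique central element $z_{a,n-a}$ of $\mathcal H_v(\mathfrak S_{(a,n-a)})$ with $u_{n-a}^-h_{n-a,a}u_a^+h_{a,n-a}u_{n-a}^-h_{n-a,a}u_a^+=u_{n-a}^-h_{n-a,a}u_a^+z_{a,n-a}$; it acts on $S_{\lambda^{(1)}}\otimes\widehat S_{\lambda^{(2)}}$ as a scalar, which is $f_{\underline\lambda}(v)\in\mathcal A$. Schur elements: let $\mathrm{tr}$ be the trace form with $\mathrm{tr}(T_w)=\delta_{w,1}$ on $\mathcal H_{v,\tilde v}(B_n)$ and on $\mathcal H_v(\mathfrak S_k)$. Over the fraction fields these algebras are split semisimple and $\mathrm{tr}=\sum_\chi s_\chi^{-1}\chi$, the sum over irreducible characters $\chi$; $s_\chi$ is the Schur element of $\chi$. $s_{\underline\lambda}(v,\tilde v)\in\widetilde{\mathcal A}$ is the Schur element of $S^{\underline\lambda}$ (over $\mathbb Q(v,\tilde v)$) and $s_\lambda(v)\in\mathcal A$ that of $S^\lambda$ (over $\mathbb Q(v)$), with $s_\emptyset=1$. *)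

(* Defs.v *)
From HB Require Import structures.
From mathcomp Require Import all_boot all_order all_fingroup all_algebra.
From mathcomp Require Import fraction generic_quotient boolp.

Set Implicit Arguments.
Unset Strict Implicit.
Unset Printing Implicit Defensive.

Import GRing.Theory.

Local Open Scope ring_scope.
Local Open Scope quotient_scope.

Notation "x %:F" := (tofrac x) : ring_scope.

(* Laurent polynomials R[X^{+-1}], as the subring of Frac(R[X]) of the        *)
(* fractions p / X^k.                                                         *)

Section Laurent.
Variable R : idomainType.
Implicit Types (p : {poly R}) (k : nat).

Definition is_laurent : {pred {fraction {poly R}}} :=
  fun x => `[< exists pk : {poly R} * nat, x * ('X^(pk.2))%:F = (pk.1)%:F >].

Lemma is_laurentP x :
  reflect (exists p k, x * ('X^k)%:F = p%:F) (x \in is_laurent).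
Proof.
rewrite unfold_in; apply: (iffP (asboolP _)) => [[[p k] /= e]|[p [k e]]].
  by exists p, k.
by exists (p, k).
Qed.

Lemma is_laurent_subring : subring_closed is_laurent.
Proof.
split=> [|x y /is_laurentP[p [k ep]] /is_laurentP[r [l er]]
         |x y /is_laurentP[p [k ep]] /is_laurentP[r [l er]]].
- by apply/is_laurentP; exists 1, 0%N; rewrite mul1r.
- apply/is_laurentP; exists (p * 'X^l - r * 'X^k), (k + l)%N.
  rewrite tofracB !tofracM -ep -er exprD tofracM mulrBl !mulrA.
  by congr (_ - _); rewrite mulrAC.
- apply/is_laurentP; exists (p * r), (k + l)%N.
  by rewrite tofracM -ep -er exprD tofracM mulrACA.
Qed.

HB.instance Definition _ :=
  GRing.isSubringClosed.Build _ is_laurent is_laurent_subring.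

Record laurent := MkLaurent
  { laurent_val : {fraction {poly R}}; _ : laurent_val \in is_laurent }.

HB.instance Definition _ := [isSub for laurent_val].
HB.instance Definition _ := [Choice of laurent by <:].
HB.instance Definition _ :=
  [SubChoice_isSubComNzRing of laurent by <:].

Lemma laurent_val0 : laurent_val 0 = 0. Proof. exact: GRing.val0. Qed.
Lemma laurent_val1 : laurent_val 1 = 1. Proof. exact: GRing.val1. Qed.
Lemma laurent_valM : {morph laurent_val : x y / x * y}.
Proof. exact: GRing.valM. Qed.

Lemma laurent_val_eq0 x : (laurent_val x == 0) = (x == 0).
Proof. by rewrite -laurent_val0 (inj_eq val_inj). Qed.

Definition laurent_unit : {pred laurent} :=
  fun x => (x != 0) && ((laurent_val x)^-1 \in is_laurent).

Definition laurent_inv (x : laurent) : laurent := insubd x (laurent_val x)^-1.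

Lemma laurent_mulVx : {in laurent_unit, left_inverse 1 laurent_inv *%R}.
Proof.
move=> x /andP[x0 xV]; apply: val_inj; apply: etrans (laurent_valM _ _) _.
apply: etrans (esym laurent_val1).
by rewrite [laurent_val (laurent_inv x)](insubdK x xV) mulVf ?laurent_val_eq0.
Qed.

Lemma laurent_unitPl (x y : laurent) : y * x = 1 -> laurent_unit x.
Proof.
move=> yx; have vyx : laurent_val y * laurent_val x = 1.
  by rewrite -laurent_valM yx laurent_val1.
have vx0 : laurent_val x != 0.
  by apply: contra_eq_neq vyx => ->; rewrite mulr0 eq_sym oner_neq0.
apply/andP; split; first by rewrite -laurent_val_eq0.
suff -> : (laurent_val x)^-1 = laurent_val y by apply: valP.
by rewrite -[LHS]mul1r -vyx mulfK.
Qed.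

Lemma laurent_invr_out : {in [predC laurent_unit], laurent_inv =1 id}.
Proof.
move=> x; rewrite inE /= unfold_in negb_and negbK => /orP[/eqP->|xV].
  apply: val_inj; rewrite val_insubd; case: ifP => // _.
  by apply: etrans (esym laurent_val0); rewrite laurent_val0 invr0.
by apply: val_inj; rewrite val_insubd (negPf xV).
Qed.

HB.instance Definition _ :=
  GRing.ComNzRing_hasMulInverse.Build laurent
    laurent_mulVx laurent_unitPl laurent_invr_out.

Lemma laurent_mulf_eq0 (x y : laurent) : x * y = 0 -> (x == 0) || (y == 0).
Proof.
by move=> /eqP; rewrite -!laurent_val_eq0 laurent_valM mulf_eq0.
Qed.

HB.instance Definition _ :=
  GRing.ComUnitRing_isIntegral.Build laurent laurent_mulf_eq0.

Lemma laurentC_subproof (c : R) : (c%:P)%:F \in is_laurent.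
Proof. by apply/is_laurentP; exists c%:P, 0%N; rewrite tofrac1 mulr1. Qed.

Definition laurentC (c : R) : laurent := MkLaurent (laurentC_subproof c).

Lemma laurentX_subproof : ('X : {poly R})%:F \in is_laurent.
Proof. by apply/is_laurentP; exists 'X, 0%N; rewrite tofrac1 mulr1. Qed.

Definition laurentX : laurent := MkLaurent laurentX_subproof.

Lemma laurent_repr (x : laurent) :
  exists pk : {poly R} * nat, laurent_val x * ('X^(pk.2))%:F = (pk.1)%:F.
Proof. by have /is_laurentP[p [k e]] := valP x; exists (p, k). Qed.

(* Specialization X := 1, that is p / X^k |-> p(1). *)
Definition laurent_at1 (x : laurent) : R :=
  (projT1 (cid (laurent_repr x))).1.[1].

Lemma laurent_at1E (x : laurent) p k :
  laurent_val x * ('X^k)%:F = p%:F -> laurent_at1 x = p.[1].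
Proof.
rewrite /laurent_at1; case: cid => -[r l] /= er ep.
have /eqP : (r * 'X^k)%:F = (p * 'X^l)%:F :> {fraction {poly R}}.
  by rewrite !tofracM -er -ep mulrAC.
rewrite tofrac_eq => /eqP /(congr1 (fun s => s.[1])).
by rewrite !hornerM !hornerXn !expr1n !mulr1.
Qed.

End Laurent.

(* A = Z[v^{+-1}] and A2 = A[\tilde v^{+-1}]; their fraction fields are Q(v) and
   Q(v, \tilde v). *)
Definition A : idomainType := laurent int.
Definition A2 : idomainType := laurent A.
Definition v : A := laurentX int.
Definition v2 : A2 := laurentC v.
Definition tv2 : A2 := laurentX A.

(* Unital associative R-algebras given by generators and relations: formal    *)
(* expressions modulo the congruence generated by the algebra axioms and the  *)
(* relations.                                                                 *)

Inductive term (R I : Type) : Type :=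
| TGen of I
| TCst of R
| TAdd of term R I & term R I
| TMul of term R I & term R I.
Arguments TGen {R I} _.
Arguments TCst {R I} _.

HB.instance Definition _ (R I : Type) := gen_eqMixin (term R I).
HB.instance Definition _ (R I : Type) := gen_choiceMixin (term R I).

Fixpoint teval (R : comNzRingType) (I : Type) (e : I -> R) (t : term R I) : R :=
  match t with
  | TGen i => e i
  | TCst c => c
  | TAdd s u => teval e s + teval e u
  | TMul s u => teval e s * teval e u
  end.

(* A one-dimensional representation is recorded along with the presentation:  *)
(* it only serves to show 1 <> 0 in the presented algebra, as algType demands.*)
Record presentation (R : comNzRingType) := Presentation {
  pgen : Type;
  prel : term R pgen -> term R pgen -> Prop;
  pchar : pgen -> R;
  _ : forall s t, prel s t -> teval pchar s = teval pchar t }.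

Section PresentedAlgebra.
Variables (R : comNzRingType) (P : presentation R).
Local Notation term := (term R (pgen P)).
Implicit Types (s t u : term) (a b : R).

Inductive pcong : term -> term -> Prop :=
| Crel s t : prel s t -> pcong s t
| Crefl s : pcong s s
| Csym s t : pcong s t -> pcong t s
| Ctrans s t u : pcong s t -> pcong t u -> pcong s u
| Cadd s s' t t' : pcong s s' -> pcong t t' -> pcong (TAdd s t) (TAdd s' t')
| Cmul s s' t t' : pcong s s' -> pcong t t' -> pcong (TMul s t) (TMul s' t')
| CaddA s t u : pcong (TAdd s (TAdd t u)) (TAdd (TAdd s t) u)
| CaddC s t : pcong (TAdd s t) (TAdd t s)
| Cadd0 s : pcong (TAdd (TCst 0) s) s
| CaddN s : pcong (TAdd (TMul (TCst (-1)) s) s) (TCst 0)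
| CmulA s t u : pcong (TMul s (TMul t u)) (TMul (TMul s t) u)
| Cmul1l s : pcong (TMul (TCst 1) s) s
| Cmul1r s : pcong (TMul s (TCst 1)) s
| CmulDl s t u : pcong (TMul (TAdd s t) u) (TAdd (TMul s u) (TMul t u))
| CmulDr s t u : pcong (TMul s (TAdd t u)) (TAdd (TMul s t) (TMul s u))
| CcstD a b : pcong (TCst (a + b)) (TAdd (TCst a) (TCst b))
| CcstM a b : pcong (TCst (a * b)) (TMul (TCst a) (TCst b))
| CcstC a s : pcong (TMul (TCst a) s) (TMul s (TCst a)).

Definition pcongb : rel term := fun s t => `[< pcong s t >].

Lemma pcongb_refl : reflexive pcongb.
Proof. by move=> s; apply/asboolP; apply: Crefl. Qed.

Lemma pcongb_sym : symmetric pcongb.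
Proof. by move=> s t; apply/asboolP/asboolP; apply: Csym. Qed.

Lemma pcongb_trans : transitive pcongb.
Proof.
by move=> t s u /asboolP st /asboolP tu; apply/asboolP; apply: Ctrans st tu.
Qed.

Canonical pcong_equiv := EquivRel pcongb pcongb_refl pcongb_sym pcongb_trans.

Definition presalg := {eq_quot pcong_equiv}.
HB.instance Definition _ : EqQuotient _ pcong_equiv presalg :=
  EqQuotient.on presalg.
HB.instance Definition _ := Choice.on presalg.

Lemma pcongP s t : reflect (pcong s t) (\pi_presalg s == \pi_presalg t).
Proof. by rewrite eqmodE; apply: asboolP. Qed.

Lemma pcong_pi s t : pcong s t -> \pi_presalg s = \pi_presalg t.
Proof. by move=> st; apply/eqP/pcongP. Qed.

Lemma pcong_repr s : pcong (repr (\pi_presalg s)) s.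
Proof. by apply/pcongP; rewrite reprK. Qed.

Definition pcst a : presalg := \pi_presalg (TCst a).
Definition padd (x y : presalg) : presalg := \pi_presalg (TAdd (repr x) (repr y)).
Definition pmul (x y : presalg) : presalg := \pi_presalg (TMul (repr x) (repr y)).
Definition popp (x : presalg) : presalg := pmul (pcst (-1)) x.
Definition pscale a (x : presalg) : presalg := pmul (pcst a) x.

Lemma pi_padd s t : \pi_presalg (TAdd s t) = padd (\pi_presalg s) (\pi_presalg t).
Proof. by apply/esym/pcong_pi/Cadd; apply: pcong_repr. Qed.

Lemma pi_pmul s t : \pi_presalg (TMul s t) = pmul (\pi_presalg s) (\pi_presalg t).
Proof. by apply/esym/pcong_pi/Cmul; apply: pcong_repr. Qed.

Lemma paddA : associative padd.
Proof.
elim/quotW=> s; elim/quotW=> t; elim/quotW=> u.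
by rewrite -(pi_padd t u) -(pi_padd s t) -2!pi_padd; apply/pcong_pi/CaddA.
Qed.

Lemma paddC : commutative padd.
Proof.
by elim/quotW=> s; elim/quotW=> t; rewrite -2!pi_padd; apply/pcong_pi/CaddC.
Qed.

Lemma padd0 : left_id (pcst 0) padd.
Proof. by elim/quotW=> s; rewrite -pi_padd; apply/pcong_pi/Cadd0. Qed.

Lemma paddN : left_inverse (pcst 0) popp padd.
Proof.
by elim/quotW=> s; rewrite /popp -pi_pmul -pi_padd; apply/pcong_pi/CaddN.
Qed.

HB.instance Definition _ := GRing.isZmodule.Build presalg paddA paddC padd0 paddN.

Lemma pmulA : associative pmul.
Proof.
elim/quotW=> s; elim/quotW=> t; elim/quotW=> u.
by rewrite -(pi_pmul t u) -(pi_pmul s t) -2!pi_pmul; apply/pcong_pi/CmulA.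
Qed.

Lemma pmul1l : left_id (pcst 1) pmul.
Proof. by elim/quotW=> s; rewrite -pi_pmul; apply/pcong_pi/Cmul1l. Qed.

Lemma pmul1r : right_id (pcst 1) pmul.
Proof. by elim/quotW=> s; rewrite -pi_pmul; apply/pcong_pi/Cmul1r. Qed.

Lemma pmulDl : left_distributive pmul +%R.
Proof.
elim/quotW=> s; elim/quotW=> t; elim/quotW=> u.
rewrite -[_ + _]/(padd _ _) -[RHS]/(padd _ _) -(pi_pmul s u) -(pi_pmul t u).
by rewrite -(pi_padd s t) -pi_pmul -pi_padd; apply/pcong_pi/CmulDl.
Qed.

Lemma pmulDr : right_distributive pmul +%R.
Proof.
elim/quotW=> s; elim/quotW=> t; elim/quotW=> u.
rewrite -[_ + _]/(padd _ _) -[RHS]/(padd _ _) -(pi_pmul s t) -(pi_pmul s u).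
by rewrite -(pi_padd t u) -pi_pmul -pi_padd; apply/pcong_pi/CmulDr.
Qed.

Lemma pcong_teval s t : pcong s t -> teval (@pchar _ P) s = teval (@pchar _ P) t.
Proof.
elim=> {s t} /=.
- by case: P => I r c h s t /h.
- by [].
- by move=> s t _ ->.
- by move=> s t u _ -> _ ->.
- by move=> s s' t t' _ -> _ ->.
- by move=> s s' t t' _ -> _ ->.
- by move=> *; rewrite addrA.
- by move=> *; rewrite addrC.
- by move=> *; rewrite add0r.
- by move=> *; rewrite mulN1r addNr.
- by move=> *; rewrite mulrA.
- by move=> *; rewrite mul1r.
- by move=> *; rewrite mulr1.
- by move=> *; rewrite mulrDl.
- by move=> *; rewrite mulrDr.
- by [].
- by [].
- by move=> *; rewrite mulrC.
Qed.

Lemma pcst1_neq0 : pcst 1 != 0.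
Proof.
by apply/negP => /pcongP/pcong_teval /= /eqP; apply/negP/oner_neq0.
Qed.

HB.instance Definition _ :=
  GRing.Zmodule_isNzRing.Build presalg
    pmulA pmul1l pmul1r pmulDl pmulDr pcst1_neq0.

Lemma pcstD a b : pcst (a + b) = pcst a + pcst b.
Proof. by rewrite -[RHS]pi_padd; apply/pcong_pi/CcstD. Qed.

Lemma pcstM a b : pcst (a * b) = pcst a * pcst b.
Proof. by rewrite -[RHS]pi_pmul; apply/pcong_pi/CcstM. Qed.

Lemma pcst_comm a (x : presalg) : pcst a * x = x * pcst a.
Proof.
elim/quotW: x => s.
by rewrite -[LHS]pi_pmul -[RHS]pi_pmul; apply/pcong_pi/CcstC.
Qed.

Lemma pscaleA a b x : pscale a (pscale b x) = pscale (a * b) x.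
Proof. by rewrite /pscale pcstM; apply: mulrA. Qed.

Lemma pscale1 : left_id 1 pscale.
Proof. by move=> x; apply: mul1r. Qed.

Lemma pscaleDr : right_distributive pscale +%R.
Proof. by move=> a x y; apply: mulrDr. Qed.

Lemma pscaleDl x : {morph pscale^~ x : a b / a + b}.
Proof. by move=> a b; rewrite /pscale pcstD; apply: mulrDl. Qed.

HB.instance Definition _ :=
  GRing.Zmodule_isLmodule.Build R presalg pscaleA pscale1 pscaleDr pscaleDl.

Lemma pscaleAl a (x y : presalg) : a *: (x * y) = (a *: x) * y.
Proof. exact: mulrA. Qed.

HB.instance Definition _ :=
  GRing.Lmodule_isLalgebra.Build R presalg pscaleAl.

Lemma pscaleAr a (x y : presalg) : a *: (x * y) = x * (a *: y).
Proof.
change (pcst a * (x * y) = x * (pcst a * y)).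
by rewrite !mulrA pcst_comm.
Qed.

HB.instance Definition _ :=
  GRing.Lalgebra_isAlgebra.Build R presalg pscaleAr.

Definition pgenerator (i : pgen P) : presalg := \pi_presalg (TGen i).

End PresentedAlgebra.

Section Hecke.
Variable R : comNzRingType.
Local Notation "s + t" := (TAdd s t).
Local Notation "s * t" := (TMul s t).
Local Notation g := TGen.
Local Notation c := TCst.

(* Type B_n: the generator i : 'I_n is T_i. *)
Inductive relB (n : nat) (Q q : R) : term R 'I_n -> term R 'I_n -> Prop :=
| BquadQ (i : 'I_n) : i = 0%N :> nat ->
    relB Q q ((g i + c 1%R) * (g i + c (- Q)%R)) (c 0%R)
| Bquadq (i : 'I_n) : (0 < i)%N ->
    relB Q q ((g i + c 1%R) * (g i + c (- q)%R)) (c 0%R)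
| Bbraid4 (i j : 'I_n) : i = 0%N :> nat -> j = 1%N :> nat ->
    relB Q q (g i * g j * g i * g j) (g j * g i * g j * g i)
| Bbraid3 (i j : 'I_n) : (0 < i)%N -> j = i.+1 :> nat ->
    relB Q q (g i * g j * g i) (g j * g i * g j)
| Bcomm (i j : 'I_n) : (i.+1 < j)%N -> relB Q q (g i * g j) (g j * g i).

(* Type A_{k-1}: the generator i : 'I_k.-1 is T_{i+1}. *)
Inductive relA (k : nat) (q : R) : term R 'I_k.-1 -> term R 'I_k.-1 -> Prop :=
| Aquad (i : 'I_k.-1) :
    relA q ((g i + c 1%R) * (g i + c (- q)%R)) (c 0%R)
| Abraid3 (i j : 'I_k.-1) : j = i.+1 :> nat ->
    relA q (g i * g j * g i) (g j * g i * g j)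
| Acomm (i j : 'I_k.-1) : (i.+1 < j)%N -> relA q (g i * g j) (g j * g i).

Lemma relB_char n (Q q : R) (s t : term R 'I_n) : relB Q q s t ->
  teval (fun i : 'I_n => if val i == 0%N then Q else q) s =
  teval (fun i : 'I_n => if val i == 0%N then Q else q) t.
Proof.
case=> [i i0|i i0|i j i0 j1|i j i0 ji|i j ij] /=.
- by rewrite i0 eqxx subrr mulr0.
- by rewrite eqn0Ngt i0 subrr mulr0.
- by rewrite i0 j1 /= [(Q * q)%R]mulrC -mulrA [(Q * q)%R]mulrC mulrA.
- by rewrite ji eqn0Ngt i0.
- by rewrite mulrC.
Qed.

Lemma relA_char k (q : R) (s t : term R 'I_k.-1) : relA q s t ->
  teval (fun=> q) s = teval (fun=> q) t.
Proof. by case=> [i|i j ji|i j ij] //=; rewrite subrr mulr0. Qed.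

Definition heckeB n (Q q : R) : algType R :=
  presalg (Presentation (@relB_char n Q q)).

Definition heckeA k (q : R) : algType R :=
  presalg (Presentation (@relA_char k q)).

(* T_i with i : nat, and 0 outside 0 <= i < n, resp. 1 <= i < k. *)
Definition TB n (Q q : R) (i : nat) : heckeB n Q q :=
  if insub i is Some j then
    pgenerator (P := Presentation (@relB_char n Q q)) j
  else 0.

Definition TA k (q : R) (i : nat) : heckeA k q :=
  if i is i'.+1 then
    if insub i' is Some j then
      pgenerator (P := Presentation (@relA_char k q)) j
    else 0
  else 0.

End Hecke.

Section Coxeter.
Variables (gT : finGroupType) (r : nat) (s : 'I_r -> gT).

Definition wordprod (t : seq 'I_r) : gT := (\prod_(i <- t) s i)%g.

(* The length of w in the generators s (junk if s does not generate w). *)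
Definition coxlen (w : gT) : nat :=
  find (fun l => [exists t : l.-tuple 'I_r, wordprod t == w]) (iota 0 #|gT|).

(* Some reduced expression of w. *)
Definition redword (w : gT) : seq 'I_r :=
  if [pick t : (coxlen w).-tuple 'I_r | wordprod t == w] is Some t
  then val t else [::].

End Coxeter.

(* The point i of {1, ..., k} is the ordinal i - 1; products of permutations  *)
(* in MathComp are already composed from left to right.                       *)

(* s_i = (i, i+1) for 1 <= i < k. *)
Definition transp (k i : nat) : 'S_k :=
  match insub i.-1, insub i with
  | Some x, Some y => tperm x y
  | _, _ => 1%g
  end.

Definition gensA (k : nat) (i : 'I_k.-1) : 'S_k := transp k i.+1.

(* Signed permutations, as permutations of {+,-} x {1, ..., n}. *)
Definition gensB (n : nat) (i : 'I_n) : {perm bool * 'I_n} :=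
  if val i == 0%N then tperm (false, i) (true, i)
  else (tperm (false, ord_pred i) (false, i) *
        tperm (true, ord_pred i) (true, i))%g.

Definition weylB (n : nat) : {set {perm bool * 'I_n}} :=
  <<[set gensB i | i : 'I_n]>>%g.

Definition w_ab (n a b : nat) : 'S_n :=
  (\prod_(0 <= j < b) \prod_(0 <= i < a) transp n (a + j - i))%g.

(* Partitions are the weakly decreasing sequences of positive integers. *)

Definition is_partition (lam : seq nat) : bool :=
  sorted geq lam && (0%N \notin lam).

Definition is_bipartition (n : nat) (lam1 lam2 : seq nat) : bool :=
  [&& is_partition lam1, is_partition lam2 & sumn lam1 + sumn lam2 == n]%N.

Definition conj_part (lam : seq nat) : seq nat :=
  [seq count (fun r => j < r)%N lam | j <- iota 0 (head 0%N lam)].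

(* reshape_index lam i and reshape_offset lam i are the row and the column of *)
(* the entry i in the tableau t^lam (all indices starting from 0).            *)

Definition young (lam : seq nat) : {set 'S_(sumn lam)} :=
  [set w : 'S_(sumn lam) |
     [forall i, reshape_index lam (w i) == reshape_index lam i]].

(* The unique w with t^lam w = t_lam. *)
Definition w_part (lam : seq nat) : 'S_(sumn lam) :=
  odflt 1%g [pick w : 'S_(sumn lam) | [forall i,
    val (w i) == flatten_index (conj_part lam)
                   (reshape_offset lam i) (reshape_index lam i)]].

(* T i is the Hecke generator T_i, in any algebra containing the relevant     *)
(* Hecke algebra; q and Q are the parameters v and \tilde v. The analogue     *)
(* with indices shifted by a is obtained from fun i => T (a + i).             *)
Section HeckeElements.
Variables (R : comUnitRingType) (H : algType R) (T : nat -> H) (Q q : R).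

Definition TwA (k : nat) (w : 'S_k) : H :=
  \prod_(i <- redword (@gensA k) w) T i.+1.

Definition TwB (n : nat) (w : {perm bool * 'I_n}) : H :=
  \prod_(i <- redword (@gensB n) w) T i.

Definition x_el (lam : seq nat) : H := \sum_(w in young lam) TwA w.

Definition y_el (lam : seq nat) : H :=
  \sum_(w in young lam) (- q) ^- coxlen (@gensA (sumn lam)) w *: TwA w.

Definition z_el (lam : seq nat) : H :=
  x_el lam * TwA (w_part lam) * y_el (conj_part lam).

Definition dual_z_el (lam : seq nat) : H :=
  y_el (conj_part lam) * TwA (w_part (conj_part lam)) * x_el lam.

(* T_{i-1} ... T_1 T_0 T_1 ... T_{i-1}, for i >= 1. *)
Definition murphy (i : nat) : H :=
  (\prod_(1 <= j < i) T (i - j)) * T 0%N * (\prod_(1 <= j < i) T j).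

Definition u_plus (k : nat) : H :=
  \prod_(1 <= i < k.+1) ((q ^+ i.-1)%:A + murphy i).

Definition u_minus (k : nat) : H :=
  \prod_(1 <= i < k.+1) ((Q * q ^+ i.-1)%:A - murphy i).

Definition h_ab (n a b : nat) : H := TwA (w_ab n a b).

(* u_{n-a}^- h_{n-a,a} u_a^+ *)
Definition uhu (n a : nat) : H :=
  u_minus (n - a) * h_ab n (n - a) a * u_plus a.

(* Unital subalgebra generated by S. *)
Inductive subalg (S : H -> Prop) : H -> Prop :=
| subalg_gen x : S x -> subalg S x
| subalg_scalar c : subalg S c%:A
| subalg_add x y : subalg S x -> subalg S y -> subalg S (x + y)
| subalg_mul x y : subalg S x -> subalg S y -> subalg S (x * y).

Definition hecke_sub (J : pred nat) : H -> Prop :=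
  subalg (fun x => exists2 i, J i & x = T i).

(* The right ideal x B. *)
Definition right_ideal (B : H -> Prop) (x : H) : H -> Prop :=
  fun y => exists2 h, B h & y = x * h.

End HeckeElements.

Definition specht_gen (R : comUnitRingType) (H : algType R) (T : nat -> H)
    (Q q : R) (n : nat) (lam1 lam2 : seq nat) : H :=
  let a := sumn lam1 in
  uhu T Q q n a * z_el T q lam1 * z_el (fun i => T (a + i)%N) q lam2.

Section SchurElements.
Variables (K : fieldType) (H : algType K).

(* Matrices act on row vectors from the right, so that these are the          *)
(* finite-dimensional right H-modules.                                        *)
Definition is_rep (d : nat) (rho : H -> 'M[K]_d) : Prop :=
  [/\ forall c x y, rho (c *: x + y) = c *: rho x + rho y,
      rho 1 = 1%:M & forall x y, rho (x * y) = rho x *m rho y].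

Definition irreducible_rep (d : nat) (rho : H -> 'M[K]_d) : Prop :=
  (0 < d)%N /\
  forall U : 'M[K]_d, (forall h, stablemx U (rho h)) -> U = 0 \/ row_full U.

Definition irreducible_char (chi : H -> K) : Prop :=
  exists (d : nat) (rho : H -> 'M[K]_d),
    [/\ is_rep rho, irreducible_rep rho & forall h, chi h = \tr (rho h)].

(* The matrix representation rho is isomorphic to the right submodule N of H. *)
Definition affords (N : H -> Prop) (d : nat) (rho : H -> 'M[K]_d) : Prop :=
  exists phi : {linear 'rV[K]_d -> H},
    [/\ injective phi, forall y, N y <-> exists x, y = phi x
      & forall x h, phi (x *m rho h) = phi x * h].

Definition char_of (N : H -> Prop) (chi : H -> K) : Prop :=
  exists (d : nat) (rho : H -> 'M[K]_d),
    [/\ is_rep rho, affords N rho & forall h, chi h = \tr (rho h)].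

(* tr is the sum of s_chi^-1 chi over the (finitely many, pairwise distinct)  *)
(* irreducible characters chi, and s is s_chi for the character chi of N.     *)
Definition is_schur_element (tr : H -> K) (N : H -> Prop) (s : K) : Prop :=
  exists (r : nat) (chi : 'I_r -> H -> K) (c : 'I_r -> K),
    [/\ injective chi,
        forall xi, irreducible_char xi <-> exists i, xi = chi i,
        forall i, c i != 0,
        forall h, tr h = \sum_(i < r) (c i)^-1 * chi i h
      & exists2 i, char_of N (chi i) & s = c i].

End SchurElements.

Definition is_traceA (K : fieldType) (k : nat) (q : K)
    (tr : {scalar heckeA k q}) : Prop :=
  forall w : 'S_k, tr (TwA (@TA K k q) w) = (w == 1%g)%:R.

Definition is_traceB (K : fieldType) (n : nat) (Q q : K)
    (tr : {scalar heckeB n Q q}) : Prop :=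
  forall w, w \in weylB n -> tr (TwB (@TB K n Q q) w) = (w == 1%g)%:R.

Definition schurA (lam : seq nat) (s : A) : Prop :=
  let q : {fraction A} := v%:F in
  let k := sumn lam in
  let T := @TA _ k q in
  exists tr : {scalar heckeA k q}, is_traceA tr /\
    is_schur_element tr (right_ideal (fun=> True) (z_el T q lam)) s%:F.

Definition schurB (n : nat) (lam1 lam2 : seq nat) (s : A2) : Prop :=
  let q : {fraction A2} := v2%:F in
  let Q : {fraction A2} := tv2%:F in
  let T := @TB _ n Q q in
  exists tr : {scalar heckeB n Q q}, is_traceB tr /\
    is_schur_element tr
      (right_ideal (fun=> True) (specht_gen T Q q n lam1 lam2)) s%:F.

(* z is a central element z_{a,n-a} of H_v(S_(a,n-a)), taken inside H_v(B_n). *)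
Definition is_z_ab (n a : nat) (z : heckeB n 1 v) : Prop :=
  let T := @TB A n 1 v in
  let L := hecke_sub T (fun i => (0 < i < n) && (i != a))%N in
  let E := uhu T 1 v n a in
  [/\ L z, forall y, L y -> z * y = y * z
    & E * h_ab T n a (n - a) * E = E * z].

(* H_v(S_(a,n-a)) is the tensor product of the commuting subalgebras          *)
(* H_v(S_a) and H_v(S_{a+1..n}) through the multiplication map, and           *)
(* S_{lam1} (x) \hat S_{lam2} is the span of the products m1 m2 in it.        *)
Definition f_scalar (n : nat) (lam1 lam2 : seq nat) (f : A) : Prop :=
  let a := sumn lam1 in
  let T := @TB A n 1 v in
  let S1 := right_ideal (hecke_sub T (fun i => 0 < i < a)%N)
              (dual_z_el T v lam1) in
  let S2 := right_ideal (hecke_sub T (fun i => a < i < n)%N)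
              (dual_z_el (fun i => T (a + i)%N) v lam2) in
  exists2 z, is_z_ab a z &
    forall m1 m2, S1 m1 -> S2 m2 -> m1 * m2 * z = f *: (m1 * m2).

(* Main.v *)
From HB Require Import structures.
Require Import Defs.
From mathcomp Require Import all_boot all_order all_algebra.
From mathcomp Require Import fraction all_fingroup generic_quotient boolp zify ring.

(* If x generates a right ideal xH affording an irreducible character with    *)
(* Schur element s, and x H x is a line, then x h x = s tr(x h) x for all h.  *)
(* Let z_i be the generators z_lambda of the two type A Specht modules, E =   *)
(* u^- h u^+, x = E z_1 z_2, and h = T_{w_1} T_{w_2} h_{a,n-a}, with w_i such  *)
(* that T_1 has nonzero coefficient t_i in z_i T_{w_i}.  In type A the corner *)
(* formula reads z_i T_{w_i} z_i = s_i t_i z_i.  In type B, comparing signs   *)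
(* of the signed permutations occurring in E gives                            *)
(* tr(x h) = V^a' v^(n(n-1)/2) t_1 t_2, where V is the second parameter and   *)
(* a' = n - a; this descends from the fraction field to the integral form,    *)
(* where V = 1 can be put.  There E h_{a,n-a} E = E z with z central in the   *)
(* parabolic subalgebra, so x h x = s_1 t_1 s_2 t_2 f x, the scalar f coming  *)
(* from the dual Specht modules since s_i t_i z_i is a multiple of an element *)
(* p m with m in the dual Specht module.  Comparing the two values of x h x   *)
(* proves the formula, provided that x has no torsion after V = 1.            *)

Set Implicit Arguments.
Unset Strict Implicit.
Unset Printing Implicit Defensive.

Import GRing.Theory.
Local Open Scope ring_scope.
Local Open Scope quotient_scope.

(** * Coxeter length, Matsumoto's theorem and standard bases *)

Section LengthFunction.
Variables (gT : finGroupType) (r : nat) (s : 'I_r -> gT) (W : {set gT}).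
Variables (len : gT -> nat) (desc : 'I_r -> gT -> bool).

Record coxeter_length : Prop := CoxeterLength {
  cox1 : 1%g \in W;
  coxM : forall i w, w \in W -> (s i * w)%g \in W;
  cox_invol : forall i, (s i * s i = 1)%g;
  cox_len1 : len 1%g = 0%N;
  cox_up : forall i w, w \in W -> ~~ desc i w -> len (s i * w)%g = (len w).+1;
  cox_desc : forall i w, w \in W -> desc i (s i * w)%g = ~~ desc i w;
  cox_nodesc : forall w, w \in W -> (forall i, ~~ desc i w) -> w = 1%g }.

Hypothesis cox : coxeter_length.
Local Notation wp := (wordprod s).

Lemma wordprod_cons i t : wp (i :: t) = (s i * wp t)%g.
Proof. by rewrite /wordprod big_cons. Qed.

Lemma wordprod_nil : wp [::] = 1%g.
Proof. by rewrite /wordprod big_nil. Qed.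

Lemma wordprod_cat t u : wp (t ++ u) = (wp t * wp u)%g.
Proof. by rewrite /wordprod big_cat. Qed.

Lemma cox_invK i w : (s i * (s i * w) = w)%g.
Proof. by rewrite mulgA (cox_invol cox) mul1g. Qed.

Lemma cox_sV i : ((s i)^-1 = s i)%g.
Proof. by apply/eqP; rewrite eq_invg_mul (cox_invol cox). Qed.

Lemma wordprod_rev t : wp (rev t) = (wp t)^-1%g.
Proof.
elim: t => [|i t IH]; first by rewrite wordprod_nil invg1.
by rewrite rev_cons -cats1 wordprod_cat IH !wordprod_cons wordprod_nil mulg1
           invMg cox_sV.
Qed.

Lemma wordprodW t : wp t \in W.
Proof.
elim: t => [|i t IH]; first by rewrite wordprod_nil (cox1 cox).
by rewrite wordprod_cons (coxM cox).
Qed.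

Lemma cox_down i w : w \in W -> desc i w -> len w = (len (s i * w)%g).+1.
Proof.
move=> wW d; rewrite -(cox_up cox (i := i)) ?cox_invK ?(coxM cox) //.
by rewrite (cox_desc cox) ?negbK.
Qed.

Lemma len_wordprod t : (len (wp t) <= size t)%N.
Proof.
elim: t => [|i t IH] /=; first by rewrite wordprod_nil (cox_len1 cox).
rewrite wordprod_cons; have tW := wordprodW t.
case d: (desc i (wp t)); last by rewrite (cox_up cox) ?d.
by move: IH; rewrite (cox_down tW d) => /ltnW/leq_trans; apply.
Qed.

Definition reduced t := size t == len (wp t).

Lemma reduced_tail i t : reduced (i :: t) -> reduced t.
Proof.
rewrite /reduced wordprod_cons /= => /eqP e; have tW := wordprodW t.
rewrite eqn_leq len_wordprod andbT -ltnS e.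
case d: (desc i (wp t)); last by rewrite (cox_up cox) ?d.
by rewrite (leq_trans _ (leqnSn _)) // (cox_down tW d) ltnW // ltnS.
Qed.

Lemma reduced_drop j t : reduced t -> reduced (drop j t).
Proof.
elim: j t => [|j IH] [|i t] //= rt.
by apply: IH; apply: reduced_tail rt.
Qed.

Lemma reduced_desc i t : reduced (i :: t) -> desc i (wp (i :: t)).
Proof.
move=> rt; have /eqP rt' := reduced_tail rt; move/eqP: rt.
rewrite wordprod_cons => /= e; rewrite (cox_desc cox) ?wordprodW //.
apply/negP => d; move: (cox_down (wordprodW t) d); rewrite -rt' -e; lia.
Qed.

Lemma reduced_word_exists w : w \in W -> exists2 t, reduced t & wp t = w.
Proof.
move: {2}(len w) (leqnn (len w)) => l.
elim: l w => [|l IH] w lw wW; case: (pickP (desc^~ w)) => [i /= d|nd].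
- by move: lw; rewrite (cox_down wW d).
- exists [::]; last by rewrite wordprod_nil (cox_nodesc cox wW) // => i; rewrite nd.
  by rewrite /reduced wordprod_nil (cox_len1 cox).
- have [t /eqP rt tw] : exists2 t, reduced t & wp t = (s i * w)%g.
    by apply: IH; rewrite ?(coxM cox) // -ltnS -(cox_down wW d).
  exists (i :: t); rewrite /reduced wordprod_cons tw cox_invK //=.
  by rewrite rt tw -(cox_down wW d).
- exists [::]; last by rewrite wordprod_nil (cox_nodesc cox wW) // => i; rewrite nd.
  by rewrite /reduced wordprod_nil (cox_len1 cox).
Qed.

Lemma groupW w : w \in W -> (w^-1)%g \in W.
Proof.
by move=> /reduced_word_exists[t _ <-]; rewrite -wordprod_rev wordprodW.
Qed.

Lemma mulW w u : w \in W -> u \in W -> (w * u)%g \in W.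
Proof.
move=> /reduced_word_exists[t _ <-] /reduced_word_exists[t' _ <-].
by rewrite -wordprod_cat wordprodW.
Qed.

Lemma lenV w : w \in W -> len (w^-1)%g = len w.
Proof.
have le u : u \in W -> (len (u^-1)%g <= len u)%N.
  move=> /reduced_word_exists[t /eqP rt <-].
  by rewrite -rt -wordprod_rev -(size_rev t) len_wordprod.
by move=> wW; apply/eqP; rewrite eqn_leq le //= -{1}(invgK w) le // groupW.
Qed.

Lemma coxlen_bound w : w \in W -> (len w < #|gT|)%N.
Proof.
move=> /reduced_word_exists[t rt <-].
have f_inj : injective (fun j : 'I_(size t).+1 => wp (drop j t)).
  move=> i j /(congr1 len).
  have /eqP <- := reduced_drop i rt; have /eqP <- := reduced_drop j rt.
  rewrite !size_drop => e; apply: val_inj => /=.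
  move: (ltn_ord i) (ltn_ord j) e; rewrite !ltnS => le_i le_j e.
  by rewrite -(subKn le_i) e subKn.
by have := leq_card _ f_inj; rewrite card_ord -(eqP rt).
Qed.

Lemma coxlenE w : w \in W -> coxlen s w = len w.
Proof.
move=> wW; rewrite /coxlen; set a := (fun l => _).
have aP l : reflect (exists2 t, size t = l & wp t = w) (a l).
  apply: (iffP existsP) => [[t /eqP tw]|[t tl tw]].
    by exists t; rewrite ?size_tuple.
  have st : size t == l by apply/eqP.
  by exists (Tuple st); apply/eqP.
have al : a (len w).
  have [t /eqP rt tw] := reduced_word_exists wW.
  by apply/aP; exists t => //; rewrite rt tw.
have lw := coxlen_bound wW.
have ha : has a (iota 0 #|gT|) by apply/hasP; exists (len w); rewrite ?mem_iota.
have := nth_find 0%N ha; move: ha; rewrite has_find size_iota => lf.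
rewrite nth_iota // add0n => /aP[t tl tw].
apply/eqP; rewrite eqn_leq -{2}tw -tl len_wordprod andbT tl leqNgt.
apply/negP => /(before_find 0%N); rewrite nth_iota ?add0n ?al //.
Qed.

Lemma redwordP w : w \in W -> reduced (redword s w) /\ wp (redword s w) = w.
Proof.
move=> wW; rewrite /redword; case: pickP => [t /eqP tw|none].
  by rewrite /reduced tw size_tuple coxlenE.
have [t /eqP rt tw] := reduced_word_exists wW.
have st : size t == coxlen s w by rewrite rt tw coxlenE.
by have := none (Tuple st); rewrite /= tw eqxx.
Qed.

(* [i :: a] and [j :: b] are the two reduced words of the longest element of  *)
(* the dihedral group generated by [s i] and [s j].                           *)
Definition braid_compatible (H : nzRingType) (T : 'I_r -> H) : Prop :=
  forall i j w, w \in W -> i != j -> desc i w -> desc j w ->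
  exists a b w', [/\ w' \in W,
    w = (wp (i :: a) * w')%g /\ w = (wp (j :: b) * w')%g,
    size a = size b, len w = ((size a).+1 + len w')%N
    & \prod_(k <- i :: a) T k = \prod_(k <- j :: b) T k].

Lemma braid_compatible_lt (H : nzRingType) (T : 'I_r -> H) :
  (forall (i j : 'I_r) w, w \in W -> (i < j)%N -> desc i w -> desc j w ->
  exists a b w', [/\ w' \in W,
    w = (wp (i :: a) * w')%g /\ w = (wp (j :: b) * w')%g,
    size a = size b, len w = ((size a).+1 + len w')%N
    & \prod_(k <- i :: a) T k = \prod_(k <- j :: b) T k]) ->
  braid_compatible T.
Proof.
move=> h i j w wW; rewrite neq_ltn => /orP[ij|ji] di dj; first exact: h.
have [a [b [w' [w'W [e1 e2] sab lw Tab]]]] := h j i w wW ji dj di.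
by exists b, a, w'; split=> //; rewrite -sab.
Qed.

Section Matsumoto.
Variables (H : nzRingType) (T : 'I_r -> H).
Hypothesis braidT : braid_compatible T.

Local Notation Tp t := (\prod_(k <- t) T k).

Lemma matsumoto t u : reduced t -> reduced u -> wp t = wp u -> Tp t = Tp u.
Proof.
move: {2}(size t) (leqnn (size t)) => l.
elim: l t u => [|l IH] [|i t] // [|j u] //= lt rt ru.
- by move=> e; move: ru; rewrite /reduced -e wordprod_nil (cox_len1 cox).
- by move=> e; move: ru; rewrite /reduced -e wordprod_nil (cox_len1 cox).
- by move=> e; move: rt; rewrite /reduced e wordprod_nil (cox_len1 cox).
move=> e.
have rt' := reduced_tail rt; have ru' := reduced_tail ru.
have [ij|ij] := eqVneq i j.
  rewrite !big_cons ij; congr (_ * _); apply: IH => //.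
  by move: e; rewrite ij !wordprod_cons => /mulgI.
have di := reduced_desc rt; have dj := reduced_desc ru; rewrite -e in dj.
have [a [b [w' [w'W [e1 e2] sab lw Tab]]]] := braidT (wordprodW _) ij di dj.
have [c /eqP rc ec] := reduced_word_exists w'W.
have sz : size t = (size a + size c)%N.
  by move: rt; rewrite /reduced lw rc ec => /eqP /= [].
have et : wp t = wp (a ++ c).
  by move: e1; rewrite !wordprod_cons wordprod_cat ec -mulgA => /mulgI.
have eu : wp u = wp (b ++ c).
  by move: e2; rewrite e !wordprod_cons wordprod_cat ec -mulgA => /mulgI.
have szu : size u = size t by move: ru; rewrite /reduced -e -(eqP rt) => /eqP [].
have -> : Tp (i :: t) = Tp (i :: a) * Tp c.
  rewrite !big_cons -mulrA -big_cat; congr (_ * _); apply: IH => //.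
  by rewrite /reduced -et -(eqP rt') size_cat sz.
have -> : Tp (j :: u) = Tp (j :: b) * Tp c.
  rewrite !big_cons -mulrA -big_cat; congr (_ * _); apply: IH => //.
    by rewrite szu.
  by rewrite /reduced -eu -(eqP ru') szu size_cat sz sab.
by rewrite Tab.
Qed.

Definition Tw w := Tp (redword s w).

Lemma Tw_word t : reduced t -> Tp t = Tw (wp t).
Proof.
move=> rt; have [rr e] := redwordP (wordprodW t).
by apply: matsumoto => //; rewrite e.
Qed.

Lemma Tw1 : Tw 1%g = 1.
Proof.
have <- : wp [::] = 1%g by apply: wordprod_nil.
by rewrite -Tw_word ?big_nil // /reduced wordprod_nil (cox_len1 cox).
Qed.

Lemma Tw_up i w : w \in W -> ~~ desc i w -> T i * Tw w = Tw (s i * w)%g.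
Proof.
move=> wW d; have [rr e] := redwordP wW.
have -> : T i * Tw w = Tp (i :: redword s w) by rewrite big_cons.
rewrite -{2}e -wordprod_cons Tw_word //.
by rewrite /reduced wordprod_cons e (cox_up cox) // /= (eqP rr) e.
Qed.

Lemma Tw_upr i w : w \in W -> ~~ desc i (w^-1)%g -> Tw w * T i = Tw (w * s i)%g.
Proof.
move=> wW d; have [rr e] := redwordP wW.
have -> : Tw w * T i = Tp (redword s w ++ [:: i]) by rewrite big_cat big_seq1.
have ew : wp (redword s w ++ [:: i]) = (w * s i)%g.
  by rewrite wordprod_cat e wordprod_cons wordprod_nil mulg1.
rewrite -ew Tw_word // /reduced ew size_cat addn1 (eqP rr) e.
rewrite -(lenV (mulW wW _)) ?invMg ?cox_sV.
  by rewrite (cox_up cox) ?lenV ?groupW.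
by rewrite -[s i]mulg1 (coxM cox) ?(cox1 cox).
Qed.

Lemma Tw_down i w : w \in W -> desc i w -> Tw w = T i * Tw (s i * w)%g.
Proof.
move=> wW d; rewrite Tw_up ?cox_invK ?(coxM cox) //.
by rewrite (cox_desc cox) ?negbK.
Qed.

Lemma genW i : s i \in W.
Proof. by rewrite -[s i]mulg1 (coxM cox) ?(cox1 cox). Qed.

Lemma cox_descV i w :
  w \in W -> desc i ((w * s i)^-1)%g = ~~ desc i (w^-1)%g.
Proof. by move=> wW; rewrite invMg cox_sV (cox_desc cox) ?groupW. Qed.

Lemma cox_downr i w : w \in W -> desc i (w^-1)%g ->
  len w = (len (w * s i)%g).+1.
Proof.
move=> wW d; rewrite -(lenV wW) (cox_down (groupW wW) d).
by rewrite -(lenV (mulW wW (genW i))) invMg cox_sV.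
Qed.

Lemma Tw_downr i w : w \in W -> desc i (w^-1)%g -> Tw w = Tw (w * s i)%g * T i.
Proof.
move=> wW d; rewrite Tw_upr ?mulW ?genW ?cox_descV ?d //.
by rewrite -mulgA (cox_invol cox) mulg1.
Qed.

End Matsumoto.

Section Standard.
Variables (R : comNzRingType) (H : algType R) (T : 'I_r -> H) (q : 'I_r -> R).
Hypothesis braidT : braid_compatible T.
Hypothesis quadT : forall i, T i * T i = (q i - 1) *: T i + (q i)%:A.

Lemma Tw_quad i w : w \in W -> desc i w ->
  T i * Tw T w = q i *: Tw T (s i * w)%g + (q i - 1) *: Tw T w.
Proof.
move=> wW d; rewrite (Tw_down braidT wW d) mulrA quadT mulrDl -scalerAl addrC.
by rewrite -scalerAl mul1r (Tw_up braidT (coxM cox i wW)) ?cox_invK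
   ?(cox_desc cox) ?d.
Qed.

Definition Tspan (P : pred gT) (x : H) : Prop :=
  exists c : gT -> R, x = \sum_(w in W | P w) c w *: Tw T w.

Lemma Tspan0 P : Tspan P 0.
Proof. by exists (fun=> 0); rewrite big1 // => w _; rewrite scale0r. Qed.

Lemma TspanD P x y : Tspan P x -> Tspan P y -> Tspan P (x + y).
Proof.
move=> [c ->] [d ->]; exists (fun w => c w + d w).
by rewrite -big_split; apply: eq_bigr => w _; rewrite scalerDl.
Qed.

Lemma TspanZ P a x : Tspan P x -> Tspan P (a *: x).
Proof.
move=> [c ->]; exists (fun w => a * c w).
by rewrite scaler_sumr; apply: eq_bigr => w _; rewrite scalerA.
Qed.

Lemma Tspan_Tw (P : pred gT) w : w \in W -> P w -> Tspan P (Tw T w).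
Proof.
move=> wW Pw; exists (fun u => (u == w)%:R).
rewrite (bigD1 w) ?wW //= eqxx scale1r big1 ?addr0 // => u /andP[_ /negPf->].
by rewrite scale0r.
Qed.

Lemma Tspan_ind (P : pred gT) (K : H -> Prop) :
  K 0 -> (forall x y, K x -> K y -> K (x + y)) ->
  (forall a x, K x -> K (a *: x)) ->
  (forall w, w \in W -> P w -> K (Tw T w)) -> forall x, Tspan P x -> K x.
Proof.
move=> K0 KD KZ KT x [c ->]; apply: big_ind => // w /andP[wW Pw].
by apply: KZ; apply: KT.
Qed.

Lemma Tspan_sub (P Q : pred gT) x :
  (forall w, w \in W -> P w -> Q w) -> Tspan P x -> Tspan Q x.
Proof.
move=> PQ; apply: (Tspan_ind (K := Tspan Q)) => [|y z|a y|w wW Pw];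
  first exact: Tspan0.
- exact: TspanD.
- exact: TspanZ.
- by apply: Tspan_Tw => //; apply: PQ.
Qed.

Lemma Tspan_map (P Q : pred gT) y :
  (forall w, w \in W -> P w -> Tspan Q (y * Tw T w)) ->
  forall x, Tspan P x -> Tspan Q (y * x).
Proof.
move=> h x; apply: (Tspan_ind (K := fun x => Tspan Q (y * x)))
    => [|u z hu hz|a u hu|w]; last exact: h.
- by rewrite mulr0; apply: Tspan0.
- by rewrite mulrDr; apply: TspanD.
- by rewrite -scalerAr; apply: TspanZ.
Qed.

Lemma Tspan_gen i x : Tspan predT x -> Tspan predT (T i * x).
Proof.
apply: Tspan_map => w wW _; case d: (desc i w).
  rewrite Tw_quad //; apply: TspanD; apply: TspanZ; apply: Tspan_Tw => //.
  exact: coxM.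
by rewrite Tw_up ?d //; apply: Tspan_Tw => //; apply: coxM.
Qed.

Section Trace.
Variable tr : H -> R.
Hypothesis tr_lin : forall a x y, tr (a *: x + y) = a * tr x + tr y.
Hypothesis trT : forall w, w \in W -> tr (Tw T w) = (w == 1%g)%:R.

Lemma tr0 : tr 0 = 0.
Proof.
have := tr_lin 1 0 0; rewrite scaler0 addr0 mul1r => /eqP.
by rewrite -subr_eq subrr eq_sym => /eqP.
Qed.

Lemma trZ a x : tr (a *: x) = a * tr x.
Proof. by rewrite -[a *: x]addr0 tr_lin tr0 addr0. Qed.

Lemma trD x y : tr (x + y) = tr x + tr y.
Proof. by rewrite -[x]scale1r tr_lin mul1r scale1r. Qed.

Lemma tr_sum I (l : seq I) (P : pred I) F :
  tr (\sum_(i <- l | P i) F i) = \sum_(i <- l | P i) tr (F i).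
Proof. exact: (big_morph tr trD tr0). Qed.

Lemma tr_word t w : reduced t -> w \in W ->
  tr ((\prod_(k <- t) T k) * Tw T w) =
  (wp t * w == 1)%g%:R * \prod_(k <- t) q k.
Proof.
elim/last_ind: t w => [|t i IH] w rt wW.
  by rewrite !big_nil wordprod_nil mul1r mul1g trT // mulr1.
have rt' : reduced t.
  move: rt; rewrite /reduced -cats1 wordprod_cat wordprod_cons wordprod_nil.
  rewrite mulg1 size_cat addn1 => /eqP e.
  rewrite eqn_leq len_wordprod andbT -ltnS e.
  rewrite -(lenV (mulW (wordprodW t) (genW i))) invMg cox_sV.
  have tW := groupW (wordprodW t); rewrite -(lenV (wordprodW t)).
  case d: (desc i (wp t)^-1%g); last by rewrite (cox_up cox) ?d.
  by rewrite (cox_down tW d); apply: leqW (leqnSn _).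
have lt : len (wp (rcons t i))^-1%g = (size t).+1.
  by rewrite lenV ?wordprodW // -(eqP rt) size_rcons.
have lt' : len (wp t)^-1%g = size t by rewrite lenV ?wordprodW // (eqP rt').
have ep : wp (rcons t i) = (wp t * s i)%g.
  by rewrite -cats1 wordprod_cat wordprod_cons wordprod_nil mulg1.
rewrite !big_rcons /= -mulrA.
case d: (desc i w).
  rewrite Tw_quad // mulrDr -!scalerAr trD !trZ !IH ?(coxM cox) //.
  have -> : (wp t * w == 1)%g = false.
    apply/negP => /eqP e; have {}e : w = (wp t)^-1%g.
      by apply/eqP; rewrite eq_sym eq_invg_mul e.
    have es : (s i * (wp t)^-1 = (wp (rcons t i))^-1)%g.
      by rewrite ep invMg cox_sV.
    by move: (cox_down wW d); rewrite e es lt lt' => /eqP; rewrite ltn_eqF // ltnW.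
  by rewrite mul0r mulr0 addr0 ep mulgA; ring.
rewrite Tw_up ?d // IH ?(coxM cox) // mulgA -ep.
have -> : (wp (rcons t i) * w == 1)%g = false.
  apply/negP => /eqP e; have {}e : w = (wp (rcons t i))^-1%g.
    by apply/eqP; rewrite eq_sym eq_invg_mul e.
  have := cox_up cox wW (negbT d); rewrite {2}e lt {1}e ep invMg cox_sV cox_invK.
  by rewrite lt' => /eqP; rewrite ltn_eqF // ltnW.
by rewrite !mul0r.
Qed.

Lemma tr_coef c w : w \in W ->
  tr (Tw T (w^-1)%g * \sum_(u in W) c u *: Tw T u) =
  c w * \prod_(k <- redword s (w^-1)%g) q k.
Proof.
move=> wW; have [rr e] := redwordP (groupW wW).
rewrite mulr_sumr tr_sum (bigD1 w) //= -scalerAr trZ tr_word // e mulVg eqxx.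
rewrite mul1r [X in _ + X]big1 ?addr0 // => u /andP[uW uw].
rewrite -scalerAr trZ tr_word // e -eq_invg_mul invgK eq_sym (negPf uw).
by rewrite mul0r mulr0.
Qed.

Lemma Tw_independent c : (forall i, q i != 0) -> GRing.integral_domain_axiom R ->
  \sum_(u in W) c u *: Tw T u = 0 -> forall w, w \in W -> c w = 0.
Proof.
move=> qn0 dom e w wW; have := tr_coef c wW; rewrite e mulr0 tr0 => /esym.
move=> /dom/orP[/eqP //|].
suff /negPf -> : \prod_(k <- redword s w^-1%g) q k != 0 by [].
elim: (redword _ _) => [|k l IH]; first by rewrite big_nil oner_neq0.
rewrite big_cons; apply/negP => /eqP/dom/orP[] h; first by move: (qn0 k); rewrite h.
by rewrite h in IH.
Qed.

Lemma tr_nondegenerate : (forall i, q i != 0) -> GRing.integral_domain_axiom R ->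
  forall x, Tspan predT x -> (forall h, tr (h * x) = 0) -> x = 0.
Proof.
move=> qn0 dom x [c ex] trx.
have {}ex : x = \sum_(u in W) c u *: Tw T u.
  by rewrite ex; apply: eq_bigl => u; rewrite andbT.
rewrite ex big1 // => w wW.
have := tr_coef c wW; rewrite -ex trx => /esym/dom/orP[/eqP->|].
  by rewrite scale0r.
suff /negPf -> : \prod_(k <- redword s w^-1%g) q k != 0 by [].
elim: (redword _ _) => [|k l IH]; first by rewrite big_nil oner_neq0.
rewrite big_cons; apply/negP => /eqP/dom/orP[] h; first by move: (qn0 k); rewrite h.
by rewrite h in IH.
Qed.

End Trace.
End Standard.
End LengthFunction.

(** * Types A and B by inversions *)

Section Inversions.
Variables (X : finType) (rk : X -> nat).
Hypothesis rk_inj : injective rk.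
Implicit Type w : {perm X}.

Definition inversions w : {set X * X} :=
  [set p | (rk p.1 < rk p.2)%N && (rk (w p.2) < rk (w p.1))%N].

Lemma inversions_up x y w : rk y = (rk x).+1 -> (rk (w x) < rk (w y))%N ->
  #|inversions (tperm x y * w)%g| = #|inversions w|.+1.
Proof.
move=> rxy wxy; set t := tperm x y.
pose f (p : X * X) := (t p.1, t p.2).
have f_inj : injective f.
  by move=> [a b] [c d] [] /perm_inj -> /perm_inj ->.
have xNy : x != y by apply/eqP => e; move: rxy; rewrite e; lia.
suff -> : inversions (t * w)%g = (x, y) |: (f @^-1: inversions w).
  rewrite cardsU1 card_preimset // !inE /f /= tpermL tpermR rxy.
  by rewrite ltnNge leqnSn.
apply/setP => -[a b]; rewrite !inE /f /= !permM xpair_eqE.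
have rE u z : (u == z) = (rk u == rk z) by rewrite (inj_eq rk_inj).
move: xNy; rewrite /t !rE.
by case: tpermP => [->|->|/eqP + /eqP +]; case: tpermP => [->|->|/eqP + /eqP +];
   rewrite ?rE; lia.
Qed.

Lemma inversions1 : inversions 1%g = set0.
Proof. by apply/setP => p; rewrite !inE !perm1; lia. Qed.

Lemma increasing_perm1 w :
  (forall x y, (rk x < rk y)%N -> (rk (w x) < rk (w y))%N) -> w = 1%g.
Proof.
move=> mono; apply/permP => x; rewrite perm1.
have mE a b : (rk (w a) < rk (w b))%N = (rk a < rk b)%N.
  apply/idP/idP; last exact: mono.
  case: (ltngtP (rk a) (rk b)) => // [/mono|/rk_inj->]; last by rewrite ltnn.
  by move=> /ltnW; rewrite ltnNge => ->.
pose below z : {set X} := [set y | (rk y < rk z)%N].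
have cb : #|below (w x)| = #|below x|.
  rewrite -(card_preimset (below (w x)) (@perm_inj _ w)).
  by apply: eq_card => y; rewrite !inE mE.
have lt a b : (rk a < rk b)%N -> (#|below a| < #|below b|)%N.
  move=> ab; apply: proper_card; apply/properP; split.
    by apply/subsetP => y; rewrite !inE => /ltn_trans; apply.
  by exists a; rewrite !inE ?ltnn.
by case: (ltngtP (rk (w x)) (rk x)) => [/lt|/lt|/rk_inj //];
   rewrite cb ltnn.
Qed.

Lemma increasing_adjacent N w :
  (forall x, (rk x < N)%N) -> (forall m, (m < N)%N -> exists x, rk x = m) ->
  (forall x y, rk y = (rk x).+1 -> (rk (w x) < rk (w y))%N) -> w = 1%g.
Proof.
move=> rkN rks adj; apply: increasing_perm1 => x y.
have [d] := ubnP (rk y - rk x); elim: d x => // d IH x dl xy.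
have [z rz] : exists z, rk z = (rk x).+1.
  by apply: rks; apply: leq_ltn_trans xy (rkN y).
have xz := adj _ _ rz.
have [/eqP|ne] := eqVneq (rk z) (rk y).
  by rewrite (inj_eq rk_inj) => /eqP <-.
by apply: ltn_trans xz (IH z _ _); move/eqP: ne; rewrite ?rz; lia.
Qed.

Lemma tperm_braid (x y z : X) : x != y -> y != z -> x != z ->
  (tperm x y * tperm y z * tperm x y = tperm y z * tperm x y * tperm y z)%g.
Proof.
move=> xy yz xz.
have -> : (tperm x y * tperm y z * tperm x y = tperm y z ^ tperm x y)%g.
  by rewrite conjgE tpermV mulgA.
have -> : (tperm y z * tperm x y * tperm y z = tperm x y ^ tperm y z)%g.
  by rewrite conjgE tpermV mulgA.
by rewrite !tpermJ tpermR tpermL !tpermD 1?eq_sym // 1?eq_sym.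
Qed.

Lemma tperm_comm (x y z t : X) : x != z -> x != t -> y != z -> y != t ->
  (tperm x y * tperm z t = tperm z t * tperm x y)%g.
Proof.
move=> xz xt yz yt; apply/esym/eqP; rewrite (sameP eqP commgP).
by apply/conjg_fixP; rewrite tpermJ !tpermD.
Qed.

End Inversions.

Section BraidPatterns.
Variables (gT : finGroupType) (r : nat) (s : 'I_r -> gT) (W : {set gT}).
Variables (len : gT -> nat) (desc : 'I_r -> gT -> bool).
Hypothesis cox : coxeter_length s W len desc.
Variables (H : nzRingType) (T : 'I_r -> H).

Definition braid_step (i j : 'I_r) w := exists a b w', [/\ w' \in W,
  w = (wordprod s (i :: a) * w')%g /\ w = (wordprod s (j :: b) * w')%g,
  size a = size b, len w = ((size a).+1 + len w')%N
  & \prod_(k <- i :: a) T k = \prod_(k <- j :: b) T k].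

Local Notation wE := (wordprod_cons, wordprod_nil, mulg1).

Lemma braid_step2 i j w : w \in W -> (s i * s j = s j * s i)%g ->
  T i * T j = T j * T i -> desc i w -> desc j (s i * w)%g -> braid_step i j w.
Proof.
move=> wW sij Tij di dj; have w1 := coxM cox i wW; have w2 := coxM cox j w1.
exists [:: j], [:: i], (s j * (s i * w))%g; split=> //.
- have e : w = (s i * s j * (s j * (s i * w)))%g.
    by rewrite -!mulgA !(cox_invK cox).
  by rewrite !wE -sij.
- by rewrite (cox_down cox wW di) (cox_down cox w1 dj).
- by rewrite !big_cons !big_nil !mulr1.
Qed.

Lemma braid_step3 i j w : w \in W -> (s i * s j * s i = s j * s i * s j)%g ->
  T i * T j * T i = T j * T i * T j ->
  desc i w -> desc j (s i * w)%g -> desc i (s j * (s i * w))%g ->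
  braid_step i j w.
Proof.
move=> wW sij Tij d1 d2 d3; have w1 := coxM cox i wW.
have w2 := coxM cox j w1; have w3 := coxM cox i w2.
exists [:: j; i], [:: i; j], (s i * (s j * (s i * w)))%g; split=> //.
- have e : w = (s i * s j * s i * (s i * (s j * (s i * w))))%g.
    by rewrite -!mulgA !(cox_invK cox).
  by rewrite !wE !mulgA -sij -!mulgA !(cox_invK cox).
- by rewrite (cox_down cox wW d1) (cox_down cox w1 d2) (cox_down cox w2 d3).
- by rewrite !big_cons !big_nil !mulr1 !mulrA.
Qed.

Lemma braid_step4 i j w : w \in W ->
  (s i * s j * s i * s j = s j * s i * s j * s i)%g ->
  T i * T j * T i * T j = T j * T i * T j * T i ->
  desc i w -> desc j (s i * w)%g -> desc i (s j * (s i * w))%g ->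
  desc j (s i * (s j * (s i * w)))%g -> braid_step i j w.
Proof.
move=> wW sij Tij d1 d2 d3 d4; have w1 := coxM cox i wW.
have w2 := coxM cox j w1; have w3 := coxM cox i w2; have w4 := coxM cox j w3.
exists [:: j; i; j], [:: i; j; i], (s j * (s i * (s j * (s i * w))))%g.
split=> //.
- by rewrite !wE !mulgA -sij -!mulgA !(cox_invK cox).
- rewrite (cox_down cox wW d1) (cox_down cox w1 d2) (cox_down cox w2 d3).
  by rewrite (cox_down cox w3 d4).
- by rewrite !big_cons !big_nil !mulr1 !mulrA.
Qed.

End BraidPatterns.

Section Relations.
Variables (R : comNzRingType) (H : algType R) (T : nat -> H).

Record relsA (k : nat) (q : R) : Prop := RelsA {
  relsA_quad : forall i, (0 < i < k)%N -> T i * T i = (q - 1) *: T i + q%:A;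
  relsA_braid : forall i, (0 < i)%N -> (i.+1 < k)%N ->
    T i * T i.+1 * T i = T i.+1 * T i * T i.+1;
  relsA_comm : forall i j, (0 < i)%N -> (i.+1 < j < k)%N ->
    T i * T j = T j * T i }.

Record relsB (n : nat) (Q q : R) : Prop := RelsB {
  relsB_A : relsA n q;
  relsB_quad : (0 < n)%N -> T 0%N * T 0%N = (Q - 1) *: T 0%N + Q%:A;
  relsB_braid : (1 < n)%N ->
    T 0%N * T 1%N * T 0%N * T 1%N = T 1%N * T 0%N * T 1%N * T 0%N;
  relsB_comm : forall j, (1 < j < n)%N -> T 0%N * T j = T j * T 0%N }.

End Relations.

Lemma relsA_shift (R : comNzRingType) (H : algType R) (T : nat -> H) n q a k :
  (a + k <= n)%N -> relsA T n q -> relsA (fun i => T (a + i)%N) k q.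
Proof.
move=> akn [qd br cm]; split=> [i hi|i i0 hi|i j i0 hj].
- by apply: qd; lia.
- by rewrite addnS; apply: br; lia.
- by apply: cm; lia.
Qed.

Section TypeA.
Variable k : nat.

Lemma lo_subproof (i : 'I_k.-1) : (i < k)%N.
Proof. by have := ltn_ord i; lia. Qed.
Lemma hi_subproof (i : 'I_k.-1) : (i.+1 < k)%N.
Proof. by have := ltn_ord i; lia. Qed.
Definition lo i : 'I_k := Ordinal (lo_subproof i).
Definition hi i : 'I_k := Ordinal (hi_subproof i).

Lemma gensAE i : gensA i = tperm (lo i) (hi i).
Proof.
rewrite /gensA /transp /= (insubT (fun m => m < k)%N (lo_subproof i)).
by rewrite (insubT (fun m => m < k)%N (hi_subproof i)).
Qed.

Definition lenA (w : 'S_k) := #|inversions val w|.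
Definition descA (i : 'I_k.-1) (w : 'S_k) := (w (hi i) < w (lo i))%N.

Lemma coxA : coxeter_length (@gensA k) setT lenA descA.
Proof.
split.
- exact: in_setT.
- by move=> i w _; apply: in_setT.
- by move=> i; rewrite gensAE tperm2.
- by rewrite /lenA inversions1 cards0.
- move=> i w _; rewrite /descA -leqNgt leq_eqVlt => /orP[/eqP/val_inj/perm_inj e|lt].
    by move/(congr1 val): e => /=; lia.
  by rewrite /lenA gensAE inversions_up //; apply: val_inj.
- move=> i w _; rewrite /descA gensAE !permM tpermL tpermR.
  have : w (lo i) != w (hi i).
    by rewrite (inj_eq perm_inj) -(inj_eq val_inj) /= ltn_eqF.
  by rewrite -(inj_eq val_inj) /=; lia.
- move=> w _ nd; apply: (@increasing_adjacent _ val val_inj k).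
  + by move=> x; apply: ltn_ord.
  + by move=> m lm; exists (Ordinal lm).
  + move=> x y /= exy.
    have li : (x < k.-1)%N by have := ltn_ord y; rewrite exy; lia.
    have := nd (Ordinal li); rewrite /descA -leqNgt leq_eqVlt.
    have -> : lo (Ordinal li) = x by apply: val_inj.
    have -> : hi (Ordinal li) = y by apply: val_inj; rewrite /= exy.
    case/orP => // /eqP/val_inj/perm_inj e.
    by move: exy; rewrite e; lia.
Qed.

Lemma coxlenA w : coxlen (@gensA k) w = lenA w.
Proof. by rewrite (coxlenE coxA) ?inE. Qed.

Variables (R : comNzRingType) (H : algType R) (T : nat -> H) (q : R).
Hypothesis TA : relsA T k q.

Lemma braidA : braid_compatible (@gensA k) setT lenA descA
  (fun i : 'I_k.-1 => T i.+1).
Proof.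
apply: braid_compatible_lt => i j w wW ij di dj.
have := hi_subproof j => jk.
have [ji|ji] := eqVneq (val j) i.+1.
  have hl : hi i = lo j by apply: val_inj; rewrite /= ji.
  have d1 : lo i != lo j by rewrite -(inj_eq val_inj) /= ltn_eqF.
  have d2 : lo j != hi j by rewrite -(inj_eq val_inj) /= ltn_eqF.
  have d3 : lo i != hi j by rewrite -(inj_eq val_inj) /= ltn_eqF // ltnW.
  apply: (braid_step3 coxA) => //.
  - by rewrite !gensAE hl tperm_braid.
  - by have := relsA_braid TA (i := i.+1); rewrite ji; apply; lia.
  - move: di dj; rewrite /descA !gensAE hl !permM tpermR tpermD // => h1 h2.
    exact: ltn_trans h2 h1.
  - move: di dj; rewrite /descA !gensAE hl !permM (tpermL (lo j) (hi j)) => _.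
    rewrite (tpermD (x := lo j) (y := hi j)) ?[_ == lo i]eq_sym // tpermL.
    by rewrite (tpermD (x := lo i)).
have ij' : (i.+1 < j)%N by rewrite ltn_neqAle eq_sym ji.
apply: (braid_step2 coxA) => //.
- by rewrite !gensAE tperm_comm // -(inj_eq val_inj) /= ltn_eqF //; lia.
- by apply: (relsA_comm TA); lia.
- by move: dj; rewrite /descA !gensAE !permM !tpermD //
     -(inj_eq val_inj) /= ltn_eqF //; lia.
Qed.

Lemma quadA (i : 'I_k.-1) : T i.+1 * T i.+1 = (q - 1) *: T i.+1 + q%:A.
Proof. by apply: (relsA_quad TA); have := ltn_ord i; lia. Qed.

End TypeA.

Section TypeB.
Variable n : nat.
Local Notation X := (bool * 'I_n)%type.
Implicit Types (w : {perm X}) (i j : 'I_n).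

Definition neg (x : X) : X := (~~ x.1, x.2).

(* The order -n < ... < -1 < 1 < ... < n of the signed points, [true] being   *)
(* the sign -.                                                                *)
Definition rkB (x : X) : nat := if x.1 then (n.-1 - x.2)%N else (n + x.2)%N.

Lemma rkB_false i : rkB (false, i) = (n + i)%N. Proof. by []. Qed.
Lemma rkB_true i : rkB (true, i) = (n.-1 - i)%N. Proof. by []. Qed.

Lemma negK : involutive neg.
Proof. by case=> b i; rewrite /neg negbK. Qed.

Lemma rkB_lt x : (rkB x < n + n)%N.
Proof. by case: x => -[] i; rewrite /rkB /=; have := ltn_ord i; lia. Qed.

Lemma rkB_inj : injective rkB.
Proof.
move=> [b i] [c j]; have := ltn_ord i; have := ltn_ord j; rewrite /rkB /=.
by case: b; case: c => /= hj hi e; try (congr (_, _); apply: val_inj => /=);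
   lia.
Qed.

Lemma rkB_neg x : (rkB (neg x) + rkB x).+1 = (n + n)%N.
Proof. by case: x => -[] i; rewrite /rkB /=; have := ltn_ord i; lia. Qed.

Lemma rkB_sign x : x.1 = (rkB x < n)%N.
Proof. by case: x => -[] i; rewrite /rkB /=; have := ltn_ord i; lia. Qed.

Lemma ord_predE i : (0 < i)%N -> ord_pred i = i.-1 :> nat.
Proof.
move=> i0; rewrite /=; have := ltn_ord i; case: (val i) i0 => //= m _ mn.
by rewrite modnDr modn_small // ltnW.
Qed.

Lemma ord_pred_neq i : (0 < i)%N -> ord_pred i != i.
Proof. by move=> i0; rewrite -(inj_eq val_inj) [val _]ord_predE //=; lia. Qed.

Lemma gensB0 i : i = 0%N :> nat -> gensB i = tperm (true, i) (false, i).
Proof. by move=> i0; rewrite /gensB /= i0 eqxx tpermC. Qed.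

Lemma gensBS i : (0 < i)%N -> gensB i =
  (tperm (false, ord_pred i) (false, i) * tperm (true, i) (true, ord_pred i))%g.
Proof.
move=> i0; rewrite /gensB /= eqn0Ngt i0 /=.
by rewrite [tperm (true, i) _]tpermC.
Qed.

Lemma gensBSE i b p : (0 < i)%N -> gensB i (b, p) = (b, tperm (ord_pred i) i p).
Proof.
move=> i0; have := ord_pred_neq i0 => ne; rewrite gensBS // permM.
have pne c d : (c, ord_pred i) != (d, i) :> X by rewrite xpair_eqE (negPf ne) andbF.
case: (tpermP (ord_pred i) i p) => [->|->|/eqP h1 /eqP h2]; case: b;
  rewrite ?tpermL ?tpermR.
- by rewrite [tperm (false, _) _ _]tpermD // tpermR.
- by rewrite tpermD.
- by rewrite [tperm (false, _) _ _]tpermD // tpermL.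
- by rewrite tpermD // eq_sym.
- by rewrite !tpermD // xpair_eqE 1?eq_sym //= eq_sym.
- by rewrite !tpermD // xpair_eqE 1?eq_sym //= eq_sym.
Qed.

Lemma gensB0E i b p : i = 0%N :> nat -> gensB i (b, p) = (b (+) (p == i), p).
Proof.
move=> i0; rewrite gensB0 //.
case: tpermP => [[-> ->]|[-> ->]|h1 h2]; rewrite ?eqxx //.
suff /negPf -> : p != i by rewrite addbF.
by apply/eqP => e; case: b h1 h2; rewrite e.
Qed.

Lemma gensB_neg i x : gensB i (neg x) = neg (gensB i x).
Proof.
case: x => b p; have [i0|i0] := posnP i.
  by rewrite /neg /= !gensB0E //= addNb.
by rewrite /neg /= !gensBSE.
Qed.

Lemma weylB_neg w x : w \in weylB n -> w (neg x) = neg (w x).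
Proof.
pose negp : {perm X} := perm (inv_inj negK).
suff /subsetP sub : weylB n \subset 'C[negp]%g.
  move=> /sub/cent1P c; have := congr1 (fun u : {perm X} => u x) c.
  by rewrite /= !permM !permE.
rewrite /weylB gen_subG; apply/subsetP => _ /imsetP[i _ ->].
by apply/cent1P/permP => y; rewrite !permM !permE gensB_neg.
Qed.

Lemma gensBW i : gensB i \in weylB n.
Proof. by rewrite mem_gen // imset_f. Qed.

Definition lenB w :=
  (#|inversions rkB w| + #|[set i | (w (false, i)).1]|)./2.

Definition descB i w :=
  if val i == 0%N then (w (false, i)).1
  else (rkB (w (false, i)) < rkB (w (false, ord_pred i)))%N.

Lemma descB0 i w : i = 0%N :> nat -> descB i w = (w (false, i)).1.
Proof. by move=> i0; rewrite /descB [val i]i0. Qed.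

Lemma descBS i w : (0 < i)%N ->
  descB i w = (rkB (w (false, i)) < rkB (w (false, ord_pred i)))%N.
Proof. by move=> i0; rewrite /descB eqn0Ngt i0. Qed.

Lemma lenB_up i w : w \in weylB n -> ~~ descB i w ->
  lenB (gensB i * w)%g = (lenB w).+1.
Proof.
move=> wW; rewrite /lenB.
have wN p : w (true, p) = neg (w (false, p)).
  by rewrite -(weylB_neg _ wW).
have [i0|i0] := posnP i.
  rewrite descB0 // => ni.
  have h1 : rkB (false, i) = (rkB (true, i)).+1.
    by rewrite /rkB /= i0; have := ltn_ord i; lia.
  have h2 : (rkB (w (true, i)) < rkB (w (false, i)))%N.
    have := rkB_neg (w (false, i)); move: ni; rewrite wN rkB_sign.
    by rewrite -leqNgt; move: (rkB (w _)) (rkB (neg _)) => u u2; lia.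
  rewrite {1}gensB0 // (inversions_up rkB_inj h1 h2).
  have -> : [set j | ((gensB i * w)%g (false, j)).1] =
            i |: [set j | (w (false, j)).1].
    apply/setP => j; rewrite !inE permM gensB0E //=.
    by have [->|] := eqVneq j i; rewrite ?wN //= ni.
  by rewrite cardsU1 inE ni; lia.
rewrite descBS // => ni; have ip := ord_predE i0; have il := ltn_ord i.
have lt : (rkB (w (false, ord_pred i)) < rkB (w (false, i)))%N.
  move: ni; rewrite -leqNgt leq_eqVlt => /orP[/eqP/rkB_inj/perm_inj[e]|//].
  by move: (ord_pred_neq i0); rewrite e eqxx.
have h1 : rkB (false, i) = (rkB (false, ord_pred i)).+1.
  by rewrite !rkB_false ip; lia.
have h2 : rkB (true, ord_pred i) = (rkB (true, i)).+1.
  by rewrite !rkB_true ip; lia.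
have lt' : (rkB (w (true, i)) < rkB (w (true, ord_pred i)))%N.
  have := rkB_neg (w (false, i)); have := rkB_neg (w (false, ord_pred i)).
  rewrite !wN; move: lt; move: (rkB (w _)) (rkB (w _)) => x y.
  by move: (rkB _) (rkB _); lia.
rewrite {1}gensBS // -mulgA (inversions_up rkB_inj h1); last first.
  by rewrite !permM !tpermD.
rewrite (inversions_up rkB_inj h2 lt').
have -> : [set j | ((gensB i * w)%g (false, j)).1] =
          tperm (ord_pred i) i @^-1: [set j | (w (false, j)).1].
  by apply/setP => j; rewrite !inE permM gensBSE.
by rewrite card_preimset; [lia | exact: perm_inj].
Qed.

Lemma descB_gens i w : w \in weylB n -> descB i (gensB i * w)%g = ~~ descB i w.
Proof.
move=> wW; have [i0|i0] := posnP i.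
  rewrite !descB0 // permM gensB0E // eqxx /= -[true]/(~~ false).
  by rewrite (weylB_neg (false, i)).
rewrite !descBS // !permM !gensBSE // tpermL tpermR.
have : rkB (w (false, ord_pred i)) != rkB (w (false, i)).
  rewrite (inj_eq rkB_inj) (inj_eq perm_inj); apply/eqP => -[e].
  by move: (ord_pred_neq i0); rewrite e eqxx.
by move: (rkB _) (rkB _) => x y; lia.
Qed.

Lemma nodescB w : w \in weylB n -> (forall i, ~~ descB i w) -> w = 1%g.
Proof.
move=> wW nd; apply: (increasing_adjacent rkB_inj rkB_lt).
  move=> m lm; have [lt|le] := ltnP m n.
    have h : (n.-1 - m < n)%N by lia.
    by exists (true, Ordinal h); rewrite /rkB /=; lia.
  have h : (m - n < n)%N by lia.
  by exists (false, Ordinal h); rewrite /rkB /=; lia.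
have wN b p : w (~~ b, p) = neg (w (b, p)) by rewrite -(weylB_neg _ wW).
have adj i : (0 < i)%N -> (rkB (w (false, ord_pred i)) < rkB (w (false, i)))%N.
  move=> i0; have := nd i; rewrite descBS // -leqNgt leq_eqVlt.
  case/orP=> // /eqP/rkB_inj/perm_inj[e].
  by move: (ord_pred_neq i0); rewrite e eqxx.
have op i j : j = i.+1 :> nat -> ord_pred j = i.
  by move=> e; apply: val_inj; rewrite [val _]ord_predE e.
move=> [[] i] [[] j]; rewrite /rkB /= -/(rkB _) -/(rkB _) => e.
- have ji : i = j.+1 :> nat by have := ltn_ord i; have := ltn_ord j; lia.
  have := adj i; rewrite (op _ _ ji) ji => /(_ isT).
  have := rkB_neg (w (false, i)); have := rkB_neg (w (false, j)).
  rewrite -!wN /=; move: (rkB _) (rkB _) (rkB _) (rkB _) => x1 x2 x3 x4; lia.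
- have i0 : i = 0%N :> nat by have := ltn_ord i; have := ltn_ord j; lia.
  have -> : j = i by apply: val_inj; have := ltn_ord i; have := ltn_ord j; move=> /=; lia.
  have := nd i; rewrite descB0 // rkB_sign.
  by have := rkB_neg (w (false, i)); rewrite -!wN /=;
     move: (rkB _) (rkB _) => x1 x2; lia.
- by have := ltn_ord i; have := ltn_ord j; lia.
- have ji : j = i.+1 :> nat by lia.
  by have := adj j; rewrite (op _ _ ji) ji => /(_ isT).
Qed.

Lemma coxB : coxeter_length (@gensB n) (weylB n) lenB descB.
Proof.
split.
- exact: group1.
- by move=> i w wW; rewrite groupM ?gensBW.
- move=> i; apply/permP => -[b p]; rewrite permM perm1.
  have [i0|i0] := posnP i; first by rewrite !gensB0E // -addbA addbb addbF.
  by rewrite !gensBSE // tpermK.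
- rewrite /lenB inversions1 cards0.
  suff -> : [set i | ((1%g : {perm X}) (false, i)).1] = set0 by rewrite cards0.
  by apply/setP => i; rewrite !inE perm1.
- exact: lenB_up.
- exact: descB_gens.
- exact: nodescB.
Qed.

Variables (R : comNzRingType) (H : algType R) (T : nat -> H) (Q q : R).
Hypothesis TB : relsB T n Q q.

Lemma braidB : braid_compatible (@gensB n) (weylB n) lenB descB
  (fun i : 'I_n => T i).
Proof.
apply: braid_compatible_lt => i j w wW ij.
have j0 : (0 < j)%N by apply: leq_ltn_trans ij.
have jn := ltn_ord j; have jp := ord_predE j0; have nej := ord_pred_neq j0.
have dj b p : gensB j (b, p) = (b, tperm (ord_pred j) j p) by apply: gensBSE.
have wN p : w (true, p) = neg (w (false, p)) by rewrite -(weylB_neg _ wW).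
have ne : i != j by rewrite -(inj_eq val_inj) /= ltn_eqF.
have neqE (x y : 'I_n) : (x == y) = (x == y :> nat) by rewrite -(inj_eq val_inj).
have [i0|i0] := posnP i.
  have di b p : gensB i (b, p) = (b (+) (p == i), p) by apply: gensB0E.
  rewrite (descB0 _ i0) descBS // rkB_sign => h1 h2.
  have [j1|j1] := eqVneq (val j) 1%N.
    have ji : ord_pred j = i.
      by apply: val_inj; rewrite [val _]jp [val i]i0; move: j1 => /= ->.
    rewrite ji in dj h2.
    have neF : (j == i) = false by rewrite eq_sym (negPf ne).
    have djf : gensB j (false, j) = (false, i) by rewrite dj tpermR.
    have dif b : gensB j (b, i) = (b, j) by rewrite dj tpermL.
    have ha := rkB_neg (w (false, i)); have hb := rkB_neg (w (false, j)).
    apply: (braid_step4 coxB) => //.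
    - apply/permP => -[b p]; rewrite !permM.
      have [->|pi] := eqVneq p i.
        by rewrite !(di, dj, tpermL, tpermR, eqxx, neF, addbF).
      have [->|pj] := eqVneq p j.
        by rewrite !(di, dj, tpermL, tpermR, eqxx, neF, addbF).
      have tp : tperm i j p = p by rewrite tpermD // eq_sym.
      by rewrite !(di, dj, tp, negPf pi, addbF).
    - by rewrite i0 [nat_of_ord j]j1; apply: (relsB_braid TB); lia.
    - by rewrite descB0 // rkB_sign.
    - rewrite descBS // ji !permM !di eqxx neF /= wN.
      by move: h1 h2 ha; move: (rkB _) (rkB _) (rkB _) => x y z; lia.
    - rewrite descB0 // rkB_sign !permM dif di neF.
      by move: h1 h2; move: (rkB _) (rkB _) => x y; lia.
    - rewrite descBS // ji !permM !di eqxx neF /= djf dif !di neF eqxx /= !wN.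
      move: h1 h2 ha hb; move: (rkB _) (rkB _) (rkB _) (rkB _) => x y z t; lia.
  have {j1} j1 : (1 < j)%N by rewrite ltn_neqAle eq_sym j1.
  have nep : (ord_pred j == i) = false by rewrite neqE jp i0; apply/eqP; lia.
  have nejF : (j == i) = false by rewrite eq_sym (negPf ne).
  apply: (braid_step2 coxB) => //.
  - apply/permP => -[b p]; rewrite !permM !(di, dj).
    congr (_ (+) _, _); case: tpermP => [->|->|//]; by rewrite nep nejF.
  - by rewrite i0; apply: (relsB_comm TB); lia.
  - by rewrite descB0 // rkB_sign.
  - by rewrite descBS // !permM !di nep nejF.
have di b p : gensB i (b, p) = (b, tperm (ord_pred i) i p) by apply: gensBSE.
have ip := ord_predE i0; have nei := ord_pred_neq i0.
have nepj : ord_pred i != j by rewrite neqE ip; apply/eqP; lia.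
rewrite !descBS // => h1 h2.
have [ji|ji] := eqVneq (ord_pred j) i.
  rewrite ji in dj h2.
  have ji' : j = i.+1 :> nat by rewrite -ji jp; lia.
  apply: (braid_step3 coxB) => //.
  - apply/permP => -[b p]; rewrite !permM !(di, dj).
    by have /permP/(_ p) := tperm_braid nei ne nepj; rewrite !permM => ->.
  - by rewrite ji'; apply: (relsA_braid (relsB_A TB)); lia.
  - by rewrite descBS.
  - rewrite descBS // ji !permM !di tpermR tpermD //.
    exact: ltn_trans h2 h1.
  - rewrite descBS // !permM !dj tpermL (tpermD (z := ord_pred i)) 1?eq_sym //.
    by rewrite !di tpermL (tpermD (z := j)).
have lt : (i < ord_pred j)%N.
  by rewrite ltn_neqAle eq_sym -neqE ji jp; lia.
have [n1 n2] : ord_pred i != ord_pred j /\ i != ord_pred j.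
  by split; rewrite neqE; [rewrite ip; apply/eqP; lia | rewrite ltn_eqF].
apply: (braid_step2 coxB) => //.
- apply/permP => -[b p]; rewrite !permM !(di, dj).
  by have /permP/(_ p) := tperm_comm n1 nepj n2 ne; rewrite !permM => ->.
- by apply: (relsA_comm (relsB_A TB)); lia.
- by rewrite descBS.
- by rewrite descBS // !permM !di !tpermD.
Qed.

Definition parB (i : 'I_n) : R := if val i == 0%N then Q else q.

Lemma quadB (i : 'I_n) : T i * T i = (parB i - 1) *: T i + (parB i)%:A.
Proof.
rewrite /parB; have in_ := ltn_ord i; have [i0|i0] := posnP i.
  by rewrite [val i]i0 (relsB_quad TB) //; lia.
by rewrite /= (relsA_quad (relsB_A TB)) // i0.
Qed.

End TypeB.

Section Eigenvectors.
Variables (gT : finGroupType) (r : nat) (s : 'I_r -> gT) (W : {set gT}).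
Variables (len : gT -> nat) (desc : 'I_r -> gT -> bool).
Hypothesis cox : coxeter_length s W len desc.
Variables (R : comNzRingType) (H : algType R) (T : 'I_r -> H) (q : 'I_r -> R).
Hypothesis braidT : braid_compatible s W len desc T.
Hypothesis quadT : forall i, T i * T i = (q i - 1) *: T i + (q i)%:A.
Variables (Y : {set gT}) (i : 'I_r) (theta : R).
Hypothesis YW : {subset Y <= W}.
Hypothesis theta_root : q i * theta ^+ 2 = (q i - 1) * theta + 1.

Let S := \sum_(w in Y) theta ^+ len w *: Tw s T w.

Lemma weighted_sum_eigenl : (forall w, (s i * w \in Y)%g = (w \in Y)) ->
  T i * S = (q i * theta) *: S.
Proof.
move=> YS; have -> : S = \sum_(w in Y | ~~ desc i w)
    theta ^+ len w *: (Tw s T w + theta *: Tw s T (s i * w)%g).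
  rewrite /S (bigID (desc i)) /= addrC.
  rewrite [X in _ + X](reindex_onto (fun w => s i * w)%g (fun w => s i * w)%g);
    last by move=> w _; rewrite (cox_invK cox).
  rewrite [X in _ + X](eq_bigl (fun w => (w \in Y) && ~~ desc i w)) => [|w].
    rewrite -big_split; apply: eq_bigr => w /andP[wY nd].
    by rewrite (cox_up cox) ?YW // exprSr scalerDr scalerA.
  rewrite (cox_invK cox) eqxx andbT YS; case wY: (w \in Y) => //=.
  by rewrite (cox_desc cox) ?YW.
rewrite mulr_sumr scaler_sumr; apply: eq_bigr => w /andP[/YW wW nd].
rewrite -(Tw_up cox braidT wW nd) -scalerAr mulrDr -scalerAr mulrA quadT.
rewrite mulrDl -!scalerAl mul1r scalerA [_ * _ ^+ len w]mulrC -scalerA.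
congr (_ *: _); rewrite !scalerDr !scalerA addrA addrC; congr (_ + _).
  by rewrite mulrC.
rewrite -[X in X + _]scale1r -scalerDl; congr (_ *: _).
by rewrite -mulrA -expr2 theta_root addrC [theta * _]mulrC.
Qed.

Lemma weighted_sum_eigenr : (forall w, (w * s i \in Y)%g = (w \in Y)) ->
  S * T i = (q i * theta) *: S.
Proof.
move=> YS; pose dr w := desc i (w^-1)%g.
have -> : S = \sum_(w in Y | ~~ dr w)
    theta ^+ len w *: (Tw s T w + theta *: Tw s T (w * s i)%g).
  rewrite /S (bigID dr) /= addrC.
  rewrite [X in _ + X](reindex_onto (fun w => w * s i)%g (fun w => w * s i)%g);
    last by move=> w _; rewrite -mulgA (cox_invol cox) mulg1.
  rewrite [X in _ + X](eq_bigl (fun w => (w \in Y) && ~~ dr w)) => [|w].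
    rewrite -big_split; apply: eq_bigr => w /andP[/YW wW nd].
    have wsW := mulW cox wW (genW cox i).
    have d : desc i ((w * s i)^-1)%g by rewrite (cox_descV cox).
    rewrite (cox_downr cox wsW d) -mulgA (cox_invol cox) mulg1.
    by rewrite exprSr scalerDr scalerA.
  rewrite -mulgA (cox_invol cox) mulg1 eqxx andbT YS; case wY: (w \in Y) => //=.
  by rewrite /dr (cox_descV cox) ?YW.
rewrite mulr_suml scaler_sumr; apply: eq_bigr => w /andP[/YW wW nd].
rewrite -(Tw_upr cox braidT wW nd) -scalerAl mulrDl -scalerAl -mulrA quadT.
rewrite mulrDr -!scalerAr mulr1 scalerA [_ * _ ^+ len w]mulrC -scalerA.
congr (_ *: _); rewrite !scalerDr !scalerA addrA addrC; congr (_ + _).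
  by rewrite mulrC.
rewrite -[X in X + _]scale1r -scalerDl; congr (_ *: _).
by rewrite -mulrA -expr2 theta_root addrC [theta * _]mulrC.
Qed.

End Eigenvectors.

(** * Young subgroups and Specht ideals *)

Section Partitions.
Implicit Types (lam sh : seq nat).

Lemma reshape_index_cons n sh i :
  reshape_index (n :: sh) i = if (i < n)%N then 0%N
                              else (reshape_index sh (i - n)).+1.
Proof.
rewrite /reshape_index /= subn_eq0 /=; case: ltnP => // ni.
by rewrite subSn.
Qed.

Lemma reshape_offset_cons n sh i :
  reshape_offset (n :: sh) i = if (i < n)%N then i
                               else reshape_offset sh (i - n).
Proof.
rewrite /reshape_offset reshape_index_cons; case: ltnP => ni /=.
  by rewrite subn0.
by rewrite subnDA.
Qed.

Lemma sum_reshape sh (G : nat -> nat -> nat) :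
  (\sum_(0 <= i < sumn sh) G (reshape_index sh i) (reshape_offset sh i) =
   \sum_(0 <= r < size sh) \sum_(0 <= c < nth 0 sh r) G r c)%N.
Proof.
elim: sh G => [|n sh IH] G /=; first by rewrite !big_geq.
rewrite (big_cat_nat (n := n)) ?leq_addr //= big_nat_recl // /=.
congr (_ + _)%N.
  apply: eq_big_nat => i /andP[_ lin].
  by rewrite reshape_index_cons reshape_offset_cons lin.
rewrite -[n in LHS]add0n big_addn addKn -(IH (fun r => G r.+1)).
apply: eq_big_nat => i _.
by rewrite reshape_index_cons reshape_offset_cons ltnNge leq_addl /= addnK.
Qed.

Lemma reshape_index_mono sh i j :
  (i <= j)%N -> (reshape_index sh i <= reshape_index sh j)%N.
Proof. by rewrite (reshape_leq sh) => /orP[/ltnW|/andP[/eqP->]]. Qed.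

Lemma partition_le_head lam r :
  is_partition lam -> (nth 0 lam r <= head 0 lam)%N.
Proof.
case/andP; case: lam => [|a l] //= srt _; first by rewrite nth_nil.
case: r => [|r] //=; have [rs|rs] := ltnP r (size l); last by rewrite nth_default.
have /allP := order_path_min (fun x y z h1 h2 => leq_trans h2 h1) srt.
by apply; rewrite mem_nth.
Qed.

Lemma count_gt_nth lam c r : is_partition lam ->
  (r < count (fun x => c < x) lam)%N = (c < nth 0 lam r)%N.
Proof.
case/andP; elim: lam r => [|a l IH] r /= srt; first by rewrite nth_nil.
rewrite in_cons negb_or => /andP[_ l0].
have /allP al := order_path_min (fun x y z h1 h2 => leq_trans h2 h1) srt.
have {}IH := IH _ (path_sorted srt) l0.
have [ca|ac] /= := ltnP c a.
  by case: r => [|r] //=; rewrite add1n ltnS IH.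
rewrite add0n IH; case: r => [|r] /=.
  rewrite [RHS]ltnNge ac /=; case: l {srt l0 IH} al => [|b l] //= al.
  by rewrite ltnNge (leq_trans _ ac) // al // mem_head.
have le m : (c < nth 0 l m)%N = false.
  have [ml|ml] := ltnP m (size l); last by rewrite nth_default.
  by rewrite ltnNge (leq_trans _ ac) // al // mem_nth.
by rewrite !le.
Qed.

Lemma nth_conj_part lam c : is_partition lam ->
  nth 0%N (conj_part lam) c = count (fun x => c < x)%N lam.
Proof.
move=> pl; have [cl|lc] := ltnP c (head 0%N lam).
  by rewrite (nth_map 0%N) ?size_iota // nth_iota.
rewrite nth_default ?size_map ?size_iota //; apply/esym/eqP.
by rewrite -leqn0 leqNgt count_gt_nth // -leqNgt (leq_trans (partition_le_head _ pl)).
Qed.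

Lemma conj_part_lt lam c r : is_partition lam ->
  (r < nth 0 (conj_part lam) c)%N = (c < nth 0 lam r)%N.
Proof. by move=> pl; rewrite nth_conj_part ?count_gt_nth. Qed.

Lemma size_conj_part lam : size (conj_part lam) = head 0%N lam.
Proof. by rewrite size_map size_iota. Qed.

Lemma conj_part_partition lam : is_partition lam -> is_partition (conj_part lam).
Proof.
move=> pl; apply/andP; split.
  apply/(sortedP 0%N) => c _; rewrite !nth_conj_part //=.
  by apply: sub_count => x /ltnW.
apply/(nthP 0%N) => -[c]; rewrite size_conj_part => cl c0.
have : (0 < nth 0 (conj_part lam) c)%N by rewrite conj_part_lt // nth0.
by rewrite c0.
Qed.

Lemma count_iota_lt h m : (m <= h)%N -> count (fun c => c < m)%N (iota 0 h) = m.
Proof.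
move=> /subnKC <-; rewrite iotaD count_cat add0n.
rewrite (_ : count _ (iota 0 m) = m); last first.
  rewrite -[RHS](size_iota 0); apply/eqP; rewrite -all_count.
  by apply/allP => x; rewrite mem_iota.
rewrite (_ : count _ (iota m _) = 0%N) ?addn0 //.
apply/eqP; rewrite -leqn0 leqNgt -has_count; apply/hasPn => x.
by rewrite mem_iota -leqNgt => /andP[].
Qed.

Lemma conj_partK lam : is_partition lam -> conj_part (conj_part lam) = lam.
Proof.
move=> pl; have pc := conj_part_partition pl.
have sz : size (conj_part (conj_part lam)) = size lam.
  rewrite size_conj_part -nth0 nth_conj_part //.
  apply/eqP; rewrite -all_count; apply/allP => x xl /=; rewrite lt0n.
  by apply: contraTneq xl => ->; case/andP: pl.
apply: (@eq_from_nth _ 0%N) => // c _.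
rewrite nth_conj_part // {1}/conj_part count_map -[RHS](count_iota_lt
  (partition_le_head c pl)); apply: eq_in_count => x _ /=.
by rewrite -nth_conj_part // conj_part_lt.
Qed.

Lemma sum_conj_part lam (G : nat -> nat -> nat) : is_partition lam ->
  (\sum_(0 <= r < size lam) \sum_(0 <= c < nth 0 lam r) G r c =
   \sum_(0 <= c < size (conj_part lam))
     \sum_(0 <= r < nth 0 (conj_part lam) c) G r c)%N.
Proof.
move=> pl; have pc := conj_part_partition pl.
transitivity (\sum_(0 <= r < size lam) \sum_(0 <= c < head 0 lam)
   if (c < nth 0 lam r)%N then G r c else 0)%N.
  apply: eq_bigr => r _.
  by rewrite (big_nat_widen _ _ (head 0 lam)%N) ?partition_le_head // big_mkcond.
rewrite exchange_big size_conj_part; apply: eq_bigr => c _.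
rewrite [RHS](big_nat_widen _ _ (size lam)) ?nth_conj_part ?count_size //.
by rewrite [RHS]big_mkcond; apply: eq_bigr => r _; rewrite /= count_gt_nth.
Qed.

Lemma sumn_size_nth sh : sumn sh = (\sum_(0 <= r < size sh) nth 0 sh r)%N.
Proof. by rewrite sumnE (big_nth 0%N). Qed.

Lemma sumn_conj_part lam : is_partition lam -> sumn (conj_part lam) = sumn lam.
Proof.
move=> pl; rewrite !sumn_size_nth.
have /esym := sum_conj_part (fun _ _ => 1%N) pl.
under eq_bigr do rewrite sum_nat_const_nat subn0 muln1.
by move=> ->; apply: eq_bigr => r _; rewrite sum_nat_const_nat subn0 muln1.
Qed.

Lemma reshape_pred sh i c : (i < sumn sh)%N -> reshape_offset sh i = c.+1 ->
  [/\ (0 < i)%N, reshape_index sh i.-1 = reshape_index sh i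
    & reshape_offset sh i.-1 = c].
Proof.
move=> li ec; have := reshape_offsetP li; rewrite ec => /ltnW lc.
have e := reshape_indexK sh i; rewrite ec /flatten_index addnS in e.
have -> : i.-1 = flatten_index sh (reshape_index sh i) c by rewrite -{1}e.
rewrite (flatten_indexKl lc) (flatten_indexKr lc); split=> //.
by rewrite -e.
Qed.

Lemma block_increasing sh m (f : nat -> nat) i j :
  (forall p, (p.+1 < m)%N -> reshape_index sh p = reshape_index sh p.+1 ->
     (f p < f p.+1)%N) ->
  (i < j < m)%N -> reshape_index sh i = reshape_index sh j -> (f i < f j)%N.
Proof.
move=> inc /andP[ij jm] e.
have [d dE] : exists d, j = (i + d.+1)%N by exists (j - i.+1)%N; lia.
move: dE ij jm e => ->; elim: d => [|d IH].
  by rewrite addn1 => _ lt e; apply: inc.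
rewrite addnS => ij jm e.
have le : reshape_index sh i = reshape_index sh (i + d.+1).
  apply/eqP; rewrite eqn_leq reshape_index_mono ?leq_addr //=.
  by rewrite e reshape_index_mono.
apply: ltn_trans (IH _ _ le) (inc _ jm _) => //; [lia|lia|].
by rewrite -le.
Qed.

End Partitions.

Section TwATheory.
Variables (R : comUnitRingType) (H : algType R) (T : nat -> H) (q : R) (k : nat).
Hypothesis TA : relsA T k q.
Implicit Type w : 'S_k.
Local Notation cox := (coxA k).
Local Notation brd := (braidA TA).

Lemma TwA1 : TwA T (1%g : 'S_k) = 1.
Proof. exact: (Tw1 cox brd). Qed.

Lemma TwA_up (i : 'I_k.-1) w : (w (lo i) < w (hi i))%N ->
  T i.+1 * TwA T w = TwA T (gensA i * w)%g.
Proof.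
by move=> lt; apply: (Tw_up cox brd); rewrite ?inE // /descA -leqNgt ltnW.
Qed.

Lemma TwA_down (i : 'I_k.-1) w : (w (hi i) < w (lo i))%N ->
  TwA T w = T i.+1 * TwA T (gensA i * w)%g.
Proof. by move=> lt; apply: (Tw_down cox brd); rewrite ?inE. Qed.

Lemma TwA_upr (i : 'I_k.-1) w : (w^-1 (lo i) < w^-1 (hi i))%g%N ->
  TwA T w * T i.+1 = TwA T (w * gensA i)%g.
Proof.
by move=> lt; apply: (Tw_upr cox brd); rewrite ?inE // /descA -leqNgt ltnW.
Qed.

Lemma TwA_downr (i : 'I_k.-1) w : (w^-1 (hi i) < w^-1 (lo i))%g%N ->
  TwA T w = TwA T (w * gensA i)%g * T i.+1.
Proof. by move=> lt; apply: (Tw_downr cox brd); rewrite ?inE. Qed.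

Lemma hecke_sub_TwA (J : pred nat) (x : H) :
  (forall i, J i -> (0 < i < k)%N) -> hecke_sub T J x ->
  exists c : 'S_k -> R, x = \sum_w c w *: TwA T w.
Proof.
move=> Jk.
have spanE y : Tspan (@gensA k) setT (fun i : 'I_k.-1 => T i.+1) predT y <->
    exists c : 'S_k -> R, y = \sum_w c w *: TwA T w.
  by split=> -[c ->]; exists c; apply: eq_bigl => w; rewrite inE.
move=> hx; apply/spanE.
suff : forall y, Tspan (@gensA k) setT (fun i : 'I_k.-1 => T i.+1) predT y ->
    Tspan (@gensA k) setT (fun i : 'I_k.-1 => T i.+1) predT (x * y).
  move/(_ 1); rewrite mulr1; apply; rewrite -TwA1.
  by apply: Tspan_Tw; rewrite ?inE.
elim: hx => {x} [_ [i /Jk ik ->]|c|x y _ hx _ hy|x y _ hx _ hy] z hz.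
- have ik' : (i.-1 < k.-1)%N by lia.
  have -> : T i = T (Ordinal ik').+1 by rewrite /= prednK //; case/andP: ik.
  exact: (Tspan_gen cox brd (quadA TA)).
- by rewrite -scalerAl mul1r; apply: TspanZ.
- by rewrite mulrDl; apply: TspanD; [apply: hx | apply: hy].
- by rewrite -mulrA; apply: hx; apply: hy.
Qed.

Lemma TwA_hecke_sub w : hecke_sub T (fun i => 0 < i < k)%N (TwA T w).
Proof.
rewrite /TwA; elim: (redword _ _) => [|i l IH].
  by rewrite big_nil -(scale1r 1); apply: subalg_scalar.
rewrite big_cons; apply: subalg_mul IH; apply: subalg_gen; exists i.+1 => //.
by have := ltn_ord i; lia.
Qed.

End TwATheory.

Section Young.
Variables (R : comUnitRingType) (H : algType R) (T : nat -> H) (q : R).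
Variable lam : seq nat.
Local Notation k := (sumn lam).
Hypothesis TA : relsA T k q.
Local Notation row := (reshape_index lam).

Lemma gensA_row (i : 'I_k.-1) (p : 'I_k) :
  row i = row i.+1 -> row (gensA i p) = row p.
Proof. by move=> e; rewrite gensAE; case: tpermP => [->|->|] //=. Qed.

Lemma young_mulr (i : 'I_k.-1) (w : 'S_k) : row i = row i.+1 ->
  ((w * gensA i)%g \in young lam) = (w \in young lam).
Proof.
by move=> e; rewrite !inE; apply: eq_forallb => p; rewrite permM gensA_row.
Qed.

Lemma young_mull (i : 'I_k.-1) (w : 'S_k) : row i = row i.+1 ->
  ((gensA i * w)%g \in young lam) = (w \in young lam).
Proof.
move=> e; rewrite !inE; apply/forallP/forallP => h p.
  have := h (gensA i p); rewrite permM (gensA_row p e) => /eqP <-.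
  by rewrite gensAE tpermK.
by rewrite permM (eqP (h _)) gensA_row.
Qed.

Lemma y_elE : y_el T q lam = \sum_(w in young lam)
  (- q)^-1 ^+ @lenA k w *: TwA T w.
Proof. by apply: eq_bigr => w _; rewrite exprVn coxlenA. Qed.

Lemma x_elE : x_el T lam = \sum_(w in young lam) 1 ^+ @lenA k w *: TwA T w.
Proof. by apply: eq_bigr => w _; rewrite expr1n scale1r. Qed.

Lemma x_el_mull (i : 'I_k.-1) : row i = row i.+1 ->
  T i.+1 * x_el T lam = q *: x_el T lam.
Proof.
move=> e; rewrite x_elE.
rewrite (weighted_sum_eigenl (coxA k) (braidA TA) (q := fun=> q)) ?mulr1 //.
- exact: quadA.
- by rewrite expr1n ?mulr1 subrK.
- by move=> w; apply: young_mull.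
Qed.

Lemma x_el_mulr (i : 'I_k.-1) : row i = row i.+1 ->
  x_el T lam * T i.+1 = q *: x_el T lam.
Proof.
move=> e; rewrite x_elE.
rewrite (weighted_sum_eigenr (coxA k) (braidA TA) (q := fun=> q)) ?mulr1 //.
- exact: quadA.
- by rewrite expr1n ?mulr1 subrK.
- by move=> w; apply: young_mulr.
Qed.

Hypothesis q_unit : q \is a GRing.unit.

Let theta_root : q * (- q)^-1 ^+ 2 = (q - 1) * (- q)^-1 + 1.
Proof.
rewrite invrN sqrrN expr2 mulrA mulrV // mul1r mulrN mulrBl mulrV // mul1r.
by rewrite opprB subrK.
Qed.

Let q_theta : q * (- q)^-1 = -1.
Proof. by rewrite invrN mulrN mulrV. Qed.

Lemma y_el_mull (i : 'I_k.-1) : row i = row i.+1 ->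
  T i.+1 * y_el T q lam = -1 *: y_el T q lam.
Proof.
move=> e; rewrite y_elE -q_theta.
rewrite (weighted_sum_eigenl (coxA k) (braidA TA) (q := fun=> q)) //.
- exact: quadA.
- by move=> w; apply: young_mull.
Qed.

Lemma y_el_mulr (i : 'I_k.-1) : row i = row i.+1 ->
  y_el T q lam * T i.+1 = -1 *: y_el T q lam.
Proof.
move=> e; rewrite y_elE -q_theta.
rewrite (weighted_sum_eigenr (coxA k) (braidA TA) (q := fun=> q)) //.
- exact: quadA.
- by move=> w; apply: young_mulr.
Qed.

End Young.

Section YoungDoubleCosets.
Variable lam : seq nat.
Hypothesis pl : is_partition lam.
Local Notation k := (sumn lam).
Local Notation mu := (conj_part lam).
Local Notation row := (reshape_index lam).
Local Notation col := (reshape_offset lam).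
Local Notation row' := (reshape_index mu).
Local Notation col' := (reshape_offset mu).
Implicit Type w : 'S_k.

Let k' : sumn mu = k. Proof. exact: sumn_conj_part. Qed.

Definition row_reduced w := forall i : 'I_k.-1,
  row i = row i.+1 -> (w (lo i) < w (hi i))%N.
Definition col_reduced w := forall i : 'I_k.-1,
  row' i = row' i.+1 -> (w^-1 (lo i) < w^-1 (hi i))%g%N.

Lemma row_reduced_le w : row_reduced w ->
  (forall i : 'I_k.-1, row i = row i.+1 -> row' (w (lo i)) != row' (w (hi i))) ->
  forall p : 'I_k, (col p <= row' (w p))%N.
Proof.
move=> rw nc p; move: {2}(col p) (erefl (col p)) => c.
elim: c p => [|c IH] p cp; first by rewrite cp.
have [p0 rp cp'] := reshape_pred (ltn_ord p) cp.
have hp : (p.-1 < k.-1)%N by have := ltn_ord p; lia.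
have hE : hi (Ordinal hp) = p by apply: val_inj => /=; lia.
have e : row (Ordinal hp) = row (Ordinal hp).+1 by rewrite /= rp prednK.
have := rw _ e; have := nc _ e; have := IH (lo (Ordinal hp)) cp'.
rewrite hE cp /= => h1 h2 /ltnW/(reshape_index_mono mu); rewrite cp' in h1.
by rewrite leq_eqVlt (negPf h2) /=; apply: leq_ltn_trans.
Qed.

Lemma sum_colE : (\sum_(p < k) col p = \sum_(p < k) row' p)%N.
Proof.
rewrite -(big_mkord xpredT (fun p => col p)) (sum_reshape lam (fun _ c => c)).
rewrite sum_conj_part // -(big_mkord xpredT (fun p => row' p)) -k'.
by rewrite (sum_reshape mu (fun r _ => r)).
Qed.

Lemma sum_rowE : (\sum_(p < k) row p = \sum_(p < k) col' p)%N.
Proof.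
rewrite -(big_mkord xpredT (fun p => row p)) (sum_reshape lam (fun r _ => r)).
rewrite sum_conj_part // -(big_mkord xpredT (fun p => col' p)) -k'.
by rewrite (sum_reshape mu (fun _ c => c)).
Qed.

Lemma sum_le_eq (I : finType) (F G : I -> nat) :
  (forall i, F i <= G i)%N -> (\sum_i F i = \sum_i G i)%N -> F =1 G.
Proof.
move=> le e i.
have [_] := leqif_sum (P := xpredT) (fun i _ => leqif_eq (le i)).
by rewrite e eqxx => /esym/forallP/(_ i)/eqP.
Qed.

Lemma reduced_row' w : row_reduced w ->
  (forall i : 'I_k.-1, row i = row i.+1 -> row' (w (lo i)) != row' (w (hi i))) ->
  forall p : 'I_k, row' (w p) = col p.
Proof.
move=> rw nc p; apply/esym; move: p.
apply: (sum_le_eq (row_reduced_le rw nc)); rewrite sum_colE.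
by rewrite (reindex_inj (@perm_inj _ w)).
Qed.

Lemma reduced_col' w : col_reduced w -> (forall p : 'I_k, row' (w p) = col p) ->
  forall p : 'I_k, col' (w p) = row p.
Proof.
move=> cw rc.
have rc' (p : 'I_k) : col ((w^-1)%g p) = row' p by rewrite -rc permKV.
have le (p : 'I_k) : (col' p <= row ((w^-1)%g p))%N.
  move: {2}(col' p) (erefl (col' p)) => c.
  elim: c p => [|c IH] p cp; first by rewrite cp.
  have pk : (p < sumn mu)%N by rewrite k'.
  have [p0 rp cp'] := reshape_pred pk cp.
  have hp : (p.-1 < k.-1)%N by have := ltn_ord p; lia.
  have hE : hi (Ordinal hp) = p by apply: val_inj => /=; lia.
  have e : row' (Ordinal hp) = row' (Ordinal hp).+1 by rewrite /= rp prednK.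
  have := cw _ e; have := IH (lo (Ordinal hp)) cp'.
  rewrite hE cp; set a := (w^-1)%g _; set b := (w^-1)%g _ => h1 ab.
  have cab : col a = col b by rewrite /a /b !rc' /= rp.
  rewrite cp' in h1; apply: leq_ltn_trans h1 _.
  rewrite ltn_neqAle (reshape_index_mono lam (ltnW ab)) andbT.
  apply: contraTneq ab => rab.
  by rewrite -(reshape_indexK lam a) rab cab reshape_indexK ltnn.
move=> p; rewrite -{2}(permK w p); move: (w p).
apply: (sum_le_eq le); rewrite -sum_rowE.
by rewrite [RHS](reindex_inj (@perm_inj _ w)); apply: eq_bigr => i _;
   rewrite permK.
Qed.

Lemma w_partE w : (forall p : 'I_k, row' (w p) = col p) ->
  (forall p : 'I_k, col' (w p) = row p) -> w = w_part lam.
Proof.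
move=> rw cw.
have wE (p : 'I_k) : val (w p) = flatten_index mu (col p) (row p).
  by rewrite -rw -cw reshape_indexK.
rewrite /w_part; case: pickP => [u /forallP hu|/(_ w)] /=.
  by apply/permP => p; apply: val_inj; rewrite wE (eqP (hu p)).
by move/negP; case; apply/forallP => p; rewrite wE.
Qed.

Section Bimodule.
Variables (R : comUnitRingType) (H : algType R) (T : nat -> H) (q : R).
Hypothesis TA : relsA T k q.
Variables (X Y : H) (alpha beta : R).
Hypothesis ab_regular : forall h : H, (alpha - beta) *: h = 0 -> h = 0.
Hypothesis XT : forall i : 'I_k.-1, row i = row i.+1 -> X * T i.+1 = alpha *: X.
Hypothesis TY : forall i : 'I_k.-1, row' i = row' i.+1 -> T i.+1 * Y = beta *: Y.

Lemma collapse w (i : 'I_k.-1) : row_reduced w -> col_reduced w ->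
  row i = row i.+1 -> row' (w (lo i)) = row' (w (hi i)) -> X * TwA T w * Y = 0.
Proof.
move=> rw cw ri e; have lt := rw i ri.
pose f p := if insub p is Some x then val ((w^-1)%g x) else 0%N.
have fE (x : 'I_k) : f x = (w^-1)%g x by rewrite /f valK.
have finc p : (p.+1 < k)%N -> row' p = row' p.+1 -> (f p < f p.+1)%N.
  move=> pk rp; have hp : (p < k.-1)%N by lia.
  by have := cw (Ordinal hp) rp; rewrite -!fE.
have adj : w (hi i) = (w (lo i)).+1 :> nat.
  apply/eqP; rewrite eqn_leq lt andbT leqNgt; apply/negP => lt2.
  have hk := ltn_ord (w (hi i)).
  have r1 : row' (w (lo i)) = row' (w (lo i)).+1.
    apply/eqP; rewrite eqn_leq (reshape_index_mono mu (leqnSn _)) /= e.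
    by rewrite (reshape_index_mono mu lt).
  have f1 := finc _ (ltn_trans lt2 hk) r1.
  have f2 : (f (w (lo i)).+1 < f (w (hi i)))%N.
    by apply: (block_increasing finc); rewrite ?lt2 // -r1.
  by move: f1 f2; rewrite !fE !permK /=; lia.
have hj : (w (lo i) < k.-1)%N by have := ltn_ord (w (hi i)); lia.
pose j : 'I_k.-1 := Ordinal hj.
have jl : lo j = w (lo i) by apply: val_inj.
have jh : hi j = w (hi i) by apply: val_inj; rewrite /= adj.
have sw : (gensA i * w = w * gensA j)%g.
  by rewrite !gensAE jl jh -tpermJ conjgE !mulgA mulgV mul1g.
have rj : row' j = row' j.+1 by rewrite /= e -adj.
apply: ab_regular; rewrite scalerBl; apply/eqP; rewrite subr_eq0; apply/eqP.
have -> : alpha *: (X * TwA T w * Y) = X * (T i.+1 * TwA T w) * Y.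
  by rewrite 2!scalerAl -(XT ri) !mulrA.
have -> : beta *: (X * TwA T w * Y) = X * (TwA T w * T j.+1) * Y.
  by rewrite scalerAr -(TY rj) !mulrA.
by rewrite (TwA_up TA lt) sw (TwA_upr TA) // jl jh !permK.
Qed.

Lemma young_bimodule w :
  exists c, X * TwA T w * Y = c *: (X * TwA T (w_part lam) * Y).
Proof.
have [m] := ubnP (lenA w); elim: m w => // m IH w; rewrite ltnS => lw.
have step (u : 'S_k) : (lenA u < lenA w)%N ->
    exists c, X * TwA T u * Y = c *: (X * TwA T (w_part lam) * Y).
  by move=> lu; apply: IH; apply: leq_trans lu lw.
have [/existsP[i /andP[/eqP ri di]]|/existsPn rr] :=
    boolP [exists i : 'I_k.-1, (row i == row i.+1) && descA i w].
  have [|c ec] := step (gensA i * w)%g.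
    by rewrite [X in (_ < X)%N](cox_down (coxA k) (in_setT w) di).
  exists (alpha * c); rewrite (TwA_down TA di) mulrA XT //.
  by rewrite -!scalerAl ec scalerA.
have {}rr : row_reduced w.
  move=> i ri; have := rr i; rewrite ri eqxx /= /descA -leqNgt leq_eqVlt.
  by case/orP=> // /eqP/val_inj/perm_inj/(congr1 val) /=; lia.
have [/existsP[i /andP[/eqP ri di]]|/existsPn cr] :=
    boolP [exists i : 'I_k.-1, (row' i == row' i.+1) && descA i (w^-1)%g].
  have [|c ec] := step (w * gensA i)%g.
    by rewrite [X in (_ < X)%N](cox_downr (coxA k) (in_setT w) di).
  exists (beta * c); rewrite (TwA_downr TA di) mulrA -mulrA TY //.
  by rewrite -!scalerAr ec scalerA.
have {}cr : col_reduced w.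
  move=> i ri; have := cr i; rewrite ri eqxx /= /descA -leqNgt leq_eqVlt.
  by case/orP=> // /eqP/val_inj/perm_inj/(congr1 val) /=; lia.
have [/existsP[i /andP[/eqP ri /eqP e]]|/existsPn nc] := boolP
    [exists i : 'I_k.-1, (row i == row i.+1) && (row' (w (lo i)) == row' (w (hi i)))].
  by exists 0; rewrite scale0r (collapse rr cr ri e).
have rc : forall p : 'I_k, row' (w p) = col p.
  apply: (reduced_row' rr) => i ri; have := nc i; rewrite ri eqxx /=.
  by move->.
exists 1; rewrite scale1r -(w_partE rc) //; exact: reduced_col'.
Qed.

Lemma young_bimodule_sub (h : H) : hecke_sub T (fun i => 0 < i < k)%N h ->
  exists c, X * h * Y = c *: (X * TwA T (w_part lam) * Y).
Proof.
move=> /(hecke_sub_TwA TA)[//|c ->]; rewrite mulr_sumr mulr_suml.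
apply: (big_ind (fun x => exists c, x = c *: (X * TwA T (w_part lam) * Y))).
- by exists 0; rewrite scale0r.
- by move=> _ _ [a ->] [b ->]; exists (a + b); rewrite scalerDl.
- move=> w _; have [d e] := young_bimodule w; exists (c w * d).
  by rewrite -scalerAr -scalerAl e scalerA.
Qed.

End Bimodule.
End YoungDoubleCosets.

Section Subalg.
Variables (R : comUnitRingType) (H : algType R).

Lemma subalg0 (S : H -> Prop) : subalg S 0.
Proof. by rewrite -(scale0r 1); apply: subalg_scalar. Qed.

Lemma subalg1 (S : H -> Prop) : subalg S 1.
Proof. by rewrite -(scale1r 1); apply: subalg_scalar. Qed.

Lemma subalgZ (S : H -> Prop) c x : subalg S x -> subalg S (c *: x).
Proof.
by move=> hx; rewrite -(mul1r x) scalerAl; apply: subalg_mul hx; apply: subalg_scalar.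
Qed.

Lemma subalg_sum (S : H -> Prop) I (l : seq I) (P : pred I) F :
  (forall i, P i -> subalg S (F i)) -> subalg S (\sum_(i <- l | P i) F i).
Proof.
by move=> h; apply: big_ind => //; [apply: subalg0 | apply: subalg_add].
Qed.

Lemma subalg_prod (S : H -> Prop) I (l : seq I) (P : pred I) F :
  (forall i, P i -> subalg S (F i)) -> subalg S (\prod_(i <- l | P i) F i).
Proof.
by move=> h; apply: big_ind => //; [apply: subalg1 | apply: subalg_mul].
Qed.

Lemma subalg_mono (S S' : H -> Prop) x :
  (forall y, S y -> S' y) -> subalg S x -> subalg S' x.
Proof.
move=> SS; elim=> [y /SS|c|y z _ hy _ hz|y z _ hy _ hz].
- exact: subalg_gen.
- exact: subalg_scalar.
- exact: subalg_add.
- exact: subalg_mul.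
Qed.

Lemma subalg_comm (S : H -> Prop) (y x : H) :
  (forall t, S t -> y * t = t * y) -> subalg S x -> y * x = x * y.
Proof.
move=> h; elim=> [t /h //|c|t u _ ht _ hu|t u _ ht _ hu].
- by rewrite -scalerAl -scalerAr mul1r mulr1.
- by rewrite mulrDl mulrDr ht hu.
- by rewrite mulrA ht -mulrA hu mulrA.
Qed.

Lemma hecke_sub_mono (T : nat -> H) (J J' : pred nat) x :
  (forall i, J i -> J' i) -> hecke_sub T J x -> hecke_sub T J' x.
Proof.
by move=> JJ; apply: subalg_mono => y [i /JJ Ji ->]; exists i.
Qed.

Lemma hecke_sub_shift (T : nat -> H) a k x :
  hecke_sub (fun i => T (a + i)%N) (fun i => 0 < i < k)%N x ->
  hecke_sub T (fun i => a < i < a + k)%N x.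
Proof.
by apply: subalg_mono => y [i Ji ->]; exists (a + i)%N => //; lia.
Qed.

End Subalg.

Section SpechtIdeals.
Variables (R : comUnitRingType) (H : algType R) (T : nat -> H) (q : R).
Variable lam : seq nat.
Hypothesis pl : is_partition lam.
Local Notation k := (sumn lam).
Local Notation mu := (conj_part lam).
Hypothesis TA : relsA T k q.
Hypothesis q_unit : q \is a GRing.unit.
Hypothesis q1_regular : forall h : H, (q + 1) *: h = 0 -> h = 0.
Local Notation Hk := (hecke_sub T (fun i => 0 < i < k)%N).

Let k' : sumn mu = k. Proof. exact: sumn_conj_part. Qed.

Let TA' : relsA T (sumn mu) q. Proof. by rewrite k'. Qed.

Lemma x_el_sub : Hk (x_el T lam).
Proof. by apply: subalg_sum => w _; apply: TwA_hecke_sub. Qed.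

Lemma y_el_sub : Hk (y_el T q mu).
Proof.
apply: subalg_sum => w _; apply: subalgZ; rewrite -k'; exact: TwA_hecke_sub.
Qed.

Lemma z_el_sub : Hk (z_el T q lam).
Proof.
apply: subalg_mul y_el_sub; apply: subalg_mul x_el_sub _; exact: TwA_hecke_sub.
Qed.

Lemma xhy_z_el h : Hk h ->
  exists c, x_el T lam * h * y_el T q mu = c *: z_el T q lam.
Proof.
apply: (young_bimodule_sub pl TA (alpha := q) (beta := -1)) => [g|i e|i e].
- by rewrite opprK; apply: q1_regular.
- exact: (x_el_mulr TA e).
- have hi : (i < (sumn mu).-1)%N by rewrite k'.
  exact: (y_el_mull TA' q_unit (i := Ordinal hi) e).
Qed.

Lemma yhx_dual_z_el h : Hk h ->
  exists c, y_el T q mu * h * x_el T lam = c *: dual_z_el T q lam.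
Proof.
rewrite -k'; apply: (young_bimodule_sub (conj_part_partition pl) TA'
  (alpha := -1) (beta := q)) => [g e|i e|i].
- apply: q1_regular; have -> : q + 1 = - (-1 - q) by rewrite opprB opprK.
  by rewrite scaleNr e oppr0.
- exact: (y_el_mulr TA' q_unit e).
- rewrite conj_partK // => e.
  have hi : (i < k.-1)%N by rewrite -k'.
  exact: (x_el_mull TA (i := Ordinal hi) e).
Qed.

Lemma zhz_z_el h : Hk h ->
  exists c, z_el T q lam * h * z_el T q lam = c *: z_el T q lam.
Proof.
move=> hh; set t := TwA T (w_part lam).
have ht : Hk t by apply: TwA_hecke_sub.
have [|c e] := @xhy_z_el (t * y_el T q mu * h * x_el T lam * t).
  do !apply: subalg_mul => //; [exact: y_el_sub | exact: x_el_sub].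
by exists c; rewrite -e /z_el !mulrA.
Qed.

Lemma zhz_dual_z_el h c : Hk h ->
  z_el T q lam * h * z_el T q lam = c *: z_el T q lam ->
  exists d p g, [/\ Hk p, Hk g &
    c *: z_el T q lam = d *: (p * (dual_z_el T q lam * g))].
Proof.
move=> hh <-; have [d e] := yhx_dual_z_el hh.
have ht : Hk (TwA T (w_part lam)) by apply: TwA_hecke_sub.
exists d, (x_el T lam * TwA T (w_part lam)), (TwA T (w_part lam) * y_el T q mu).
split; first by apply: subalg_mul ht; apply: x_el_sub.
  by apply: subalg_mul ht _; apply: y_el_sub.
rewrite scalerAr scalerAl -e /z_el !mulrA.
by [].
Qed.

End SpechtIdeals.

(** * Schur elements *)

Lemma mxtrace_square_zero (K : fieldType) d (N : 'M[K]_d) :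
  N *m N = 0 -> \tr N = 0.
Proof.
move=> NN; rewrite -(mulmx_base N) mxtrace_mulC.
suff -> : row_base N *m col_base N = 0 by rewrite mxtrace0.
have e : col_base N *m (row_base N *m col_base N *m row_base N) = 0.
  by rewrite -[row_base N *m _ *m _]mulmxA mulmx_base mulmxA mulmx_base.
have cb : row_free (col_base N)^T by rewrite /row_free mxrank_tr; apply: col_base_full.
have rb := row_base_free N.
have {}e : row_base N *m col_base N *m row_base N = 0.
  apply: trmx_inj; apply: (row_free_inj cb).
  by rewrite -trmx_mul e !trmx0 mul0mx.
by apply: (row_free_inj rb); rewrite e mul0mx.
Qed.

Section SchurElement.
Variables (K : fieldType) (H : algType K) (tr : H -> K).
Hypothesis tr_nondeg : forall x, (forall h, tr (h * x) = 0) -> x = 0.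

Lemma rep0 d (rho : H -> 'M[K]_d) : is_rep rho -> rho 0 = 0.
Proof.
case=> lin _ _; have := lin (-1) 0 0.
by rewrite scaler0 addr0 scaleN1r addNr.
Qed.

Lemma repZ d (rho : H -> 'M[K]_d) c x : is_rep rho -> rho (c *: x) = c *: rho x.
Proof. by move=> rep; case: (rep) => lin _ _; rewrite -[c *: x]addr0 lin rep0 ?addr0. Qed.

Lemma repD d (rho : H -> 'M[K]_d) x y : is_rep rho -> rho (x + y) = rho x + rho y.
Proof. by case=> lin _ _; rewrite -[x]scale1r lin scale1r scale1r. Qed.

Lemma rep_sum d (rho : H -> 'M[K]_d) I (l : seq I) (P : pred I) F :
  is_rep rho -> rho (\sum_(i <- l | P i) F i) = \sum_(i <- l | P i) rho (F i).
Proof.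
by move=> rep; apply: (big_morph rho) => [x y|]; [apply: repD | apply: rep0].
Qed.

Variables (x : H) (s : K).
Hypothesis schur : is_schur_element tr (right_ideal (fun=> True) x) s.

Lemma square_zero_ideal (y : H) : (forall h, y * h * y = 0) -> y = 0.
Proof.
move=> yy; apply: tr_nondeg => h.
have [r [chi [c [_ irr _ trE _]]]] := schur; rewrite trE big1 // => i _.
have [d [rho [rep _ ->]]] := (irr (chi i)).2 (ex_intro _ i erefl).
have [_ _ rhoM] := rep.
rewrite mxtrace_square_zero ?mulr0 // -rhoM mulrA -(mulrA h) -(mulrA h).
by rewrite yy mulr0 rep0.
Qed.

Lemma schur_element_neq0 : s != 0.
Proof. by have [r [chi [c [_ _ cn0 _ [i _ ->]]]]] := schur; apply: cn0. Qed.

Lemma schur_generator_neq0 : (forall d, (0 < d)%N -> d%:R != 0 :> K) -> x != 0.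
Proof.
move=> char0; apply/eqP => x0.
have [r [chi [c [_ irr _ _ [i [d0 [rho0 [rep_0 [phi [phi_inj phiN _]] chiE]]] _]]]]] :=
  schur.
have [d [rho [rep [d_gt0 _] chiE']]] := (irr (chi i)).2 (ex_intro _ i erefl).
have [_ rho1 _] := rep; have [_ rho01 _] := rep_0.
have : \tr (rho0 1) = \tr (rho 1) by rewrite -chiE -chiE'.
rewrite rho1 rho01 !mxtrace1; case: d0 rho0 {chiE rho01 rep_0} phi phi_inj phiN.
  by move=> _ phi _ _ /eqP; rewrite eq_sym (negPf (char0 d d_gt0)).
move=> d0 _ phi phi_inj phiN _.
have [h _ e] := (phiN (phi (delta_mx 0 0))).2 (ex_intro _ _ erefl).
have : delta_mx 0 0 = 0 :> 'rV[K]_d0.+1.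
  by apply: phi_inj; rewrite e x0 mul0r linear0.
by move/rowP/(_ 0); rewrite !mxE !eqxx => /eqP; rewrite oner_eq0.
Qed.

Section Corner.
Variable xi : H.
Hypothesis xHx : forall h, exists c, x * h * x = c *: xi.

(* If [x g x <> 0], left multiplication by [x g] is a nonzero endomorphism of *)
(* [x H] with an eigenvector, hence a scalar as [H] has no nilpotent ideal.   *)
Lemma one_dim_corner h : exists c, x * h * x = c *: x.
Proof.
have [x0|x0] := eqVneq x 0; first by exists 0; rewrite x0 mulr0 scaler0.
have [g gx] : exists g, x * g * x <> 0.
  by apply/not_existsP => all0; move/eqP: x0; apply; apply: square_zero_ideal
    => g; apply: contrapT; apply: all0.
set eta := x * g * x in gx; have [c0 eta_c0] := xHx g; rewrite -/eta in eta_c0.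
have c0n : c0 != 0 by apply: contra_notN gx => /eqP c00; rewrite eta_c0 c00 scale0r.
have xHeta h' : exists c, x * h' * x = c *: eta.
  have [c ->] := xHx h'; exists (c / c0).
  by rewrite eta_c0 scalerA divfK.
have [F FE] : exists F, x * g * eta = F *: eta.
  by have [F FE] := xHeta (g * x * g); exists F; rewrite -FE /eta !mulrA.
have DhX h' : (eta - F *: x) * h' * x = 0.
  have [c e] := xHeta h'; rewrite !mulrBl -!scalerAl e.
  have -> : eta * h' * x = c *: (x * g * eta).
    by rewrite scalerAr -e /eta !mulrA.
  by rewrite FE !scalerA mulrC subrr.
have /eqP : eta - F *: x = 0.
  apply: square_zero_ideal => h'; rewrite mulrBr -scalerAr DhX scaler0 subr0.
  by rewrite {2}/eta !mulrA DhX !mul0r.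
rewrite subr_eq0 => /eqP etaE.
by have [c ->] := xHeta h; exists (c * F); rewrite etaE scalerA.
Qed.

End Corner.

Hypothesis xHx : forall h, exists c, x * h * x = c *: x.

Lemma ideal_char d (rho : H -> 'M[K]_d) h c :
  is_rep rho -> affords (right_ideal (fun=> True) x) rho ->
  x != 0 -> x * h * x = c *: x -> \tr (rho (x * h)) = c.
Proof.
move=> rep [phi [phi_inj phiN phiM]] x0 e; set M := rho (x * h).
have [u uE] : exists u, x * h = phi u by apply/phiN; exists h.
have vM v : exists a, v *m M = a *: u.
  have [g _ ge] := (phiN (phi v)).2 (ex_intro _ v erefl).
  have [a ae] := xHx g; exists a; apply: phi_inj.
  by rewrite phiM linearZ /= -uE ge mulrA ae scalerAl.
have [C CE] := fin_all_exists (fun i => vM (delta_mx 0 i)).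
have ME : M = (\col_i C i) *m u.
  apply/row_matrixP => i; rewrite rowE CE row_mul; apply/rowP => j.
  by rewrite !mxE big_ord1 !mxE.
have uM : u *m M = \tr M *: u.
  rewrite ME mxtrace_mulC mulmxA [u *m _]mx11_scalar mul_scalar_mx.
  by rewrite mxtrace_scalar.
have uM' : u *m M = c *: u.
  by apply: phi_inj; rewrite phiM linearZ /= -uE !mulrA e scalerAl.
have [u0|u0] := eqVneq u 0.
  have xh0 : x * h = 0 by rewrite uE u0 linear0.
  rewrite /M xh0 rep0 // mxtrace0; move/eqP: e.
  by rewrite xh0 mul0r eq_sym scaler_eq0 (negPf x0) orbF => /eqP.
move/eqP: uM; rewrite uM' -subr_eq0 -scalerBl scaler_eq0 (negPf u0) orbF.
by rewrite subr_eq0 => /eqP.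
Qed.

Lemma irreducible_annihilated d0 (rho0 : H -> 'M[K]_d0) d (rho : H -> 'M[K]_d) :
  is_rep rho0 -> affords (right_ideal (fun=> True) x) rho0 ->
  is_rep rho -> irreducible_rep rho ->
  rho x = 0 \/ (forall h, \tr (rho h) = \tr (rho0 h)).
Proof.
move=> rep0_ [phi [phi_inj phiN phiM]] rep [d_gt0 irr].
have [_ rho1 rhoM] := rep.
have [e|rx0] := eqVneq (rho x) 0; [by left | right].
have [i ni] : exists i, row i (rho x) != 0.
  apply/existsP; apply: contraNT rx0 => /existsPn all0; apply/eqP/row_matrixP.
  by move=> i; rewrite row0; apply/eqP/negPn/all0.
pose m : 'rV[K]_d := delta_mx 0 i.
have mx : m *m rho x != 0 by rewrite -rowE.
pose B := \matrix_(j < d0) (m *m rho (phi (delta_mx 0 j))).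
have vB v : v *m B = m *m rho (phi v).
  rewrite mulmx_sum_row {2}[v]row_sum_delta linear_sum rep_sum // mulmx_sumr.
  by apply: eq_bigr => j _; rewrite rowK linearZ /= repZ // scalemxAr.
have intertwine h : rho0 h *m B = B *m rho h.
  apply/row_matrixP => j; rewrite !row_mul rowK vB rowE phiM rhoM mulmxA.
  by [].
have [u uE] : exists u, x = phi u by apply/phiN; exists 1; rewrite ?mulr1.
have Bn0 : B != 0.
  by apply: contraNneq mx => B0; rewrite uE -vB B0 mulmx0.
have Bfull : row_full B.
  have [h|/eqP|] := irr <<B>>%MS.
  - by rewrite (eqmxMr _ (genmxE B)) genmxE -intertwine submxMl.
  - by rewrite -submx0 genmxE submx0 (negPf Bn0).
  - by rewrite /row_full genmxE.
have Bfree : row_free B.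
  apply: inj_row_free => v; rewrite vB => v0.
  have [g _ ge] := (phiN (phi v)).2 (ex_intro _ v erefl).
  apply: phi_inj; rewrite linear0 ge; apply: square_zero_ideal => h.
  suff e : x * (g * h) * x = 0 by rewrite !mulrA in e *; rewrite e mul0r.
  have [a ae] := xHx (g * h).
  have : m *m rho (x * (g * h) * x) = 0.
    by rewrite !mulrA -ge 2!rhoM !mulmxA v0 !mul0mx.
  rewrite ae repZ // -scalemxAr => /eqP; rewrite scaler_eq0 (negPf mx) orbF.
  by move=> /eqP->; rewrite scale0r.
move=> h; rewrite -[rho0 h]mulmx1 -(mulmxVp Bfree) mulmxA intertwine -mulmxA.
by rewrite mxtrace_mulC -mulmxA mulVpmx // mulmx1.
Qed.

Lemma schur_corner h : x * h * x = (s * tr (x * h)) *: x.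
Proof.
have [x0|x0] := eqVneq x 0; first by rewrite x0 mulr0 scaler0.
have [c ce] := xHx h; rewrite ce; congr (_ *: _).
have [r [chi [w [chi_inj irr wn0 trE [i [d0 [rho0 [rep_0 aff chiE]]] sE]]]]] := schur.
rewrite trE (bigD1 i) //= big1 ?addr0 => [|j ji].
  rewrite chiE (ideal_char rep_0 aff x0 ce) sE mulrA mulfV ?mul1r //.
have [d [rho [rep irho chijE]]] := (irr (chi j)).2 (ex_intro _ j erefl).
have [rx0|same] := irreducible_annihilated rep_0 aff rep irho.
  by have [_ _ rhoM] := rep; rewrite chijE rhoM rx0 mul0mx mxtrace0 mulr0.
case/eqP: ji; apply: chi_inj; apply/funext => g.
by rewrite chijE chiE same.
Qed.

End SchurElement.

(** * Presentations and base change *)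

Section LaurentTheory.
Variable R : idomainType.
Implicit Types x y : laurent R.

Lemma laurent_valD x y : laurent_val (x + y) = laurent_val x + laurent_val y.
Proof. exact: (raddfD (\val : laurent R -> _)). Qed.

Lemma laurent_at1D : {morph @laurent_at1 R : x y / x + y}.
Proof.
move=> x y; have [[p k] /= ep] := laurent_repr x; have [[r l] /= er] := laurent_repr y.
rewrite (laurent_at1E ep) (laurent_at1E er).
rewrite (@laurent_at1E _ _ (p * 'X^l + r * 'X^k) (k + l)).
  by rewrite hornerD !hornerM !hornerXn !expr1n !mulr1.
rewrite laurent_valD tofracD !tofracM -ep -er exprD tofracM mulrDl !mulrA.
by congr (_ + _); rewrite mulrAC.
Qed.

Lemma laurent_at1M : {morph @laurent_at1 R : x y / x * y}.
Proof.
move=> x y; have [[p k] /= ep] := laurent_repr x; have [[r l] /= er] := laurent_repr y.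
rewrite (laurent_at1E ep) (laurent_at1E er).
rewrite (@laurent_at1E _ _ (p * r) (k + l)) ?hornerM //.
by rewrite laurent_valM tofracM -ep -er exprD tofracM mulrACA.
Qed.

Lemma laurent_at1C (c : R) : laurent_at1 (laurentC c) = c.
Proof. by rewrite (@laurent_at1E _ _ c%:P 0) ?hornerC // tofrac1 mulr1. Qed.

Lemma laurent_at1X : laurent_at1 (laurentX R) = 1.
Proof. by rewrite (@laurent_at1E _ _ 'X 0) ?hornerX // tofrac1 mulr1. Qed.

Lemma laurentC1 : laurentC (1 : R) = 1.
Proof. by apply: val_inj; rewrite [RHS]laurent_val1 /= polyC1 tofrac1. Qed.

Lemma laurentCD : {morph @laurentC R : a b / a + b}.
Proof.
by move=> a b; apply: val_inj; rewrite [RHS]laurent_valD /= polyCD tofracD.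
Qed.

Lemma laurentCM : {morph @laurentC R : a b / a * b}.
Proof.
by move=> a b; apply: val_inj; rewrite [RHS]laurent_valM /= polyCM tofracM.
Qed.

Fact laurent_at1_zmod : zmod_morphism (@laurent_at1 R).
Proof.
move=> x y; apply: (addIr (laurent_at1 y)).
by rewrite -laurent_at1D !subrK.
Qed.

Fact laurent_at1_monoid : monoid_morphism (@laurent_at1 R).
Proof.
by split; [rewrite -laurentC1 laurent_at1C | apply: laurent_at1M].
Qed.

HB.instance Definition _ :=
  GRing.isZmodMorphism.Build (laurent R) R (@laurent_at1 R) laurent_at1_zmod.
HB.instance Definition _ :=
  GRing.isMonoidMorphism.Build (laurent R) R (@laurent_at1 R) laurent_at1_monoid.

Fact laurentC_zmod : zmod_morphism (@laurentC R).
Proof.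
by move=> a b; apply: (addIr (laurentC b)); rewrite -laurentCD !subrK.
Qed.

Fact laurentC_monoid : monoid_morphism (@laurentC R).
Proof. by split; [apply: laurentC1 | apply: laurentCM]. Qed.

HB.instance Definition _ :=
  GRing.isZmodMorphism.Build R (laurent R) (@laurentC R) laurentC_zmod.
HB.instance Definition _ :=
  GRing.isMonoidMorphism.Build R (laurent R) (@laurentC R) laurentC_monoid.

Lemma laurentC_inj : injective (@laurentC R).
Proof. by move=> a b /(congr1 (@laurent_at1 R)); rewrite !laurent_at1C. Qed.

Lemma laurent_at1_mod x :
  exists y, x = laurentC (laurent_at1 x) + (laurentX R - 1) * y.
Proof.
have [[p k] /= ep] := laurent_repr x.
have /factor_theorem[r re] : root (p - p.[1] *: 'X^k) 1.
  by rewrite /root hornerD hornerN hornerZ hornerXn expr1n mulr1 subrr.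
have Xk0 : ('X^k : {poly R})%:F != 0.
  by rewrite tofrac_eq0 expf_eq0 polyX_eq0 andbF.
have yP : r%:F / ('X^k)%:F \in @is_laurent R.
  by apply/is_laurentP; exists r, k; rewrite divfK.
have eX : laurent_val (laurentX R - 1) = ('X - 1%:P)%:F.
  rewrite tofracB polyC1 tofrac1 -laurent_val1.
  exact: (raddfB (\val : laurent R -> _)).
exists (MkLaurent yP); apply: val_inj; rewrite (laurent_at1E ep) [RHS]laurent_valD.
rewrite [X in _ = _ + X]laurent_valM eX [laurent_val (MkLaurent _)]/=.
rewrite [laurent_val (laurentC _)]/=.
apply: (mulIf Xk0); rewrite [LHS]ep mulrDl -mulrA divfK //.
rewrite -!tofracM -tofracD [('X - _) * _]mulrC -re mul_polyC.
by rewrite addrC subrK.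
Qed.

Lemma laurentX_neq0 : laurentX R != 0.
Proof. by rewrite -laurent_val_eq0 /= tofrac_eq0 polyX_eq0. Qed.

Lemma laurentX_addC_neq0 (c : R) : laurentX R + laurentC c != 0.
Proof.
rewrite -laurent_val_eq0 laurent_valD /= -tofracD tofrac_eq0.
by rewrite -size_poly_eq0 size_XaddC.
Qed.

Lemma laurentX_unit : laurentX R \is a GRing.unit.
Proof.
apply/unitrP.
have P : (('X : {poly R})%:F)^-1 \in @is_laurent R.
  apply/is_laurentP; exists 1, 1%N; rewrite expr1 mulVf ?tofrac1 //.
  by rewrite tofrac_eq0 polyX_eq0.
exists (MkLaurent P).
have X0 : ('X : {poly R})%:F != 0 by rewrite tofrac_eq0 polyX_eq0.
by split; apply: val_inj; rewrite [LHS]laurent_valM [RHS]laurent_val1 /=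
   ?mulVf ?mulfV.
Qed.

End LaurentTheory.

Section PresentedMorphisms.
Variables (R : comNzRingType) (P : presentation R) (S : nzRingType).
Variables (c : {rmorphism R -> S}) (e : pgen P -> S).
Hypothesis c_central : forall a y, c a * y = y * c a.

Fixpoint term_eval (t : term R (pgen P)) : S :=
  match t with
  | TGen i => e i
  | TCst a => c a
  | TAdd t u => term_eval t + term_eval u
  | TMul t u => term_eval t * term_eval u
  end.

Hypothesis e_rel : forall t u, prel t u -> term_eval t = term_eval u.

Lemma pcong_term_eval t u : pcong t u -> term_eval t = term_eval u.
Proof.
elim=> {t u} //=.
- by move=> t u w _ -> _ ->.
- by move=> t t' u u' _ -> _ ->.
- by move=> t t' u u' _ -> _ ->.
- by move=> *; rewrite addrA.
- by move=> *; rewrite addrC.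
- by move=> *; rewrite rmorph0 add0r.
- by move=> *; rewrite rmorphN rmorph1 rmorph0 mulN1r addNr.
- by move=> *; rewrite mulrA.
- by move=> *; rewrite rmorph1 mul1r.
- by move=> *; rewrite rmorph1 mulr1.
- by move=> *; rewrite mulrDl.
- by move=> *; rewrite mulrDr.
- by move=> *; rewrite rmorphD.
- by move=> *; rewrite rmorphM.
Qed.

Lemma presalg_lift : exists phi : {rmorphism presalg P -> S},
  [/\ forall t, phi (\pi_(presalg P) t) = term_eval t,
      forall i, phi (pgenerator i) = e i
    & forall a x, phi (a *: x) = c a * phi x].
Proof.
pose f (x : presalg P) := term_eval (repr x).
have f_pi t : f (\pi_(presalg P) t) = term_eval t.
  exact: pcong_term_eval (pcong_repr t).
have fD x y : f (x + y) = f x + f y.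
  elim/quotW: x => t; elim/quotW: y => u.
  have -> : \pi_(presalg P) t + \pi_(presalg P) u = \pi_(presalg P) (TAdd t u).
    by rewrite pi_padd.
  by rewrite !f_pi.
have fM x y : f (x * y) = f x * f y.
  elim/quotW: x => t; elim/quotW: y => u.
  have -> : \pi_(presalg P) t * \pi_(presalg P) u = \pi_(presalg P) (TMul t u).
    by rewrite pi_pmul.
  by rewrite !f_pi.
have f1 : f 1 = 1 by rewrite -(rmorph1 c); apply: (f_pi (TCst 1)).
have fB : zmod_morphism f.
  by move=> x y; apply: (addIr (f y)); rewrite -fD !subrK.
pose fA := GRing.isZmodMorphism.Build _ _ f fB.
pose fMM := GRing.isMonoidMorphism.Build _ _ f (conj f1 fM).
pose phi : {rmorphism presalg P -> S} := HB.pack f fA fMM.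
exists phi; split=> // [i|a x]; first exact: f_pi.
by rewrite [LHS](fM (pcst P a) x) [f (pcst P a)]f_pi.
Qed.

End PresentedMorphisms.

Lemma presalg_subalg (R : comUnitRingType) (P : presentation R) (x : presalg P) :
  subalg (fun y => exists i, y = pgenerator (P := P) i) x.
Proof.
elim/quotW: x; elim=> [i|a|t ht u hu|t ht u hu].
- by apply: subalg_gen; exists i.
- have -> : \pi_(presalg P) (TCst a) = a%:A by rewrite -[RHS]/(pcst P a * 1) mulr1.
  exact: subalg_scalar.
- by rewrite pi_padd; apply: subalg_add.
- by rewrite pi_pmul; apply: subalg_mul.
Qed.

Lemma quadratic_expand (R : comNzRingType) (H : algType R) (x : H) (q : R) :
  (x + 1) * (x + (- q)%:A) = x * x - ((q - 1) *: x + q%:A).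
Proof.
rewrite mulrDl !mulrDr mul1r -scalerAr !mulr1 scaleNr -!addrA; congr (_ + _).
by rewrite mul1r scaleNr scalerBl scale1r !opprD opprK !addrA.
Qed.

Section HeckePresentations.
Variable R : comNzRingType.

Lemma TB_gen n (Q q : R) i (hi : (i < n)%N) :
  TB n Q q i = pgenerator (P := Presentation (@relB_char R n Q q)) (Ordinal hi).
Proof. by rewrite /TB insubT. Qed.

Lemma TA_gen k (q : R) i (hi : (i < k.-1)%N) :
  TA k q i.+1 = pgenerator (P := Presentation (@relA_char R k q)) (Ordinal hi).
Proof. by rewrite /TA insubT. Qed.

Section Relations.
Variable P : presentation R.
Local Notation pi := (\pi_(presalg P)).

Lemma prel_pi t u : prel t u -> pi t = pi u.
Proof. by move=> h; apply/pcong_pi/Crel. Qed.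

Lemma pi_cst a : pi (TCst a) = a%:A.
Proof. by rewrite -[RHS]/(pcst P a * 1) mulr1. Qed.

Lemma pi_add t u : pi (TAdd t u) = pi t + pi u.
Proof. exact: pi_padd. Qed.

Lemma pi_mul t u : pi (TMul t u) = pi t * pi u.
Proof. exact: pi_pmul. Qed.

Lemma pi_gen i : pi (TGen i) = pgenerator i. Proof. by []. Qed.

End Relations.

Local Notation piE := (pi_cst, pi_add, pi_mul, pi_gen).

Lemma TB_relsB n (Q q : R) : relsB (TB n Q q) n Q q.
Proof.
pose P := Presentation (@relB_char R n Q q).
have rel t u : relB Q q t u -> \pi_(presalg P) t = \pi_(presalg P) u.
  exact: (@prel_pi P).
have quad i c (hi : (i < n)%N) :
  relB Q q (TMul (TAdd (TGen (Ordinal hi)) (TCst 1))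
                 (TAdd (TGen (Ordinal hi)) (TCst (- c)))) (TCst 0) ->
  TB n Q q i * TB n Q q i = (c - 1) *: TB n Q q i + c%:A.
  move=> /rel; rewrite !piE scale1r scale0r quadratic_expand => /eqP.
  by rewrite subr_eq0 => /eqP; rewrite (TB_gen Q q hi).
split; [split | |  | ].
- by move=> i /andP[i0 hi]; apply: (quad _ _ hi); apply: Bquadq.
- move=> i i0 hi; have hi' := ltnW hi; rewrite (TB_gen Q q hi) (TB_gen Q q hi').
  by have /rel := @Bbraid3 R n Q q (Ordinal hi') (Ordinal hi) i0 erefl; rewrite !piE.
- move=> i j i0 /andP[ij hj]; have hi : (i < n)%N by lia.
  rewrite (TB_gen Q q hi) (TB_gen Q q hj).
  by have /rel := @Bcomm R n Q q (Ordinal hi) (Ordinal hj) ij; rewrite !piE.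
- by move=> hi; apply: (quad _ _ hi); apply: BquadQ.
- move=> h1; have h0 := ltnW h1; rewrite (TB_gen Q q h0) (TB_gen Q q h1).
  by have /rel := @Bbraid4 R n Q q (Ordinal h0) (Ordinal h1) erefl erefl; rewrite !piE.
- move=> j /andP[j1 hj]; have h0 : (0 < n)%N by lia.
  rewrite (TB_gen Q q h0) (TB_gen Q q hj).
  by have /rel := @Bcomm R n Q q (Ordinal h0) (Ordinal hj) j1; rewrite !piE.
Qed.

Lemma TA_relsA k (q : R) : relsA (TA k q) k q.
Proof.
pose P := Presentation (@relA_char R k q).
have rel t u : relA q t u -> \pi_(presalg P) t = \pi_(presalg P) u.
  exact: (@prel_pi P).
split.
- case=> // i ik; have hi : (i < k.-1)%N by lia.
  rewrite (TA_gen q hi); have /rel := Aquad q (Ordinal hi).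
  rewrite !piE scale1r scale0r quadratic_expand => /eqP.
  by rewrite subr_eq0 => /eqP.
- case=> // i _ ik; have hi : (i < k.-1)%N by lia.
  have hi' : (i.+1 < k.-1)%N by lia.
  rewrite (TA_gen q hi) (TA_gen q hi').
  by have /rel := @Abraid3 R k q (Ordinal hi) (Ordinal hi') erefl; rewrite !piE.
- case=> // i [|j] _ //; rewrite ltnS => ijk; have hi : (i < k.-1)%N by lia.
  have hj : (j < k.-1)%N by lia.
  rewrite (TA_gen q hi) (TA_gen q hj).
  have ij : (i.+1 < j)%N by lia.
  by have /rel := @Acomm R k q (Ordinal hi) (Ordinal hj) ij; rewrite !piE.
Qed.

Variables (R' : comNzRingType) (H : algType R') (f : {rmorphism R -> R'}).
Variable T : nat -> H.

Let c : {rmorphism R -> H} := [the {rmorphism R' -> H} of in_alg H] \o f.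

Let c_central a y : c a * y = y * c a.
Proof. by rewrite /c /= mulr_algl mulr_algr. Qed.

Let cE a y : c a * y = f a *: y.
Proof. by rewrite /c /= mulr_algl. Qed.

Lemma heckeB_lift n Q q : relsB T n (f Q) (f q) ->
  exists phi : {rmorphism heckeB n Q q -> H},
    (forall i, (i < n)%N -> phi (TB n Q q i) = T i) /\
    (forall a x, phi (a *: x) = f a *: phi x).
Proof.
move=> TB; pose P := Presentation (@relB_char R n Q q).
have quad i a : T i * T i = (f a - 1) *: T i + (f a)%:A ->
    (T i + c 1) * (T i + c (- a)) = c 0.
  move=> e; rewrite rmorph1 rmorph0 /c /= rmorphN quadratic_expand e.
  by rewrite subrr.
have [|phi [_ phi_gen phiZ]] :=
  @presalg_lift R P H c (fun i : 'I_n => T i) c_central.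
  move=> t u []  /= [i hi] /=.
  - by move=> i0; rewrite i0 in hi *; apply: quad; rewrite (relsB_quad TB).
  - by move=> i0; apply: quad; rewrite (relsA_quad (relsB_A TB)) // i0.
  - move=> [j hj] /= i0 j1; rewrite j1 in hj *.
    by rewrite i0 (relsB_braid TB).
  - move=> [j hj] /= i0 j1; rewrite j1 in hj *.
    by rewrite (relsA_braid (relsB_A TB)).
  - move=> [j hj] /= ij; have [i0|i0] := posnP i.
      by rewrite i0 (relsB_comm TB) //; lia.
    by rewrite (relsA_comm (relsB_A TB)) //; lia.
exists phi; split=> [i hi|a x]; first by rewrite TB_gen phi_gen.
by rewrite phiZ cE.
Qed.

Lemma heckeA_lift k q : relsA T k (f q) ->
  exists phi : {rmorphism heckeA k q -> H},
    (forall i, (0 < i < k)%N -> phi (TA k q i) = T i) /\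
    (forall a x, phi (a *: x) = f a *: phi x).
Proof.
move=> TA; pose P := Presentation (@relA_char R k q).
have quad i a : T i * T i = (f a - 1) *: T i + (f a)%:A ->
    (T i + c 1) * (T i + c (- a)) = c 0.
  move=> e; rewrite rmorph1 rmorph0 /c /= rmorphN quadratic_expand e.
  by rewrite subrr.
have [|phi [_ phi_gen phiZ]] :=
  @presalg_lift R P H c (fun i : 'I_k.-1 => T i.+1) c_central.
  move=> t u []  /= [i hi] /=.
  - by apply: quad; rewrite (relsA_quad TA) // -ltn_predRL.
  - move=> [j hj] /= ji; rewrite ji in hj *.
    by rewrite (relsA_braid TA) // -ltn_predRL.
  - by move=> [j hj] /= ij; rewrite (relsA_comm TA) //; lia.
exists phi; split=> [[|i] // hi|a x]; last by rewrite phiZ cE.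
have hi' : (i < k.-1)%N by lia.
by rewrite TA_gen phi_gen.
Qed.

End HeckePresentations.

Section HeckeSpan.

Lemma heckeB_span (R : comUnitRingType) n (Q q : R) (x : heckeB n Q q) :
  Tspan (@gensB n) (weylB n) (fun i : 'I_n => TB n Q q i) predT x.
Proof.
have TBr := TB_relsB n Q q.
suff : forall y, Tspan (@gensB n) (weylB n) (fun i : 'I_n => TB n Q q i) predT y ->
    Tspan (@gensB n) (weylB n) (fun i : 'I_n => TB n Q q i) predT (x * y).
  move/(_ 1); rewrite mulr1; apply.
  rewrite -(Tw1 (coxB n) (braidB TBr)); apply: Tspan_Tw => //.
elim: (presalg_subalg x) => {x} [_ [i ->]|c|x y _ hx _ hy|x y _ hx _ hy] z hz.
- have -> : pgenerator i = TB n Q q i.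
    by rewrite TB_gen; congr pgenerator; apply: val_inj.
  exact: (Tspan_gen (coxB n) (braidB TBr) (quadB TBr)).
- by rewrite -scalerAl mul1r; apply: TspanZ.
- by rewrite mulrDl; apply: TspanD; [apply: hx | apply: hy].
- by rewrite -mulrA; apply: hx; apply: hy.
Qed.

Lemma heckeA_sub (R : comUnitRingType) k (q : R) (x : heckeA k q) :
  hecke_sub (TA k q) (fun i => 0 < i < k)%N x.
Proof.
apply: subalg_mono (presalg_subalg x) => _ [i ->].
exists i.+1; first by have := ltn_ord i; lia.
by rewrite (TA_gen q (ltn_ord i)); congr pgenerator; apply: val_inj.
Qed.

Lemma heckeA_span (R : comUnitRingType) k (q : R) (x : heckeA k q) :
  exists c : 'S_k -> R, x = \sum_w c w *: TwA (TA k q) w.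
Proof. exact: (hecke_sub_TwA (TA_relsA k q) _ (heckeA_sub x)). Qed.

End HeckeSpan.

Section BaseChange.
Variables (R R' : comUnitRingType) (H : algType R) (H' : algType R').
Variables (f : {rmorphism R -> R'}) (phi : {rmorphism H -> H'}).
Hypothesis phiZ : forall a x, phi (a *: x) = f a *: phi x.
Variables (T : nat -> H) (T' : nat -> H').

Section TypeARange.
Variable k : nat.
Hypothesis phiT : forall i, (0 < i < k)%N -> phi (T i) = T' i.

Lemma phi_TwA (w : 'S_k) : phi (TwA T w) = TwA T' w.
Proof.
rewrite rmorph_prod; apply: eq_bigr => i _; apply: phiT.
by have := ltn_ord i; lia.
Qed.

End TypeARange.

Lemma phi_x_el lam : (forall i, (0 < i < sumn lam)%N -> phi (T i) = T' i) ->
  phi (x_el T lam) = x_el T' lam.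
Proof.
by move=> phiT; rewrite rmorph_sum; apply: eq_bigr => w _; apply: phi_TwA.
Qed.

Lemma phi_y_el q lam : q \is a GRing.unit ->
  (forall i, (0 < i < sumn lam)%N -> phi (T i) = T' i) ->
  phi (y_el T q lam) = y_el T' (f q) lam.
Proof.
move=> qu phiT; rewrite rmorph_sum; apply: eq_bigr => w _.
by rewrite phiZ (phi_TwA phiT) rmorphV ?rmorphXn ?rmorphN ?unitrX ?unitrN.
Qed.

Lemma phi_z_el q lam : is_partition lam -> q \is a GRing.unit ->
  (forall i, (0 < i < sumn lam)%N -> phi (T i) = T' i) ->
  phi (z_el T q lam) = z_el T' (f q) lam.
Proof.
move=> pl qu phiT; rewrite !rmorphM phi_x_el // (phi_TwA phiT) phi_y_el //.
by rewrite sumn_conj_part.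
Qed.

Lemma phi_dual_z_el q lam : is_partition lam -> q \is a GRing.unit ->
  (forall i, (0 < i < sumn lam)%N -> phi (T i) = T' i) ->
  phi (dual_z_el T q lam) = dual_z_el T' (f q) lam.
Proof.
move=> pl qu phiT; have phiT' := phiT; rewrite -sumn_conj_part // in phiT'.
by rewrite !rmorphM phi_x_el // (phi_TwA phiT') phi_y_el.
Qed.

Lemma phi_hecke_sub (J : pred nat) x : (forall i, J i -> phi (T i) = T' i) ->
  hecke_sub T J x -> hecke_sub T' J (phi x).
Proof.
move=> phiT; elim=> {x} [_ [i Ji ->]|c|x y _ hx _ hy|x y _ hx _ hy].
- by rewrite phiT //; apply: subalg_gen; exists i.
- by rewrite phiZ rmorph1; apply: subalg_scalar.
- by rewrite rmorphD; apply: subalg_add.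
- by rewrite rmorphM; apply: subalg_mul.
Qed.

Section TypeBRange.
Hypothesis phiT : forall i, phi (T i) = T' i.

Lemma phi_murphy i : phi (murphy T i) = murphy T' i.
Proof.
rewrite !rmorphM !rmorph_prod phiT; congr (_ * _ * _);
  by apply: eq_bigr => j _; apply: phiT.
Qed.

Lemma phi_u_plus q k : phi (u_plus T q k) = u_plus T' (f q) k.
Proof.
rewrite rmorph_prod; apply: eq_bigr => i _.
by rewrite rmorphD phiZ rmorph1 rmorphXn phi_murphy.
Qed.

Lemma phi_u_minus Q q k : phi (u_minus T Q q k) = u_minus T' (f Q) (f q) k.
Proof.
rewrite rmorph_prod; apply: eq_bigr => i _.
by rewrite rmorphB phiZ rmorph1 rmorphM rmorphXn phi_murphy.
Qed.

Lemma phi_uhu Q q n a : phi (uhu T Q q n a) = uhu T' (f Q) (f q) n a.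
Proof.
by rewrite !rmorphM phi_u_plus phi_u_minus; congr (_ * _ * _); apply: phi_TwA.
Qed.

End TypeBRange.
End BaseChange.

(** * The element u^- h u^+ *)

Section MurphyElements.
Variables (R : comUnitRingType) (H : algType R) (T : nat -> H).
Local Notation L := (murphy T).

Lemma murphy1 : L 1 = T 0%N.
Proof. by rewrite /murphy !big_geq // mul1r mulr1. Qed.

Lemma murphyS i : (0 < i)%N -> L i.+1 = T i * L i * T i.
Proof.
move=> i0; rewrite /murphy big_ltn // subn1 big_add1 /=.
rewrite [in X in _ * X = _]big_nat_recr //= !mulrA; congr (_ * _ * _ * _ * _).
Qed.

Lemma murphy_sub i : (0 < i)%N -> hecke_sub T (fun j => j < i)%N (L i).
Proof.
move=> i0; apply: subalg_mul; first apply: subalg_mul.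
- rewrite big_nat_cond; apply: subalg_prod => j /andP[hj _].
  by apply: subalg_gen; exists (i - j)%N => //; lia.
- by apply: subalg_gen; exists 0%N.
- rewrite big_nat_cond; apply: subalg_prod => j /andP[hj _].
  by apply: subalg_gen; exists j => //; lia.
Qed.

End MurphyElements.

Section JucysMurphy.
Variables (R : comUnitRingType) (H : algType R) (T : nat -> H).
Variables (n : nat) (Q q : R).
Hypothesis TB : relsB T n Q q.

(* [L] is [murphy T]; a variable keeps rewriting from unfolding it. *)
Variable L : nat -> H.
Hypothesis murphy1 : L 1 = T 0%N.
Hypothesis murphyS : forall i, (0 < i)%N -> L i.+1 = T i * L i * T i.
Hypothesis murphy_sub :
  forall i, (0 < i)%N -> hecke_sub T (fun j => j < i)%N (L i).

Lemma gen_far i j : (i.+1 < j < n)%N -> T i * T j = T j * T i.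
Proof.
case: i => [|i] h; first exact: (relsB_comm TB).
exact: (relsA_comm (relsB_A TB)).
Qed.

Lemma comm_low_gen i j x : (i < j < n)%N ->
  hecke_sub T (fun l => l < i)%N x -> T j * x = x * T j.
Proof.
move=> hij; apply: subalg_comm => _ [l li ->].
by rewrite (gen_far (i := l)) //; lia.
Qed.

Lemma gen_murphy_gt i j : (0 < i < j)%N -> (j < n)%N -> T j * L i = L i * T j.
Proof.
case/andP=> i0 ij jn; apply: (@comm_low_gen i); rewrite ?ij //.
exact: murphy_sub.
Qed.

Lemma gen_murphy_lt i j : (j.+1 < i <= n)%N -> T j * L i = L i * T j.
Proof.
elim: i => // i IH; rewrite !ltnS => /andP[ji iln].
have i0 : (0 < i)%N by apply: leq_ltn_trans ji.
rewrite murphyS //.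
have [ji'|ij] := ltnP j.+1 i.
  rewrite !mulrA (gen_far (i := j)); last by lia.
  rewrite -(mulrA (T i) (T j)) IH; last by lia.
  by rewrite -!mulrA (gen_far (i := j)) //; lia.
have {ij ji} e : i = j.+1 by lia.
rewrite e in iln i0 *; case: j {e IH} iln i0 => [|j] iln _.
  by rewrite murphy1 !mulrA (relsB_braid TB).
have b : T j.+1 * T j.+2 * T j.+1 = T j.+2 * T j.+1 * T j.+2.
  exact: (relsA_braid (relsB_A TB)).
have c : T j.+2 * L j.+1 = L j.+1 * T j.+2 by apply: gen_murphy_gt; lia.
rewrite murphyS // !mulrA b -!mulrA; congr (_ * (_ * _)).
by rewrite !mulrA c -!(mulrA (L _)) b !mulrA.
Qed.

Lemma murphy_comm i j : (0 < i)%N -> (i < j <= n)%N -> L i * L j = L j * L i.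
Proof.
move=> i0 ij; apply/esym; apply: subalg_comm (murphy_sub i0).
by move=> _ [l /= li ->]; rewrite gen_murphy_lt //; lia.
Qed.

Section SymmetricProducts.
Variables (b eps : R).

Definition murphy_factor i := (b * q ^+ i.-1)%:A + eps *: L i.
Definition murphy_prod k := \prod_(1 <= i < k.+1) murphy_factor i.
Local Notation f := murphy_factor.
Local Notation U := murphy_prod.

Lemma comm_factor y i : y * L i = L i * y -> y * f i = f i * y.
Proof.
move=> e; rewrite mulrDr mulrDl -!scalerAr -!scalerAl mulr1 mul1r.
by congr (_ + _ *: _).
Qed.

Lemma murphy_prodS k : U k.+1 = U k * f k.+1.
Proof. by rewrite /murphy_prod big_nat_recr. Qed.

Lemma gen_factor_pair i : (0 < i)%N -> (i.+1 <= n)%N ->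
  T i * (f i * f i.+1) = f i * f i.+1 * T i.
Proof.
move=> i0 iln.
have quad : T i * T i = (q - 1) *: T i + q%:A.
  by apply: (relsA_quad (relsB_A TB)); rewrite i0.
have LL : L i * L i.+1 = L i.+1 * L i by apply: murphy_comm => //; lia.
have eL' := murphyS i0.
have cP : T i * (L i * L i.+1) = L i * L i.+1 * T i.
  by rewrite [in RHS]LL eL' !mulrA.
have cS : T i * (L i.+1 + q *: L i) = (L i.+1 + q *: L i) * T i.
  rewrite mulrDr mulrDl -scalerAr -scalerAl eL' !mulrA quad.
  rewrite -[_ * T i * T i]mulrA quad !mulrDl !mulrDr.
  rewrite -!scalerAl -!scalerAr !mul1r !mulr1 -!addrA; congr (_ + _).
  by rewrite addrC.
have -> : f i * f i.+1 =
    (b * q ^+ i.-1 * (b * q ^+ i))%:A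
    + (b * q ^+ i.-1 * eps) *: (L i.+1 + q *: L i)
    + (eps * eps) *: (L i * L i.+1).
  have qi : q ^+ i = q * q ^+ i.-1 by rewrite -exprS prednK.
  rewrite mulrDl !mulrDr -!scalerAl -!scalerAr !mul1r !mulr1 !scalerA.
  rewrite scalerDr scalerA !addrA [_ *: _ + _ + _ *: L i]addrAC -!addrA.
  congr (_ + _); rewrite addrCA; congr (_ + (_ + _)).
  by congr (_ *: _); rewrite qi; ring.
move: (L i.+1 + q *: L i) (L i * L i.+1) cS cP => S P cS cP.
by rewrite !mulrDr !mulrDl -!scalerAr -!scalerAl cS cP mulr1 mul1r.
Qed.

Lemma gen_prod_gt k i : (k < i < n)%N -> T i * U k = U k * T i.
Proof.
elim: k => [|k IH] h; first by rewrite /murphy_prod big_geq // mulr1 mul1r.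
rewrite murphy_prodS mulrA IH; last by lia.
by rewrite -!mulrA comm_factor // gen_murphy_gt //; lia.
Qed.

Lemma gen_prod_lt k i : (0 < i < k)%N -> (k <= n)%N -> T i * U k = U k * T i.
Proof.
elim: k => [|k IH]; first by rewrite ltn0 andbF.
case/andP=> i0; rewrite ltnS leq_eqVlt => /orP[/eqP <-|ik] kn.
  have -> : U i.+1 = U i.-1 * (f i * f i.+1).
    by rewrite murphy_prodS -{1}(prednK i0) murphy_prodS prednK // mulrA.
  rewrite [LHS]mulrA gen_prod_gt; last by lia.
  by rewrite -!mulrA gen_factor_pair // !mulrA.
rewrite murphy_prodS mulrA IH ?i0 //; last by lia.
by rewrite -!mulrA comm_factor // gen_murphy_lt //; lia.
Qed.

Variable theta : R.
Hypothesis bQ : eps * Q = theta * b.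
Hypothesis bQ1 : b + eps * (Q - 1) = theta * eps.

Lemma T0_factor : (0 < n)%N -> T 0%N * f 1 = theta *: f 1.
Proof.
move=> n0; rewrite /murphy_factor murphy1 expr0 mulr1 mulrDr -!scalerAr mulr1.
rewrite (relsB_quad TB) // scalerDr !scalerA addrA -scalerDl bQ1 bQ addrC.
by rewrite scalerDr !scalerA.
Qed.

Lemma factor_T0 : f 1 * T 0%N = T 0%N * f 1.
Proof. by rewrite comm_factor // murphy1. Qed.

Lemma T0_comm_prod k : (k <= n)%N -> T 0%N * U k = U k * T 0%N.
Proof.
elim: k => [|k IH] kn; first by rewrite /murphy_prod big_geq // mulr1 mul1r.
rewrite murphy_prodS mulrA IH 1?ltnW // -!mulrA; congr (_ * _).
case: k {IH} kn => [|k] kn; first by rewrite factor_T0.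
by rewrite comm_factor // gen_murphy_lt //; lia.
Qed.

Lemma T0_prod k : (0 < k <= n)%N -> T 0%N * U k = theta *: U k.
Proof.
elim: k => // -[_|k IH] hk.
  by rewrite murphy_prodS /murphy_prod big_geq // mul1r T0_factor //; lia.
by rewrite murphy_prodS mulrA IH ?scalerAl //; lia.
Qed.

Lemma prod_T0 k : (0 < k <= n)%N -> U k * T 0%N = theta *: U k.
Proof. by move=> hk; rewrite -T0_comm_prod ?T0_prod //; lia. Qed.

End SymmetricProducts.

End JucysMurphy.

Section UPlusMinus.
Variables (R : comUnitRingType) (H : algType R) (T : nat -> H).
Variables (n : nat) (Q q : R).
Hypothesis TB : relsB T n Q q.
Local Notation L := (murphy T).

Lemma u_plusE k : u_plus T q k = murphy_prod q L 1 1 k.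
Proof. by apply: eq_bigr => i _; rewrite /murphy_factor mul1r scale1r. Qed.

Lemma u_minusE k : u_minus T Q q k = murphy_prod q L Q (-1) k.
Proof. by apply: eq_bigr => i _; rewrite /murphy_factor scaleN1r. Qed.

Lemma gen_u_plus k i : (0 < i < n)%N -> i != k -> (k <= n)%N ->
  T i * u_plus T q k = u_plus T q k * T i.
Proof.
move=> hi ik kn; rewrite u_plusE; case: (ltngtP i k) ik => // ik _.
  by apply: (gen_prod_lt TB (murphy1 T) (@murphyS _ _ T) (@murphy_sub _ _ T)); lia.
by apply: (gen_prod_gt TB (@murphy_sub _ _ T)); lia.
Qed.

Lemma gen_u_minus k i : (0 < i < n)%N -> i != k -> (k <= n)%N ->
  T i * u_minus T Q q k = u_minus T Q q k * T i.
Proof.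
move=> hi ik kn; rewrite u_minusE; case: (ltngtP i k) ik => // ik _.
  by apply: (gen_prod_lt TB (murphy1 T) (@murphyS _ _ T) (@murphy_sub _ _ T)); lia.
by apply: (gen_prod_gt TB (@murphy_sub _ _ T)); lia.
Qed.

Lemma u_plus_T0 k : (0 < k <= n)%N -> u_plus T q k * T 0%N = Q *: u_plus T q k.
Proof.
move=> hk; rewrite u_plusE.
rewrite (prod_T0 TB (murphy1 T) (@murphyS _ _ T) (@murphy_sub _ _ T) (theta := Q)) //.
  by rewrite mulr1 mul1r.
by rewrite mul1r mulr1 addrC subrK.
Qed.

Lemma T0_u_minus k : (0 < k <= n)%N ->
  T 0%N * u_minus T Q q k = -1 *: u_minus T Q q k.
Proof.
move=> hk; rewrite u_minusE.
rewrite (T0_prod TB (murphy1 T) (theta := -1)) //.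
by rewrite !mulN1r opprB addrC subrK opprK.
Qed.

End UPlusMinus.

Section BlockTransposition.
Variables (n a b : nat).
Hypothesis abn : (a + b = n)%N.

Lemma transpE i (x : 'I_n) : (0 < i < n)%N ->
  transp n i x = (if x == i.-1 :> nat then i else if x == i :> nat then i.-1 else x)
  :> nat.
Proof.
move=> /andP[i0 hi]; have hp : (i.-1 < n)%N by lia.
rewrite /transp (insubT (fun m => m < n)%N hp) (insubT (fun m => m < n)%N hi) /=.
case: tpermP => [->|->|/eqP + /eqP +] /=; rewrite ?eqxx //.
  by case: eqP => //; lia.
by rewrite -!(inj_eq val_inj) /= => /negPf-> /negPf->.
Qed.

Lemma cycleE j m (x : 'I_n) : (j < b)%N -> (m <= a)%N ->
  (\prod_(0 <= i < m) transp n (a + j - i))%g x =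
  (if x == (a + j)%N :> nat then a + j - m
   else if a + j - m <= x < a + j then x.+1 else x)%N :> nat.
Proof.
move=> jb; elim: m => [|m IH] ma.
  rewrite big_geq // perm1 subn0; case: eqP => // _.
  by case: ifP => //; lia.
rewrite big_nat_recr //= permM transpE; last by lia.
rewrite IH; last exact: ltnW.
move: (nat_of_ord x) => y; case: (y =P (a + j)%N) => [_|ne].
  by repeat (case: ifP); lia.
case: (boolP (a + j - m <= y < a + j)%N) => h.
  by repeat (case: ifP); lia.
by repeat (case: ifP); lia.
Qed.

Lemma w_ab_partial m (x : 'I_n) : (m <= b)%N ->
  (\prod_(0 <= j < m) \prod_(0 <= i < a) transp n (a + j - i))%g x =
  (if x < a then x + m else if x < a + m then x - a else x)%N :> nat.
Proof.
elim: m => [|m IH] mb.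
  by rewrite big_geq // perm1 !addn0; repeat (case: ifP); lia.
rewrite big_nat_recr //= permM cycleE // IH; last exact: ltnW.
move: (nat_of_ord x) (ltn_ord x) => y yn; case: (boolP (y < a)%N) => h1.
  by repeat (case: ifP); lia.
by case: (boolP (y < a + m)%N) => h2; repeat (case: ifP); lia.
Qed.

Lemma w_abE (x : 'I_n) :
  w_ab n a b x = (if x < a then x + b else x - a)%N :> nat.
Proof.
rewrite [LHS](w_ab_partial x (leqnn b)) abn; case: ifP => // _.
by have := ltn_ord x; case: ifP => //=; lia.
Qed.

Lemma card_ord_lt (p : 'I_n -> bool) :
  #|[set x : 'I_n | p x]| = (\sum_(x < n) p x)%N.
Proof.
rewrite -sum1_card big_mkcond; apply: eq_bigr => x _; rewrite inE.
by case: (p x).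
Qed.

Lemma lenA_w_ab : lenA (w_ab n a b) = (a * b)%N.
Proof.
have -> : lenA (w_ab n a b) =
    #|setX [set x : 'I_n | (x < a)%N] [set x : 'I_n | (a <= x)%N]|.
  apply: eq_card => -[x y]; rewrite !inE /= !w_abE.
  have := ltn_ord x; have := ltn_ord y.
  by case: ifP; case: ifP; lia.
rewrite cardsX.
have ca : #|[set x : 'I_n | (x < a)%N]| = a.
  rewrite card_ord_lt -(big_mkord xpredT (fun i => (i < a)%N : nat)).
  rewrite (big_cat_nat (n := a)) ?leq0n //=; last by lia.
  rewrite [X in (X + _)%N](eq_big_nat _ _ (F2 := fun=> 1%N)); last first.
    by move=> i /andP[_ ->].
  rewrite [X in (_ + X)%N](eq_big_nat _ _ (F2 := fun=> 0%N)); last first.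
    by move=> i /andP[+ _]; rewrite leqNgt => /negPf->.
  by rewrite !sum_nat_const_nat; lia.
have e : [set x : 'I_n | (a <= x)%N] = ~: [set x : 'I_n | (x < a)%N].
  by apply/setP => x; rewrite !inE leqNgt.
by rewrite ca e cardsCs setCK ca card_ord -abn addKn.
Qed.

End BlockTransposition.

Section WordsA.
Variables (R : comUnitRingType) (H : algType R) (T : nat -> H) (q : R) (n : nat).
Hypothesis TA : relsA T n q.

Lemma ordinal_word (l : seq nat) : all (fun i => 0 < i < n)%N l ->
  exists t : seq 'I_n.-1, l = [seq (val i).+1 | i <- t].
Proof.
elim: l => [|i l IH] /=; first by exists [::].
move=> /andP[hi /IH[t ->]]; have hi' : (i.-1 < n.-1)%N by lia.
by exists (Ordinal hi' :: t) => /=; rewrite prednK //; lia.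
Qed.

Lemma TwA_nat_word (l : seq nat) (w : 'S_n) : all (fun i => 0 < i < n)%N l ->
  (\prod_(i <- l) transp n i)%g = w -> size l = lenA w ->
  TwA T w = \prod_(i <- l) T i.
Proof.
move=> /ordinal_word[t ->] wE sz; rewrite !big_map in wE *.
have wp : wordprod (@gensA n) t = w by rewrite -wE.
have rt : reduced (@gensA n) (@lenA n) t.
  by rewrite /reduced wp -sz size_map.
have := Tw_word (coxA n) (braidA TA) rt; rewrite wp => e.
by rewrite [LHS](esym e).
Qed.

Lemma h_abE a b : (a + b = n)%N -> h_ab T n a b =
  \prod_(0 <= j < b) \prod_(0 <= i < a) T (a + j - i)%N.
Proof.
move=> abn; pose l := [seq (a + j - i)%N | j <- index_iota 0 b, i <- index_iota 0 a].
have := @TwA_nat_word l (w_ab n a b); rewrite /h_ab => ->.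
- by rewrite /l big_allpairs_dep.
- apply/allP => _ /allpairsP[[j i] [/= hj hi ->]]; move: hj hi.
  by rewrite !mem_index_iota; lia.
- by rewrite /l big_allpairs_dep.
- by rewrite lenA_w_ab // size_allpairs !size_iota; lia.
Qed.

Lemma TwA_intertwine (w : 'S_n) (i j : 'I_n.-1) :
  w (lo i) = lo j -> w (hi i) = hi j -> T i.+1 * TwA T w = TwA T w * T j.+1.
Proof.
move=> wl wh; rewrite (TwA_up TA) ?wl ?wh // (TwA_upr TA); last first.
  by rewrite -wl -wh !permK.
by rewrite !gensAE -wl -wh -tpermJ conjgE !mulgA mulgV mul1g.
Qed.

Lemma h_ab_intertwine_lo a b i : (a + b = n)%N -> (0 < i < a)%N ->
  T i * h_ab T n a b = h_ab T n a b * T (i + b)%N.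
Proof.
move=> abn hi; have h1 : (i.-1 < n.-1)%N by lia.
have h2 : ((i + b).-1 < n.-1)%N by lia.
have := @TwA_intertwine (w_ab n a b) (Ordinal h1) (Ordinal h2).
rewrite /= !prednK; [|lia..]; apply; apply: val_inj; rewrite [LHS]w_abE //=;
  case: ifP; lia.
Qed.

Lemma h_ab_intertwine_hi a b i : (a + b = n)%N -> (a < i < n)%N ->
  T i * h_ab T n a b = h_ab T n a b * T (i - a)%N.
Proof.
move=> abn hi; have h1 : (i.-1 < n.-1)%N by lia.
have h2 : ((i - a).-1 < n.-1)%N by lia.
have := @TwA_intertwine (w_ab n a b) (Ordinal h1) (Ordinal h2).
rewrite /= !prednK; [|lia..]; apply; apply: val_inj; rewrite [LHS]w_abE //=;
  case: ifP; lia.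
Qed.

End WordsA.

Section Blocks.
Variables (n p k : nat).
Hypothesis pkn : (p + k <= n)%N.
Local Notation X := (bool * 'I_n)%type.

Lemma blk_pt_subproof (x : 'I_k) : (p + x < n)%N.
Proof. by have := ltn_ord x; lia. Qed.
Definition blk_pt x : 'I_n := Ordinal (blk_pt_subproof x).

Lemma blk_gen_subproof (i : 'I_k.-1) : (p + i.+1 < n)%N.
Proof. by have := ltn_ord i; lia. Qed.
Definition blk_gen i : 'I_n := Ordinal (blk_gen_subproof i).

Lemma blk_pt_inj : injective blk_pt.
Proof. by move=> x y /(congr1 val) /= /addnI /val_inj. Qed.

Lemma blk_gen_gt0 i : (0 < blk_gen i)%N.
Proof. by rewrite /= addnS. Qed.

Lemma blk_gen_lo i : ord_pred (blk_gen i) = blk_pt (lo i).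
Proof. by apply: val_inj; rewrite [LHS]ord_predE ?blk_gen_gt0 //= addnS. Qed.

Lemma blk_gen_hi i : blk_gen i = blk_pt (hi i).
Proof. exact: val_inj. Qed.

Definition blk_prod (t : seq 'I_k.-1) : {perm X} :=
  wordprod (@gensB n) [seq blk_gen i | i <- t].

Lemma blk_prod_in t c (x : 'I_k) :
  blk_prod t (c, blk_pt x) = (c, blk_pt (wordprod (@gensA k) t x)).
Proof.
elim: t x => [|i t IH] x; first by rewrite /blk_prod !wordprod_nil !perm1.
rewrite /blk_prod /= !wordprod_cons !permM gensBSE ?blk_gen_gt0 //.
rewrite blk_gen_lo blk_gen_hi -inj_tperm; last exact: blk_pt_inj.
by rewrite IH gensAE.
Qed.

Lemma blk_prod_out t c (y : 'I_n) : ~~ (p <= y < p + k)%N ->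
  blk_prod t (c, y) = (c, y).
Proof.
move=> hy; elim: t => [|i t IH]; first by rewrite /blk_prod wordprod_nil perm1.
rewrite /blk_prod /= wordprod_cons permM gensBSE ?blk_gen_gt0 // tpermD ?IH //.
  by rewrite blk_gen_lo; apply: contraNneq hy => <- /=; have := ltn_ord i; lia.
by apply: contraNneq hy => <- /=; have := ltn_ord i; lia.
Qed.

Lemma blk_prodW t : blk_prod t \in weylB n.
Proof. exact: (wordprodW (coxB n)). Qed.

Variables (R : comUnitRingType) (H : algType R) (T : nat -> H) (Q q : R).
Hypothesis TB : relsB T n Q q.
Local Notation TwBn := (Tw (@gensB n) (fun i : 'I_n => T i)).

Lemma blk_desc i (t : seq 'I_k.-1) (v : {perm X}) :
  reduced (@gensA k) (@lenA k) (i :: t) ->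
  (forall x y : 'I_k, (x < y)%N ->
     (rkB (v (false, blk_pt x)) < rkB (v (false, blk_pt y)))%N) ->
  ~~ descB (blk_gen i) (blk_prod t * v)%g.
Proof.
move=> rt vinc.
rewrite descBS ?blk_gen_gt0 // -leqNgt ltnW // blk_gen_lo blk_gen_hi !permM.
rewrite !blk_prod_in; apply: vinc.
have := reduced_desc (coxA k) rt; rewrite wordprod_cons (cox_desc (coxA k)) ?in_setT //.
rewrite /descA -leqNgt leq_eqVlt => /orP[/eqP/val_inj/perm_inj/(congr1 val)|//].
by move=> /=; lia.
Qed.

Lemma blk_word_mul (t : seq 'I_k.-1) v :
  reduced (@gensA k) (@lenA k) t -> v \in weylB n ->
  (forall x y : 'I_k, (x < y)%N ->
     (rkB (v (false, blk_pt x)) < rkB (v (false, blk_pt y)))%N) ->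
  (\prod_(i <- t) T (p + i.+1)%N) * TwBn v = TwBn (blk_prod t * v)%g.
Proof.
move=> + vW vinc; elim: t => [|i t IH] rt.
  by rewrite big_nil mul1r /blk_prod wordprod_nil mul1g.
have rt' := reduced_tail (coxA k) rt.
rewrite big_cons -mulrA IH //; have uW := mulW (coxB n) (blk_prodW t) vW.
have -> : T (p + i.+1)%N = T (blk_gen i) by [].
rewrite (Tw_up (coxB n) (braidB TB)) ?blk_desc //.
by rewrite /blk_prod /= wordprod_cons mulgA.
Qed.

Lemma blk_reduced (t : seq 'I_k.-1) : reduced (@gensA k) (@lenA k) t ->
  reduced (@gensB n) (@lenB n) [seq blk_gen i | i <- t].
Proof.
elim: t => [|i t IH] rt; first by rewrite /reduced wordprod_nil (cox_len1 (coxB n)).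
have /eqP rt' := IH (reduced_tail (coxA k) rt).
have nd : ~~ descB (blk_gen i) (blk_prod t).
  rewrite -[blk_prod t]mulg1; apply: blk_desc => // x y xy.
  by rewrite !perm1 /rkB /= !ltn_add2l.
by rewrite /reduced /= wordprod_cons (cox_up (coxB n)) ?wordprodW // -?rt' //
   (wordprodW (coxB n)).
Qed.

Definition blk_perm (w : 'S_k) := blk_prod (redword (@gensA k) w).

Lemma blk_perm_in w c (x : 'I_k) : blk_perm w (c, blk_pt x) = (c, blk_pt (w x)).
Proof.
by rewrite blk_prod_in; have [_ ->] := redwordP (coxA k) (in_setT w).
Qed.

Lemma blk_perm_mul (w : 'S_k) v : v \in weylB n ->
  (forall x y : 'I_k, (x < y)%N ->
     (rkB (v (false, blk_pt x)) < rkB (v (false, blk_pt y)))%N) ->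
  TwA (fun i => T (p + i)%N) w * TwBn v = TwBn (blk_perm w * v)%g.
Proof.
by apply: blk_word_mul; have [] := redwordP (coxA k) (in_setT w).
Qed.

End Blocks.

Lemma left_reduced_pos n (w : {perm bool * 'I_n}) (p : 'I_n) : w \in weylB n ->
  (forall i : 'I_n, (i < p.+1)%N -> ~~ descB i w) -> (w (false, p)).1 = false.
Proof.
move=> wW; case: p => p hp /=; elim: p hp => [|p IH] hp rd.
  by have := rd (Ordinal hp) isT; rewrite descB0 // => /negbTE.
have hp' := ltnW hp; have := rd (Ordinal hp) (ltnSn _); rewrite descBS //.
have -> : ord_pred (Ordinal hp) = Ordinal hp'.
  by apply: val_inj; rewrite [LHS]ord_predE.
have := IH hp' (fun i hi => rd i (ltnW hi)).
by rewrite !rkB_sign; move: (rkB _) (rkB _) => x y; lia.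
Qed.

Lemma left_reduced_inc n (w : {perm bool * 'I_n}) c : w \in weylB n -> (c <= n)%N ->
  (forall i : 'I_n, (i < c)%N -> ~~ descB i w) ->
  forall p r : 'I_n, (p < r)%N -> (r < c)%N ->
  ((w (false, p)).2 < (w (false, r)).2)%N.
Proof.
move=> wW cn rd p [r hr] /=; elim: r hr => // r IH hr pr rc.
have hr' := ltnW hr; have := rd (Ordinal hr) rc; rewrite descBS //.
have -> : ord_pred (Ordinal hr) = Ordinal hr'.
  by apply: val_inj; rewrite [LHS]ord_predE.
have s1 : (w (false, Ordinal hr)).1 = false.
  by apply: left_reduced_pos => // i hi; apply: rd; apply: leq_trans hi _.
have s2 : (w (false, Ordinal hr')).1 = false.
  by apply: left_reduced_pos => // i hi; apply: rd; apply: leq_trans hi _; rewrite ltnW.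
have step : ~~ (rkB (w (false, Ordinal hr)) < rkB (w (false, Ordinal hr')))%N ->
   ((w (false, Ordinal hr')).2 < (w (false, Ordinal hr)).2)%N.
  rewrite -leqNgt leq_eqVlt => /orP[/eqP/rkB_inj/perm_inj[]|]; first by lia.
  by rewrite /rkB s1 s2 ltn_add2l.
move=> /step; move: pr; rewrite ltnS leq_eqVlt => /orP[/eqP e|pr].
  by have -> : p = Ordinal hr' by apply: val_inj.
by apply: ltn_trans; apply: IH => //; apply: ltnW.
Qed.

Section BiPartIdempotent.
Variables (R : comUnitRingType) (H : algType R) (T : nat -> H).
Variables (n : nat) (Q q : R).
Hypothesis TB : relsB T n Q q.
Variable a : nat.
Hypothesis an : (a <= n)%N.
Local Notation b := (n - a)%N.
Local Notation E := (uhu T Q q n a).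
Local Notation hab := (h_ab T n a b).
Local Notation uP := (u_plus T q a).
Local Notation uM := (u_minus T Q q b).
Local Notation Ha := (hecke_sub T (fun i => 0 < i < a)%N).
Local Notation Hb := (hecke_sub T (fun i => a < i < n)%N).
Local Notation HL := (hecke_sub T (fun i => (0 < i < n) && (i != a))%N).

Let ab : (a + b = n)%N. Proof. exact: subnKC. Qed.
Let ba : (b + a = n)%N. Proof. exact: subnK. Qed.

Lemma gen_uhu_lo i : (0 < i < b)%N -> T i * E = E * T (i + a)%N.
Proof.
move=> hi; rewrite /uhu !mulrA (gen_u_minus TB); try lia.
rewrite -!mulrA; congr (_ * _); rewrite mulrA (h_ab_intertwine_lo (relsB_A TB)) //.
by rewrite -!mulrA (gen_u_plus TB) //; lia.
Qed.

Lemma gen_uhu_hi i : (b < i < n)%N -> T i * E = E * T (i - b)%N.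
Proof.
move=> hi; rewrite /uhu !mulrA (gen_u_minus TB); try lia.
rewrite -!mulrA; congr (_ * _); rewrite mulrA (h_ab_intertwine_hi (relsB_A TB)) //.
by rewrite -!mulrA (gen_u_plus TB) //; lia.
Qed.

Lemma gen_hab_uhu i : (0 < i < n)%N -> i != a ->
  T i * (hab * E) = hab * E * T i.
Proof.
move=> hi ia; rewrite [LHS]mulrA; case: (ltngtP i a) ia => // lt _.
  rewrite (h_ab_intertwine_lo (relsB_A TB)) //; last by lia.
  by rewrite -mulrA gen_uhu_hi; [rewrite addnK mulrA | lia].
rewrite (h_ab_intertwine_hi (relsB_A TB)) //; last by lia.
by rewrite -mulrA gen_uhu_lo; [rewrite subnK 1?ltnW // mulrA | lia].
Qed.

Lemma hab_uhu_comm y : HL y -> hab * E * y = y * (hab * E).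
Proof.
apply: subalg_comm => _ [i /= /andP[hi ia] ->].
by rewrite gen_hab_uhu.
Qed.

Lemma u_plus_comm y : HL y -> uP * y = y * uP.
Proof.
apply: subalg_comm => _ [i /= /andP[hi ia] ->].
by rewrite (gen_u_plus TB).
Qed.

Lemma u_minus_comm y : hecke_sub T (fun i => 0 < i < b)%N y -> uM * y = y * uM.
Proof.
by apply: subalg_comm => _ [i /= hi ->]; rewrite (gen_u_minus TB) //; lia.
Qed.

Lemma uhu_shift y : hecke_sub T (fun i => 0 < i < b)%N y ->
  exists2 y', Hb y' & y * E = E * y'.
Proof.
elim=> {y} [_ [i hi ->]|c|y z _ [y' hy ey] _ [z' hz ez]|y z _ [y' hy ey] _ [z' hz ez]].
- exists (T (i + a)%N); last exact: gen_uhu_lo.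
  by apply: subalg_gen; exists (i + a)%N => //; lia.
- exists c%:A; first exact: subalg_scalar.
  by rewrite -scalerAl -scalerAr mul1r mulr1.
- exists (y' + z'); first exact: subalg_add.
  by rewrite mulrDl mulrDr ey ez.
- exists (y' * z'); first exact: subalg_mul.
  by rewrite -mulrA ez mulrA ey -mulrA.
Qed.

Lemma Ha_HL y : Ha y -> HL y.
Proof. by apply: hecke_sub_mono => i; lia. Qed.

Lemma Hb_HL y : Hb y -> HL y.
Proof. by apply: hecke_sub_mono => i; lia. Qed.

Lemma Ha_Hb_comm y z : Ha y -> Hb z -> y * z = z * y.
Proof.
move=> hy; apply: subalg_comm => _ [j /= hj ->].
apply/esym; apply: subalg_comm hy => _ [i /= hi ->].
by apply/esym; apply: (gen_far TB); lia.
Qed.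

Local Notation TwBn := (Tw (@gensB n) (fun i : 'I_n => T i)).

Lemma TwB_block w : w \in weylB n ->
  (forall p : 'I_n, w (false, p) = (false, w_ab n a b p)) -> TwBn w = hab.
Proof.
move=> wW wf; have n0 : (0 + n <= n)%N by [].
have := @blk_perm_mul n 0 n n0 R H T Q q TB (w_ab n a b) 1%g (cox1 (coxB n)).
rewrite (Tw1 (coxB n) (braidB TB)) mulr1 mulg1 => e.
rewrite /h_ab [RHS]e; last first.
  by move=> x y xy; rewrite !perm1 /rkB /=; lia.
have pt x : blk_pt n0 x = x by apply: val_inj.
congr TwBn; apply/permP => -[c p].
have bf : forall c, blk_perm n0 (w_ab n a b) (c, p) = (c, w_ab n a b p).
  by move=> d; rewrite -{1}(pt p) blk_perm_in pt.
by rewrite bf; case: c; rewrite // -[(true, p)]/(neg (false, p)) (weylB_neg _ wW) wf.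
Qed.

Lemma reduced_block w : w \in weylB n ->
  (forall i : 'I_n, (i < a)%N -> ~~ descB i w) ->
  (forall i : 'I_n, (i < b)%N -> ~~ descB i (w^-1)%g) ->
  (forall p : 'I_n, (p < a)%N -> (b <= (w (false, p)).2)%N) ->
  forall p : 'I_n, w (false, p) = (false, w_ab n a b p).
Proof.
move=> wW rl rr big_.
have wVW := groupW (coxB n) wW.
have pos (p : 'I_n) : (p < a)%N -> (w (false, p)).1 = false.
  by move=> pa; apply: left_reduced_pos => // i hi; apply: rl; apply: leq_trans hi _.
have posV (p : 'I_n) : (p < b)%N -> ((w^-1)%g (false, p)).1 = false.
  by move=> pb; apply: left_reduced_pos => // i hi; apply: rr; apply: leq_trans hi _.
have inc := left_reduced_inc wW an rl.
have incV := left_reduced_inc wVW (leq_subr a n) rr.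
(* a strictly increasing map from an interval of size [c] to [d, d + c) *)
have exact_ (c d : nat) (g : 'I_n -> 'I_n) : (c <= n)%N -> (d + c = n)%N ->
    (forall p : 'I_n, (p < c)%N -> (d <= g p)%N) ->
    (forall p r : 'I_n, (p < r)%N -> (r < c)%N -> (g p < g r)%N) ->
    forall p : 'I_n, (p < c)%N -> g p = (d + p)%N :> nat.
  move=> cn dc lowb ginc p pc.
  have ge m (hm : (m < n)%N) : (m < c)%N -> (d + m <= g (Ordinal hm))%N.
    elim: m hm => [|m IH] hm mc; first by rewrite addn0 lowb.
    have hm' := ltnW hm; rewrite addnS.
    by apply: leq_ltn_trans (IH hm' (ltnW mc)) (ginc _ _ _ _) => /=.
  have le m (hm : (c - m.+1 < n)%N) : (m < c)%N ->
      (g (Ordinal hm) <= d + (c - m.+1))%N.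
    elim: m hm => [|m IH] hm mc; first by have := ltn_ord (g (Ordinal hm)); lia.
    have hm' : (c - m.+1 < n)%N by lia.
    have := IH hm' (ltnW mc); have := ginc (Ordinal hm) (Ordinal hm').
    by move=> /= h1 h2; have := h1 _ _; lia.
  have hp : (c - (c - p.+1).+1 < n)%N by lia.
  have eP : Ordinal hp = p by apply: val_inj => /=; lia.
  have := le _ hp; rewrite eP; have := ge _ (ltn_ord p) pc.
  have -> : Ordinal (ltn_ord p) = p by apply: val_inj.
  by move=> h1 h2; have := h2 _; lia.
have wlo (p : 'I_n) : (p < a)%N -> (w (false, p)).2 = (b + p)%N :> nat.
  by apply: (@exact_ a b (fun p => (w (false, p)).2)).
have bigV (p : 'I_n) : (p < b)%N -> (a <= ((w^-1)%g (false, p)).2)%N.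
  move=> pb; rewrite leqNgt; apply/negP => lt.
  have := wlo _ lt; have := posV p pb.
  case E0 : ((w^-1)%g (false, p)) => [c y] /= _.
  have -> : (false, y) = (w^-1)%g (false, p).
    by rewrite E0; have := posV p pb; rewrite E0 /= => ->.
  by rewrite permKV /=; lia.
have wVlo (p : 'I_n) : (p < b)%N -> ((w^-1)%g (false, p)).2 = (a + p)%N :> nat.
  by apply: (@exact_ b a (fun p => ((w^-1)%g (false, p)).2)); rewrite ?leq_subr.
move=> p; case: (ltnP p a) => [pa|ap].
  rewrite [LHS]surjective_pairing pos //; congr (_, _); apply: val_inj => /=.
  by rewrite wlo // w_abE // pa addnC.
have hp : (p - a < n)%N by have := ltn_ord p; lia.
have pb : (Ordinal hp < b)%N by have := ltn_ord p => /=; lia.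
have eq : (w^-1)%g (false, Ordinal hp) = (false, p).
  rewrite [LHS]surjective_pairing posV //; congr (_, _); apply: val_inj => /=.
  by rewrite wVlo //=; lia.
rewrite -eq permKV; congr (_, _); apply: val_inj => /=.
by rewrite w_abE // ltnNge ap.
Qed.

End BiPartIdempotent.

Section BiSpechtCorner.
Variables (R : comUnitRingType) (H : algType R) (T : nat -> H).
Variables (n : nat) (Q q : R).
Hypothesis TB : relsB T n Q q.
Variable a : nat.
Hypothesis an : (a <= n)%N.
Hypothesis Q1_regular : forall h : H, (Q + 1) *: h = 0 -> h = 0.
Local Notation b := (n - a)%N.
Local Notation E := (uhu T Q q n a).
Local Notation hab := (h_ab T n a b).
Local Notation hba := (h_ab T n b a).
Local Notation uP := (u_plus T q a).
Local Notation uM := (u_minus T Q q b).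
Local Notation Ha := (hecke_sub T (fun i => 0 < i < a)%N).
Local Notation Hb := (hecke_sub T (fun i => a < i < n)%N).
Local Notation Hb' := (hecke_sub T (fun i => 0 < i < b)%N).
Local Notation TwBn := (Tw (@gensB n) (fun i : 'I_n => T i)).

Variables z1 z2 : H.
Hypotheses (z1H : Ha z1) (z2H : Hb z2).

Lemma uhu_sandwich y1 y2 : Ha y1 -> Hb y2 ->
  E * z1 * z2 * y1 * y2 * hab * (E * z1 * z2) =
  E * (hab * E) * ((z1 * y1 * z1) * (z2 * y2 * z2)).
Proof.
move=> h1 h2.
have cz y : Ha y -> hab * E * y = y * (hab * E).
  by move=> hy; apply: (hab_uhu_comm TB an); apply: Ha_HL.
have cz' y : Hb y -> hab * E * y = y * (hab * E).
  by move=> hy; apply: (hab_uhu_comm TB an); apply: Hb_HL.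
have c1 := Ha_Hb_comm TB an.
have key : z1 * z2 * y1 * y2 * z1 * z2 = (z1 * y1 * z1) * (z2 * y2 * z2).
  rewrite !mulrA -(mulrA z1 z2 y1) -(c1 y1 z2) // mulrA.
  rewrite -(mulrA _ y2 z1) -(c1 z1 y2) // mulrA.
  by rewrite -(mulrA _ z2 z1) -(c1 z1 z2) // !mulrA.
move: hab E cz cz' => g e cz cz'; rewrite -key.
have ez : z1 * z2 * y1 * y2 * (g * e) = (g * e) * (z1 * z2 * y1 * y2).
  rewrite -(mulrA _ y2) -cz' // mulrA -(mulrA _ y1) -cz // mulrA.
  by rewrite -(mulrA _ z2) -cz' // mulrA -cz // !mulrA.
have -> : e * z1 * z2 * y1 * y2 * g * (e * z1 * z2) =
    e * (z1 * z2 * y1 * y2 * (g * e)) * z1 * z2 by rewrite !mulrA.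
by rewrite ez !mulrA.
Qed.

Hypothesis z1_corner : forall h, Ha h -> exists c, z1 * h * z1 = c *: z1.
Hypothesis z2_corner : forall h, Hb h -> exists c, z2 * h * z2 = c *: z2.

Local Notation x := (E * z1 * z2).
Local Notation xi := (E * (hab * E) * (z1 * z2)).

(* Small descents of [w] on either side are absorbed by [y1], [y2] or by the *)
(* eigenvectors [u_plus], [u_minus] of [T 0].  Without them, either [w] fixes *)
(* 0, so that [T 0] commutes with [Tw w] and the product is both [Q] and -1   *)
(* times itself, or [w] agrees with [w_ab] on the first [a] points.           *)
Lemma uhu_corner_Tw w : w \in weylB n -> forall y1 y2, Ha y1 -> Hb' y2 ->
  exists c, x * y1 * TwBn w * (y2 * x) = c *: xi.
Proof.
have [m] := ubnP (lenB w); elim: m w => // m IH w; rewrite ltnS => lw wW.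
move=> y1 y2 h1 h2.
have brd := braidB TB; have cox := coxB n.
have uPc : uP * (z1 * z2 * y1) = z1 * z2 * y1 * uP.
  apply: (u_plus_comm TB an); apply: subalg_mul; last exact: Ha_HL.
  by apply: subalg_mul; [apply: Ha_HL | apply: Hb_HL].
have xT0 : (0 < a)%N -> x * y1 * T 0%N = Q *: (x * y1).
  move=> a0; have -> : x * y1 = uM * hba * (z1 * z2 * y1) * uP.
    by rewrite -(mulrA (uM * _)) -uPc /uhu !mulrA.
  by rewrite -mulrA (u_plus_T0 TB) ?a0 // scalerAr.
have T0x : (0 < b)%N -> T 0%N * (y2 * x) = -1 *: (y2 * x).
  move=> b0; have -> : y2 * x = uM * (y2 * hba * uP * z1 * z2).
    by rewrite /uhu !mulrA -(u_minus_comm TB an h2).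
  by rewrite mulrA (T0_u_minus TB) ?scalerAl //; lia.
have [/existsP[i /andP[ia di]]|/existsPn nl] :=
    boolP [exists i : 'I_n, (i < a)%N && descB i w].
  have sW := coxM cox i wW.
  have ls : (lenB (gensB i * w)%g < m)%N.
    by apply: leq_trans lw; rewrite [X in (_ < X)%N](cox_down cox wW di).
  rewrite (Tw_down cox brd wW di).
  have [i0|i0] := posnP i.
    rewrite i0 in ia *; have [c e] := IH _ ls sW _ _ h1 h2.
    exists (Q * c); rewrite [x * y1 * (_ * _)]mulrA xT0 // -!scalerAl e scalerA.
    by [].
  have hyi : Ha (y1 * T i).
    by apply: subalg_mul h1 _; apply: subalg_gen; exists (i : nat); rewrite ?i0.
  have [c e] := IH _ ls sW _ _ hyi h2.
  by exists c; rewrite -e !mulrA.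
have [/existsP[i /andP[ib di]]|/existsPn nr] :=
    boolP [exists i : 'I_n, (i < b)%N && descB i (w^-1)%g].
  have sW := mulW cox wW (genW cox i).
  have ls : (lenB (w * gensB i)%g < m)%N.
    by apply: leq_trans lw; rewrite [X in (_ < X)%N](cox_downr cox wW di).
  rewrite (Tw_downr cox brd wW di).
  have [i0|i0] := posnP i.
    rewrite i0 in ib *; have [c e] := IH _ ls sW _ _ h1 h2.
    exists (-1 * c); rewrite [x * y1 * _]mulrA -[_ * T 0%N * _]mulrA T0x //.
    by rewrite -scalerAr e scalerA.
  have hyi : Hb' (T i * y2).
    by apply: subalg_mul h2; apply: subalg_gen; exists (i : nat); rewrite ?i0.
  have [c e] := IH _ ls sW _ _ h1 hyi.
  by exists c; rewrite -e !mulrA.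
have rl (i : 'I_n) : (i < a)%N -> ~~ descB i w.
  by move=> ia; have := nl i; rewrite ia.
have rr (i : 'I_n) : (i < b)%N -> ~~ descB i (w^-1)%g.
  by move=> ib; have := nr i; rewrite ib.
have [/existsP[p /andP[pa pb]]|/existsPn big_] :=
    boolP [exists p : 'I_n, (p < a)%N && ((w (false, p)).2 < b)%N].
  have n0 : (0 < n)%N by apply: leq_ltn_trans (ltn_ord p).
  pose o := Ordinal n0; have a0 : (0 < a)%N by apply: leq_ltn_trans pa.
  have b0 : (0 < b)%N by apply: leq_ltn_trans pb.
  have wVW := groupW cox wW.
  have inc := left_reduced_inc wW an rl.
  have incV := left_reduced_inc wVW (leq_subr a n) rr.
  have wo1 : (w (false, o)).1 = false.
    by apply: left_reduced_pos => // i hi; apply: rl; apply: leq_trans hi _.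
  have woE : w (false, o) = (false, (w (false, o)).2).
    by rewrite [LHS]surjective_pairing wo1.
  have ob : ((w (false, o)).2 < b)%N.
    have [e|ne] := eqVneq o p; first by rewrite e.
    apply: ltn_trans (inc o p _ pa) pb.
    by rewrite lt0n; apply: contraNneq ne => p0; apply/eqP/val_inj.
  have wo : w (false, o) = (false, o).
    rewrite woE; congr (_, _); apply/eqP; apply: contraT => ne.
    have lt : (o < (w (false, o)).2)%N.
      by rewrite lt0n; apply: contraNneq ne => e; apply/eqP/val_inj.
    by have := incV _ _ lt ob; rewrite -woE permK.
  have sw : (gensB o * w = w * gensB o)%g.
    have wt : w (true, o) = (true, o).
      by rewrite -[(true, o)]/(neg (false, o)) (weylB_neg _ wW) wo.
    rewrite !gensB0 //; have := tpermJ (true, o) (false, o) w.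
    by rewrite wo wt conjgE => e; rewrite -{2}e !mulgA mulgV mul1g.
  exists 0; rewrite scale0r; apply: Q1_regular; rewrite scalerDl scale1r.
  have u1 : T o * TwBn w = TwBn (gensB o * w)%g.
    by apply: (Tw_up cox brd) => //; apply: rl.
  have u2 : TwBn w * T o = TwBn (w * gensB o)%g.
    by apply: (Tw_upr cox brd) => //; apply: rr.
  have -> : Q *: (x * y1 * TwBn w * (y2 * x)) = x * y1 * (T 0%N * TwBn w) * (y2 * x).
    by rewrite [x * y1 * (T 0%N * _)]mulrA xT0 // -!scalerAl.
  rewrite u1 sw -u2 [x * y1 * (_ * T o)]mulrA -[_ * T o * _]mulrA T0x //.
  by rewrite scaleN1r mulrN addNr.
have wf := reduced_block an wW rl rr.
have whab : TwBn w = hab.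
  apply: (TwB_block TB an wW); apply: wf => p pa.
  by have := big_ p; rewrite pa /= -leqNgt.
have [y2' h2' e2] := uhu_shift TB an h2.
have [c1 e1] := z1_corner h1; have [c2 e2'] := z2_corner h2'.
exists (c1 * c2).
have cz y : Ha y \/ Hb y -> hab * E * y = y * (hab * E).
  by move=> hy; apply: (hab_uhu_comm TB an); case: hy; [apply: Ha_HL | apply: Hb_HL].
rewrite whab [(c1 * c2) *: _]scalerAr.
have -> : (c1 * c2) *: (z1 * z2) = (c1 *: z1) * (c2 *: z2).
  by rewrite -scalerAl -scalerAr scalerA.
rewrite -e1 -e2' -uhu_sandwich //.
have -> : y2 * x = E * y2' * z1 * z2 by rewrite 2!mulrA e2.
have -> : E * z1 * z2 * y1 * hab * (E * y2' * z1 * z2) =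
    E * z1 * z2 * y1 * (hab * E * y2') * z1 * z2.
  by move: (uhu T Q q n a) => e; rewrite !mulrA.
rewrite cz; last by right.
by move: (uhu T Q q n a) => e; rewrite !mulrA.
Qed.

Lemma uhu_corner h : Tspan (@gensB n) (weylB n) (fun i : 'I_n => T i) predT h ->
  exists c, x * h * x = c *: xi.
Proof.
apply: (Tspan_ind (K := fun h => exists c, x * h * x = c *: xi)).
- by exists 0; rewrite mulr0 mul0r scale0r.
- move=> y z [c ec] [d ed]; exists (c + d).
  by rewrite mulrDr mulrDl ec ed scalerDl.
- move=> d y [c ec]; exists (d * c).
  by rewrite -scalerAr -scalerAl ec scalerA.
- move=> w wW _; have [c ec] := uhu_corner_Tw wW (subalg1 _) (subalg1 _).
  by exists c; rewrite -ec mulr1 mul1r.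
Qed.

End BiSpechtCorner.

(** * The trace of u^- h u^+ *)

Section SignPatterns.
Variables (R : comUnitRingType) (H : algType R) (T : nat -> H).
Variables (n : nat) (Q q : R).
Hypothesis TB : relsB T n Q q.
Implicit Types (eps : nat -> bool) (w : {perm bool * 'I_n}).
Local Notation span := (Tspan (@gensB n) (weylB n) (fun i : 'I_n => T i)).

Definition signs eps w := [forall p : 'I_n, (w (false, p)).1 == eps p].

Definition swap_nat i p := if p == i.-1 then i else if p == i then i.-1 else p.

Lemma span_signs_ext eps eps' x : (forall p, (p < n)%N -> eps p = eps' p) ->
  span (signs eps) x -> span (signs eps') x.
Proof.
move=> e; apply: Tspan_sub => w _ /forallP h; apply/forallP => p.
by rewrite -e.
Qed.

Lemma signs_gen (i : 'I_n) eps w : (0 < i)%N ->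
  signs eps w -> signs (eps \o swap_nat i) (gensB i * w)%g.
Proof.
move=> i0 /forallP h; apply/forallP => p; rewrite permM gensBSE //=.
rewrite (eqP (h _)); apply/eqP; congr eps.
have ip := ord_predE i0; rewrite /swap_nat.
case: tpermP => [->|->|/eqP + /eqP +].
- by rewrite ip eqxx.
- by rewrite ip eqxx; case: eqP => //=; lia.
- by rewrite -!(inj_eq val_inj) [val (ord_pred i)]ip => /negPf-> /negPf->.
Qed.

Lemma gen_span_signs i eps x : (0 < i < n)%N -> (eps i ==> eps i.-1) ->
  span (signs eps) x -> span (signs (eps \o swap_nat i)) (T i * x).
Proof.
case/andP=> i0 hi hd; apply: Tspan_map => w wW sw.
pose j := Ordinal hi; have -> : T i = T j by [].
have j0 : (0 < j)%N by [].
have sjw := signs_gen j0 sw; have jwW := coxM (coxB n) j wW.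
case d: (descB j w); last first.
  by rewrite (Tw_up (coxB n) (braidB TB)) ?d //; apply: Tspan_Tw.
rewrite (Tw_quad (coxB n) (braidB TB) (quadB TB)) //.
apply: TspanD; apply: TspanZ; first exact: Tspan_Tw.
apply: Tspan_Tw => //.
have e : eps i = eps i.-1.
  have /forallP h := sw; move: hd.
  have hp : (ord_pred j : nat) = i.-1 by rewrite ord_predE.
  have := eqP (h j); have := eqP (h (ord_pred j)).
  rewrite hp /= => <- <-; rewrite !rkB_sign; move: d; rewrite descBS //.
  by move: (rkB _) (rkB _) => u1 u2; lia.
have /forallP h := sw; apply/forallP => p; rewrite (eqP (h p)) /= /swap_nat.
case: (nat_of_ord p =P i.-1) => [->|_]; first by rewrite e.
by case: (nat_of_ord p =P i) => [->|_]; rewrite ?e.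
Qed.

Definition set_sign eps m p := (p == m) || eps p.

Lemma T0_span_signs eps x : (0 < n)%N -> eps 0%N = false ->
  span (signs eps) x -> span (signs (set_sign eps 0%N)) (T 0%N * x).
Proof.
move=> n0 e0; apply: Tspan_map => w wW /forallP h.
pose j := Ordinal n0; have -> : T 0%N = T j by [].
have j0 : j = 0%N :> nat by [].
have pj : (w (false, j)).1 = false by rewrite (eqP (h j)).
rewrite (Tw_up (coxB n) (braidB TB)) ?descB0 ?pj //.
apply: Tspan_Tw; first exact: (coxM (coxB n)).
apply/forallP => p; rewrite permM gensB0E //= /set_sign.
rewrite -(inj_eq val_inj) /=; case: (nat_of_ord p =P 0%N) => [p0|_] /=.
  have -> : p = j by apply: val_inj; rewrite /= p0.
  by rewrite -[(true, j)]/(neg (false, j)) (weylB_neg _ wW) /= pj.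
by rewrite (eqP (h p)).
Qed.

Lemma murphy_span_signs m eps x : (m < n)%N -> (forall p, (p <= m)%N -> eps p = false) ->
  span (signs eps) x -> span (signs (set_sign eps m)) (murphy T m.+1 * x).
Proof.
elim: m x => [|m IH] x mn e hx.
  by rewrite murphy1; apply: T0_span_signs => //; apply: e.
rewrite murphyS // -2!mulrA.
have hx1 : span (signs eps) (T m.+1 * x).
  apply: span_signs_ext (gen_span_signs _ _ hx); rewrite ?e ?mn //.
  move=> p _; rewrite /= /swap_nat.
  by case: (p =P m) => [->|_]; [rewrite !e | case: (p =P m.+1) => [->|_ //]; rewrite !e].
have hx2 : span (signs (set_sign eps m)) (murphy T m.+1 * (T m.+1 * x)).
  by apply: IH => //; [apply: ltnW | move=> p pm; apply: e; apply: leqW].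
apply: span_signs_ext (gen_span_signs _ _ hx2); rewrite ?mn //.
  move=> p _; rewrite /= /swap_nat /set_sign /=.
  case: (p =P m) => [->|pm]; first by rewrite !e // (ltn_eqF (ltnSn m)) gtn_eqF.
  by case: (p =P m.+1) => [->|pm']; rewrite ?eqxx //; case: eqP.
by rewrite /set_sign eqxx implybT.
Qed.

Lemma prod_span_signs b e k eps x : (k <= n)%N ->
  (forall p, (p < k)%N -> eps p = false) -> span (signs eps) x ->
  exists2 y,
    span (fun w => [forall p : 'I_n, (k <= p)%N ==> ((w (false, p)).1 == eps p)]
                   && [exists p : 'I_n, (p < k)%N && (w (false, p)).1]) y
    & murphy_prod q (murphy T) b e k * x
      = (\prod_(1 <= i < k.+1) (b * q ^+ i.-1)) *: x + y.
Proof.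
elim: k eps x => [|k IH] eps x kn e0 hx.
  exists 0; first exact: Tspan0.
  by rewrite /murphy_prod !big_geq // mul1r scale1r addr0.
have hL : span (signs (set_sign eps k)) (murphy T k.+1 * x).
  by apply: murphy_span_signs.
have [|y hy ey] := IH eps x (ltnW kn) _ hx.
  by move=> p pk; apply: e0; apply: leqW.
have [|y' hy' ey'] := IH (set_sign eps k) (murphy T k.+1 * x) (ltnW kn) _ hL.
  by move=> p pk; rewrite /set_sign ltn_eqF //= e0 // leqW.
rewrite murphy_prodS -mulrA /murphy_factor mulrDl -!scalerAl mul1r mulrDr.
rewrite -!scalerAr ey ey'.
set c := \prod_(1 <= i < k.+1) _; set d := b * q ^+ k.
exists (d *: y + e *: (c *: (murphy T k.+1 * x) + y')); last first.
  rewrite scalerDr scalerA addrA [\prod_(1 <= i < k.+2) _]big_nat_recr //=.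
  by rewrite [d * _]mulrC.
apply: TspanD; apply: TspanZ.
  apply: Tspan_sub hy => w _ /andP[/forallP h1 /existsP[p /andP[pk hp]]].
  apply/andP; split; last by apply/existsP; exists p; rewrite hp ltnW.
  by apply/forallP => r; apply/implyP => kr; apply: (implyP (h1 r)); apply: ltnW.
apply: TspanD; [apply: TspanZ; apply: Tspan_sub hL | apply: Tspan_sub hy'] => w _.
  move=> /forallP h; apply/andP; split.
    apply/forallP => r; apply/implyP => kr; rewrite (eqP (h r)) /set_sign.
    by rewrite gtn_eqF.
  apply/existsP; exists (Ordinal kn); rewrite (eqP (h _)) /set_sign /= eqxx.
  by rewrite ltnSn.
move=> /andP[/forallP h1 /existsP[p /andP[pk hp]]].
apply/andP; split; last by apply/existsP; exists p; rewrite hp ltnW.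
apply/forallP => r; apply/implyP => kr; have := implyP (h1 r) (ltnW kr).
by rewrite /set_sign gtn_eqF.
Qed.

Lemma cycle_span_signs j m eps x : (j + m < n)%N ->
  (forall p, (j < p <= j + m)%N -> eps p = false) -> span (signs eps) x ->
  span (signs (fun p => if p == (j + m)%N then eps j
                        else if (j <= p < j + m)%N then false else eps p))
       ((\prod_(0 <= i < m) T (m + j - i)%N) * x).
Proof.
elim: m => [|m IH] jm e hx.
  rewrite big_geq // mul1r addn0; apply: span_signs_ext hx => p _.
  case: (p =P j) => [e0|_]; first by rewrite e0.
  by case: ifP => //; lia.
rewrite big_ltn // subn0 big_add1 /=.
have hm : (j + m < n)%N by lia.
have e' p : (j < p <= j + m)%N -> eps p = false by move=> hp; apply: e; lia.
have {}IH := IH hm e' hx; rewrite -mulrA.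
have -> : \prod_(0 <= i < m) T (m.+1 + j - i.+1)%N = \prod_(0 <= i < m) T (m + j - i)%N.
  by apply: eq_bigr => i _; rewrite addSn subSS.
apply: span_signs_ext (gen_span_signs _ _ IH).
- move=> p pn; rewrite /= /swap_nat addSn /= [(m + j)%N]addnC addnS.
  have em := e (j + m).+1.
  case: (p =P (j + m)%N) => [->|h1].
    by rewrite em; [repeat (case: ifP => //); lia | lia].
  case: (p =P (j + m).+1) => [_|h2]; first by rewrite eqxx.
  by rewrite (introF eqP h1); repeat (case: ifP => //); lia.
- lia.
- rewrite addSn /= [(m + j)%N]addnC eqxx ifF; last by lia.
  rewrite ifF; last by lia.
  by rewrite e //; lia.
Qed.

End SignPatterns.

Section TraceOfIdempotent.
Variables (R : comUnitRingType) (H : algType R) (T : nat -> H).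
Variables (n : nat) (Q q : R).
Hypothesis TB : relsB T n Q q.
Variable a : nat.
Hypothesis an : (a <= n)%N.
Local Notation b := (n - a)%N.
Local Notation E := (uhu T Q q n a).
Local Notation hab := (h_ab T n a b).
Local Notation hba := (h_ab T n b a).
Local Notation uM := (u_minus T Q q b).
Local Notation TwBn := (Tw (@gensB n) (fun i : 'I_n => T i)).
Local Notation span := (Tspan (@gensB n) (weylB n) (fun i : 'I_n => T i)).

Let ba : (b + a = n)%N. Proof. exact: subnK. Qed.

Lemma hba_span_signs (eps : nat -> bool) x : (forall p, (a <= p)%N -> eps p = false) ->
  span (@signs n eps) x ->
  span (@signs n (fun p => if (p < b)%N then false else eps (p - b)%N)) (hba * x).
Proof.
move=> e hx; rewrite (h_abE (relsB_A TB) ba).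
have gen d : (d <= a)%N -> span (@signs n (fun p => if (p < a - d)%N then eps p
    else if (p < a - d + b)%N then false else eps (p - b)%N))
  ((\prod_(a - d <= j < a) \prod_(0 <= i < b) T (b + j - i)%N) * x).
  elim: d => [|d IH] da.
    rewrite subn0 big_geq // mul1r; apply: span_signs_ext hx => p pn.
    by case: (ltnP p a) => // pa; rewrite (e p pa) ifT //; lia.
  have e1 : (a - d = (a - d.+1).+1)%N by lia.
  have hm : (a - d.+1 < a)%N by lia.
  rewrite big_ltn // -e1 -mulrA.
  have jm : (a - d.+1 + b < n)%N by lia.
  apply: span_signs_ext (cycle_span_signs TB jm _ (IH (ltnW da))).
    move=> p pn; rewrite e1; move: (a - d.+1)%N hm jm => m hm jm.
    case: (p =P (m + b)%N) => [->|h1].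
      by rewrite ltnSn ifF ?ifF ?addnK //; lia.
    by repeat (case: ifP => //); lia.
  move=> p hp; rewrite e1; move: (a - d.+1)%N hm hp => m hm hp.
  by rewrite ifF ?ifT //; lia.
have := gen a (leqnn a); rewrite subnn; apply: span_signs_ext => p _.
by rewrite ltn0 add0n.
Qed.

Variable tr : H -> R.
Hypothesis tr_lin : forall c x y, tr (c *: x + y) = c * tr x + tr y.
Hypothesis trT : forall w, w \in weylB n -> tr (TwBn w) = (w == 1%g)%:R.

Lemma tr_span_neq1 (P : pred {perm bool * 'I_n}) x :
  (forall w, w \in weylB n -> P w -> w != 1%g) -> span P x -> tr x = 0.
Proof.
move=> P1; apply: (Tspan_ind (K := fun y => tr y = 0)).
- exact: tr0.
- by move=> y z ey ez; rewrite (trD tr_lin) ey ez addr0.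
- by move=> c y ey; rewrite (trZ tr_lin) ey mulr0.
- by move=> w wW Pw; rewrite trT // (negPf (P1 w wW Pw)).
Qed.

Lemma neg_neq1 (w : {perm bool * 'I_n}) (p : 'I_n) : (w (false, p)).1 -> w != 1%g.
Proof. by apply: contraTneq => ->; rewrite perm1. Qed.

Local Notation cP := (\prod_(1 <= i < a.+1) (1 * q ^+ i.-1)).
Local Notation cM := (\prod_(1 <= i < b.+1) (Q * q ^+ i.-1)).

Lemma tr_uhu_positive w : w \in weylB n -> @signs n (fun=> false) w ->
  tr (E * TwBn w) = cM * cP * tr (hba * TwBn w).
Proof.
move=> wW sw.
have [//|y hy ey] := prod_span_signs (q := q) TB 1 1 an _ (Tspan_Tw _ _ wW sw).
have hbasp v eps : v \in weylB n -> @signs n eps v ->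
    (forall p, (a <= p)%N -> eps p = false) ->
    exists2 y, span (fun w => [exists p : 'I_n, (p < b)%N && (w (false, p)).1]) y &
      uM * (hba * TwBn v) = cM *: (hba * TwBn v) + y.
  move=> vW sv he; have := hba_span_signs he (Tspan_Tw _ _ vW sv) => hx.
  have [|y' hy' ey'] := prod_span_signs (q := q) TB Q (-1) (leq_subr a n) _ hx.
    by move=> p ->.
  exists y'; last by rewrite u_minusE.
  by apply: Tspan_sub hy' => u _ /andP[].
have negE (v : {perm bool * 'I_n}) :
    [exists p : 'I_n, (p < b)%N && (v (false, p)).1] -> v != 1%g.
  by case/existsP=> p /andP[_]; apply: neg_neq1.
rewrite /uhu -!mulrA u_plusE ey !mulrDr -!scalerAr (trD tr_lin) (trZ tr_lin).
have [//|y0 hy0 ->] := hbasp w (fun=> false) wW sw.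
rewrite (trD tr_lin) (trZ tr_lin) (tr_span_neq1 (fun u _ => negE u) hy0) addr0.
rewrite mulrCA; suff -> : tr (uM * (hba * y)) = 0 by rewrite addr0.
apply: (Tspan_ind (K := fun y => tr (uM * (hba * y)) = 0)) hy.
- by rewrite !mulr0 (tr0 tr_lin).
- by move=> u v eu ev; rewrite !mulrDr (trD tr_lin) eu ev addr0.
- by move=> c u eu; rewrite -!scalerAr (trZ tr_lin) eu mulr0.
move=> v vW /andP[/forallP h1 /existsP[r /andP[ra hr]]].
pose eps p := (p < a)%N && oapp (fun i : 'I_n => (v (false, i)).1) false (insub p).
have epsE (p : 'I_n) : eps p = (p < a)%N && (v (false, p)).1 by rewrite /eps valK.
have sv : @signs n eps v.
  apply/forallP => p; rewrite epsE; case: (ltnP p a) => //= ap.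
  by have := implyP (h1 p) ap.
have epsa p : (a <= p)%N -> eps p = false by rewrite /eps ltnNge => ->.
have [y1 hy1 ->] := hbasp v eps vW sv epsa.
rewrite (trD tr_lin) (trZ tr_lin) (tr_span_neq1 (fun u _ => negE u) hy1) addr0.
rewrite (@tr_span_neq1 _ _ _ (hba_span_signs epsa (Tspan_Tw _ _ vW sv))) ?mulr0 //.
move=> u _ /forallP hu; have hrb : (r + b < n)%N by lia.
apply: (@neg_neq1 u (Ordinal hrb)); rewrite (eqP (hu _)) /= ifF; last by lia.
by rewrite addnK epsE ra hr.
Qed.

Let aan : (0 + a <= n)%N. Proof. by []. Qed.
Let abn : (a + b <= n)%N. Proof. by rewrite subnKC. Qed.
Let n0n : (0 + n <= n)%N. Proof. by []. Qed.

Let pt0 x : blk_pt n0n x = x. Proof. exact: val_inj. Qed.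

Lemma TwB_hba : exists t : seq 'I_n,
  [/\ reduced (@gensB n) (@lenB n) t,
      forall c p, wordprod (@gensB n) t (c, p) = (c, w_ab n b a p),
      hba = \prod_(i <- t) T i
    & \prod_(i <- t) parB Q q i = q ^+ (a * b)].
Proof.
have [rt et] := redwordP (coxA n) (in_setT (w_ab n b a)).
exists [seq blk_gen n0n i | i <- redword (@gensA n) (w_ab n b a)]; split.
- exact: blk_reduced.
- by move=> c p; have := blk_perm_in n0n (w_ab n b a) c p; rewrite !pt0.
- by rewrite big_map.
rewrite big_map; under eq_bigr => i _ do rewrite /parB /=.
have sz : size (redword (@gensA n) (w_ab n b a)) = (a * b)%N.
  by rewrite (eqP rt) et lenA_w_ab // mulnC.
rewrite -sz; elim: (redword _ _) => [|i l IH] /=; first by rewrite big_nil.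
by rewrite big_cons IH exprS.
Qed.

Lemma tr_uhu_basis (w1 : 'S_a) (w2 : 'S_b) :
  tr (E * (TwA T w1 * (TwA (fun i => T (a + i)%N) w2 * hab))) =
  cM * cP * q ^+ (a * b) * (w1 == 1%g)%:R * (w2 == 1%g)%:R.
Proof.
have cox := coxB n.
pose v0 := blk_perm n0n (w_ab n a b).
have v0E c p : v0 (c, p) = (c, w_ab n a b p).
  by have := blk_perm_in n0n (w_ab n a b) c p; rewrite !pt0.
have v0W : v0 \in weylB n by apply: blk_prodW.
have ab : (a + b = n)%N by rewrite subnKC.
have habE : hab = TwBn v0.
  by apply/esym; apply: (TwB_block TB an v0W) => p; rewrite v0E.
pose v1 := (blk_perm abn w2 * v0)%g.
have e1 : TwA (fun i => T (a + i)%N) w2 * hab = TwBn v1.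
  rewrite habE (@blk_perm_mul _ _ _ abn _ _ _ _ _ TB) // => x y xy.
  by rewrite !v0E /rkB /= !w_abE //= !ifF; lia.
pose v2 := (blk_perm aan w1 * v1)%g.
have v1W : v1 \in weylB n by apply: (mulW cox) => //; apply: blk_prodW.
have v1a c (x : 'I_a) : v1 (c, blk_pt aan x) = (c, w_ab n a b (blk_pt aan x)).
  rewrite permM /blk_perm blk_prod_out ?v0E //=.
  by have := ltn_ord x; lia.
have v1b c (x : 'I_b) : v1 (c, blk_pt abn x) = (c, w_ab n a b (blk_pt abn (w2 x))).
  by rewrite permM blk_perm_in v0E.
have e2 : TwA T w1 * TwBn v1 = TwBn v2.
  rewrite -(@blk_perm_mul _ _ _ aan _ _ _ _ _ TB) // => x y xy.
  rewrite !v1a /rkB /= !w_abE //=; have := ltn_ord x; have := ltn_ord y.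
  by move=> h1 h2; rewrite !ifT; lia.
have v2W : v2 \in weylB n by apply: (mulW cox) => //; apply: blk_prodW.
have v2a c (x : 'I_a) : v2 (c, blk_pt aan x) = (c, w_ab n a b (blk_pt aan (w1 x))).
  by rewrite permM blk_perm_in v1a.
have v2b c (x : 'I_b) : v2 (c, blk_pt abn x) = (c, w_ab n a b (blk_pt abn (w2 x))).
  rewrite permM /blk_perm blk_prod_out ?v1b //=.
  by have := ltn_ord x; lia.
have cover (p : 'I_n) : (exists x, p = blk_pt aan x) \/ (exists x, p = blk_pt abn x).
  have [pa|ap] := ltnP p a; [left | right].
    by exists (Ordinal pa); apply: val_inj.
  have h : (p - a < b)%N by have := ltn_ord p; lia.
  by exists (Ordinal h); apply: val_inj => /=; lia.
have sv2 : @signs n (fun=> false) v2.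
  by apply/forallP => p; case: (cover p) => -[x ->]; rewrite ?v2a ?v2b.
have [t [rt tE hbaE qE]] := TwB_hba.
rewrite e1 e2 tr_uhu_positive // hbaE.
rewrite (tr_word cox (braidB TB) (quadB TB) tr_lin trT) // qE.
have invw x : w_ab n a b (w_ab n b a x) = x.
  by apply: val_inj; rewrite /= !w_abE // ; have := ltn_ord x; repeat (case: ifP); lia.
have invw' x : w_ab n b a (w_ab n a b x) = x.
  by apply: val_inj; rewrite /= !w_abE // ; have := ltn_ord x; repeat (case: ifP); lia.
have -> : (wordprod (@gensB n) t * v2 == 1)%g = (w1 == 1%g) && (w2 == 1%g).
  apply/eqP/andP => [e|[/eqP w1E /eqP w2E]].
    have key p : v2 (false, w_ab n b a p) = (false, p).
      by have /permP/(_ (false, p)) := e; rewrite permM tE perm1.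
    split; apply/eqP/permP => x; rewrite perm1.
      have := key (w_ab n a b (blk_pt aan x)); rewrite invw' v2a => -[/perm_inj].
      by move=> /(congr1 val)/= /val_inj.
    have := key (w_ab n a b (blk_pt abn x)); rewrite invw' v2b => -[/perm_inj].
    by move=> /(congr1 val)/= /addnI/val_inj.
  apply/permP => -[c p]; rewrite permM tE perm1.
  have v2E y : v2 (c, y) = (c, w_ab n a b y).
    by case: (cover y) => -[x ->]; rewrite ?v2a ?v2b ?w1E ?w2E perm1.
  by rewrite v2E invw.
by case: (w1 == 1%g); case: (w2 == 1%g); rewrite /= !(mulr0, mul0r, mulr1, mul1r).
Qed.

End TraceOfIdempotent.

(** * Specialization and comparison *)

Section SpecializationKernel.
Variable n : nat.
Local Notation HB2 := (heckeB n tv2 v2).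
Local Notation HB1 := (heckeB n 1 v).
Local Notation P2 := (Presentation (@relB_char A2 n tv2 v2)).
Local Notation P1 := (Presentation (@relB_char A n 1 v)).

(* Sending the generators over [A] to those over [A2] is multiplicative only  *)
(* modulo [tv2 - 1], which is enough to invert the specialization.            *)
Definition eq_mod (x y : HB2) : Prop := exists z, x - y = (tv2 - 1) *: z.

Lemma eq_mod_refl x : eq_mod x x.
Proof. by exists 0; rewrite subrr scaler0. Qed.

Lemma eq_mod_sym x y : eq_mod x y -> eq_mod y x.
Proof. by move=> [z e]; exists (- z); rewrite scalerN -e opprB. Qed.

Lemma eq_mod_trans x y z : eq_mod x y -> eq_mod y z -> eq_mod x z.
Proof.
move=> [u eu] [w ew]; exists (u + w).
by rewrite scalerDr -eu -ew addrA subrK.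
Qed.

Lemma eq_modD x x' y y' :
  eq_mod x x' -> eq_mod y y' -> eq_mod (x + y) (x' + y').
Proof.
move=> [u eu] [w ew]; exists (u + w).
by rewrite scalerDr -eu -ew opprD addrACA.
Qed.

Lemma eq_modM x x' y y' :
  eq_mod x x' -> eq_mod y y' -> eq_mod (x * y) (x' * y').
Proof.
move=> [u eu] [w ew]; exists (u * y + x' * w).
rewrite scalerDr scalerAl scalerAr -eu -ew mulrBl mulrBr.
by rewrite addrA subrK.
Qed.

Let c : {rmorphism A -> HB2} :=
  [the {rmorphism A2 -> HB2} of in_alg HB2] \o [the {rmorphism A -> A2} of @laurentC A].

Let ev := @term_eval A P1 HB2 c (fun i : 'I_n => TB n tv2 v2 i).

Let cE a : c a = (laurentC a)%:A. Proof. by []. Qed.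

Lemma pcong_eq_mod t u : pcong (P := P1) t u -> eq_mod (ev t) (ev u).
Proof.
have TBr := TB_relsB n tv2 v2.
have c1 : (laurentC (1 : A))%:A = 1 :> HB2 by rewrite rmorph1 scale1r.
have c0 : (laurentC (0 : A))%:A = 0 :> HB2 by rewrite rmorph0 scale0r.
have cN a : (laurentC (- a : A))%:A = - (laurentC a)%:A :> HB2.
  by rewrite rmorphN scaleNr.
elim=> {t u}.
- move=> t u [i i0|i i0|i j i0 j1|i j i0 ji|i j ij]; rewrite /ev /=.
  + have n0 : (0 < n)%N by apply: leq_ltn_trans (ltn_ord i).
    exists (TB n tv2 v2 i + 1); rewrite cN c1 c0 subr0 i0.
    rewrite mulrDl mulrBr mulr1 mul1r addrA subrK (relsB_quad TBr n0).
    by rewrite scalerDr [(tv2 - 1) *: 1]scalerBl scale1r addrA.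
  + rewrite c1 c0 rmorphN quadratic_expand.
    rewrite (relsA_quad (relsB_A TBr)) ?i0 ?subrr //= ?ltn_ord //.
    exact: eq_mod_refl.
  + have n1 : (1 < n)%N by rewrite -j1.
    by rewrite i0 j1 (relsB_braid TBr n1); apply: eq_mod_refl.
  + rewrite ji (relsA_braid (relsB_A TBr)) //; first exact: eq_mod_refl.
    by rewrite -ji.
  + rewrite (gen_far TBr) ?ij ?ltn_ord //; exact: eq_mod_refl.
- by move=> t; apply: eq_mod_refl.
- by move=> t u _; apply: eq_mod_sym.
- by move=> t u w _ h1 _; apply: eq_mod_trans.
- by move=> t t' u u' _ h1 _; apply: eq_modD.
- by move=> t t' u u' _ h1 _; apply: eq_modM.
- by move=> t u w; rewrite /ev /= addrA; apply: eq_mod_refl.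
- by move=> t u; rewrite /ev /= addrC; apply: eq_mod_refl.
- by move=> t; rewrite /ev /= c0 add0r; apply: eq_mod_refl.
- move=> t; rewrite /ev /= cN c1 c0 mulN1r addNr.
  exact: eq_mod_refl.
- by move=> t u w; rewrite /ev /= mulrA; apply: eq_mod_refl.
- by move=> t; rewrite /ev /= c1 mul1r; apply: eq_mod_refl.
- by move=> t; rewrite /ev /= c1 mulr1; apply: eq_mod_refl.
- by move=> t u w; rewrite /ev /= mulrDl; apply: eq_mod_refl.
- by move=> t u w; rewrite /ev /= mulrDr; apply: eq_mod_refl.
- by move=> a b; rewrite /ev /= rmorphD scalerDl; apply: eq_mod_refl.
- by move=> a b; rewrite /ev /= rmorphM mulr_algl scalerA; apply: eq_mod_refl.
- by move=> a t; rewrite /ev /= mulr_algl mulr_algr; apply: eq_mod_refl.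
Qed.

Fixpoint term_at1 (t : term A2 'I_n) : term A 'I_n :=
  match t with
  | TGen i => TGen i
  | TCst a => TCst (laurent_at1 a)
  | TAdd t u => TAdd (term_at1 t) (term_at1 u)
  | TMul t u => TMul (term_at1 t) (term_at1 u)
  end.

Lemma term_at1_mod t : eq_mod (\pi_(presalg P2) t) (ev (term_at1 t)).
Proof.
elim: t => [i|a|t ht u hu|t ht u hu].
- rewrite /ev /= (TB_gen tv2 v2 (ltn_ord i)).
  have -> : Ordinal (ltn_ord i) = i by apply: val_inj.
  exact: eq_mod_refl.
- have [y {1}->] := laurent_at1_mod a; exists y%:A.
  by rewrite pi_cst [ev _]cE scalerDl addrAC subrr add0r scalerA.
- by rewrite pi_add; apply: eq_modD.
- by rewrite pi_mul; apply: eq_modM.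
Qed.

Variable phi : {rmorphism HB2 -> HB1}.
Hypothesis phiT : forall i, phi (TB n tv2 v2 i) = TB n 1 v i.
Hypothesis phiZ : forall a x, phi (a *: x) = laurent_at1 a *: phi x.

Lemma specialization_kernel x : phi x = 0 -> exists y, x = (tv2 - 1) *: y.
Proof.
have phi_pi t : phi (\pi_(presalg P2) t) = \pi_(presalg P1) (term_at1 t).
  elim: t => [i|a|t ht u hu|t ht u hu].
  - have -> : \pi_(presalg P2) (TGen i) = TB n tv2 v2 i.
      rewrite (TB_gen tv2 v2 (ltn_ord i)).
      by have -> : Ordinal (ltn_ord i) = i by apply: val_inj.
    rewrite phiT (TB_gen 1 v (ltn_ord i)).
    by have -> : Ordinal (ltn_ord i) = i by apply: val_inj.
  - by rewrite !pi_cst phiZ rmorph1.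
  - by rewrite !pi_add rmorphD ht hu.
  - by rewrite !pi_mul rmorphM ht hu.
elim/quotW: x => t; rewrite phi_pi => e.
have /pcongP/pcong_eq_mod h : \pi_(presalg P1) (term_at1 t) == \pi_(presalg P1) (TCst 0).
  by rewrite e.
have [y] := eq_mod_trans (term_at1_mod t) h.
by rewrite /ev /= rmorph0 scale0r subr0 => ->; exists y.
Qed.

End SpecializationKernel.

Lemma v_unit : v \is a GRing.unit.
Proof. exact: laurentX_unit. Qed.

Lemma v2_unit : v2 \is a GRing.unit.
Proof. by apply: (rmorph_unit (@laurentC A)); apply: v_unit. Qed.

Lemma v_frac_neq0 : v%:F != 0.
Proof. by rewrite tofrac_eq0; apply: laurentX_neq0. Qed.

Lemma v2_frac_neq0 : v2%:F != 0.
Proof.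
rewrite tofrac_eq0; apply: contraTneq v2_unit => ->.
by rewrite unitr0.
Qed.

Lemma tv2_frac_neq0 : tv2%:F != 0.
Proof. by rewrite tofrac_eq0; apply: laurentX_neq0. Qed.

Lemma v1_frac_neq0 : v%:F + 1 != 0.
Proof.
rewrite -tofrac1 -tofracD tofrac_eq0.
by have := laurentX_addC_neq0 (1 : int); rewrite rmorph1.
Qed.

Lemma tv1_frac_neq0 : tv2%:F + 1 != 0.
Proof.
rewrite -tofrac1 -tofracD tofrac_eq0.
by have := laurentX_addC_neq0 (1 : A); rewrite rmorph1.
Qed.

Lemma v21_frac_neq0 : v2%:F + 1 != 0.
Proof.
rewrite -tofrac1 -tofracD tofrac_eq0 -(rmorph1 (@laurentC A)) -rmorphD.
rewrite -(rmorph0 (@laurentC A)) (inj_eq (@laurentC_inj A)).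
by have := v1_frac_neq0; rewrite -tofrac1 -tofracD tofrac_eq0.
Qed.

Lemma natr_fracA_neq0 d : (0 < d)%N -> d%:R != 0 :> {fraction A}.
Proof.
move=> d0; rewrite -(rmorph_nat (@tofrac A)) tofrac_eq0.
rewrite -(rmorph_nat (@laurentC int)) -(rmorph0 (@laurentC int)).
by rewrite (inj_eq (@laurentC_inj int)) Num.Theory.pnatr_eq0 -lt0n.
Qed.

Lemma scalar_lin (K : comNzRingType) (V : lmodType K) (tr : {scalar V}) c x y :
  tr (c *: x + y) = c * tr x + tr y.
Proof. by rewrite linearP. Qed.

Section SchurA.
Variables (lam : seq nat) (s : A).
Hypotheses (pl : is_partition lam) (hs : schurA lam s).
Local Notation k := (sumn lam).
Local Notation HA := (heckeA k v).
Local Notation HK := (heckeA k v%:F).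
Local Notation T := (TA k v).
Local Notation z := (z_el T v lam).

Lemma schurA_corner :
  [/\ s != 0, forall h : HA, (v + 1) *: h = 0 -> h = 0
    & exists (w : 'S_k) (c : 'S_k -> A), [/\ c 1%g != 0,
        z * TwA T w = \sum_u c u *: TwA T u
      & z * TwA T w * z = (s * c 1%g) *: z]].
Proof.
have [tr [trA schur]] := hs.
have TK := TA_relsA k (v%:F).
have [phi [phiT phiZ]] :=
  @heckeA_lift A _ HK [the {rmorphism A -> {fraction A}} of @tofrac A] _ k v TK.
have trT w : w \in setT -> tr (Tw (@gensA k) (fun i : 'I_k.-1 => TA k v%:F i.+1) w)
    = (w == 1%g)%:R by move=> _; apply: trA.
have lin := scalar_lin tr.
have dom : GRing.integral_domain_axiom {fraction A}.
  by move=> x y /eqP; rewrite mulf_eq0.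
have phi_sum (c : 'S_k -> A) : phi (\sum_u c u *: TwA T u) =
    \sum_u (c u)%:F *: TwA (TA k v%:F) u.
  rewrite rmorph_sum; apply: eq_bigr => u _.
  by rewrite phiZ (phi_TwA phiT).
have phi_inj : injective phi.
  apply: raddf_inj => x; have [c ->] := heckeA_span x.
  move=> /(etrans (esym (phi_sum c))) e; rewrite big1 // => u _.
  have : (c u)%:F = 0.
    apply: (Tw_independent (coxA k) (braidA TK) (quadA TK) lin trT (fun=> v_frac_neq0)
      dom (c := fun u => (c u)%:F)) (in_setT u).
    by rewrite -[RHS]e; apply: eq_bigl => w; rewrite in_setT.
  by move/eqP; rewrite tofrac_eq0 => /eqP ->; rewrite scale0r.
have phi_tr (c : 'S_k -> A) : tr (phi (\sum_u c u *: TwA T u)) = (c 1%g)%:F.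
  rewrite phi_sum linear_sum (bigD1 1%g) //= big1 ?addr0 => [|u /negPf u1].
    by rewrite linearZ /= trA eqxx mulr1.
  by rewrite linearZ /= trA u1 mulr0.
have phi_z : phi z = z_el (TA k v%:F) v%:F lam by apply: phi_z_el => //; apply: v_unit.
have nondeg x : (forall h, tr (h * x) = 0) -> x = 0.
  apply: (tr_nondegenerate (coxA k) (braidA TK) (quadA TK) lin trT
    (fun=> v_frac_neq0) dom).
  have [c ->] := heckeA_span x; exists c.
  by apply: eq_bigl => w; rewrite in_setT.
have reg (h : HK) : (v%:F + 1) *: h = 0 -> h = 0.
  by move=> /eqP; rewrite scaler_eq0 (negPf v1_frac_neq0) => /eqP.
have vKu : v%:F \is a GRing.unit by rewrite unitfE v_frac_neq0.
rewrite -phi_z in schur.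
have zhz h : exists c, phi z * h * phi z = c *: phi z.
  by rewrite phi_z; apply: (zhz_z_el pl TK vKu reg); apply: heckeA_sub.
have corner := schur_corner nondeg schur zhz.
split.
- by have := schur_element_neq0 schur; rewrite tofrac_eq0.
- move=> h e; apply: phi_inj; rewrite rmorph0; apply: reg.
  by rewrite -[in LHS]tofrac1 -tofracD -phiZ e rmorph0.
have [w tw] : exists w : 'S_k, tr (phi z * TwA (TA k v%:F) w) != 0.
  apply/not_existsP => all0.
  have /eqP := schur_generator_neq0 schur natr_fracA_neq0; apply.
  apply: (square_zero_ideal nondeg schur) => h.
  rewrite corner; have [c ->] := heckeA_span h.
  rewrite mulr_sumr linear_sum big1 ?mulr0 ?scale0r // => u _.
  rewrite -scalerAr linearZ /=; have /negP := all0 u; rewrite negbK => /eqP ->.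
  by rewrite mulr0.
have [c ec] := heckeA_span (z * TwA T w).
have trc : tr (phi z * TwA (TA k v%:F) w) = (c 1%g)%:F.
  by rewrite -(phi_TwA phiT) -rmorphM ec phi_tr.
exists w, c; split=> //.
  by rewrite trc tofrac_eq0 in tw.
apply: phi_inj; rewrite phiZ.
have -> : phi (z * TwA T w * z) = phi z * TwA (TA k v%:F) w * phi z.
  by rewrite (rmorphM phi (z * _)) (rmorphM phi z) (phi_TwA phiT).
by rewrite corner trc /= tofracM.
Qed.

End SchurA.

Lemma hecke_sub_unshift (R : comUnitRingType) (H : algType R) (T : nat -> H) a n x :
  hecke_sub T (fun i => a < i < n)%N x ->
  hecke_sub (fun i => T (a + i)%N) (fun i => 0 < i < n - a)%N x.
Proof.
apply: subalg_mono => y [i hi ->]; exists (i - a)%N; first by lia.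
by rewrite subnKC //; lia.
Qed.

Lemma tr_uhu_basis_eq (R : comUnitRingType) (H : algType R) (T : nat -> H)
    (n : nat) (Q q : R) (TB : relsB T n Q q) (a b : nat) (tr : H -> R) :
  (a + b = n)%N -> (forall c x y, tr (c *: x + y) = c * tr x + tr y) ->
  (forall w, w \in weylB n ->
     tr (Tw (@gensB n) (fun i : 'I_n => T i) w) = (w == 1%g)%:R) ->
  forall (w1 : 'S_a) (w2 : 'S_b),
  tr (uhu T Q q n a *
        (TwA T w1 * (TwA (fun i => T (a + i)%N) w2 * h_ab T n a (n - a)))) =
  \prod_(1 <= i < b.+1) (Q * q ^+ i.-1) * \prod_(1 <= i < a.+1) (1 * q ^+ i.-1)
    * q ^+ (a * b) * (w1 == 1%g)%:R * (w2 == 1%g)%:R.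
Proof.
move=> abn; have eb : b = (n - a)%N by rewrite -abn addKn.
have an : (a <= n)%N by rewrite -abn leq_addr.
by move: eb {abn} => ->; apply: tr_uhu_basis.
Qed.

Lemma v_power_count n a b : (a + b = n)%N ->
  \prod_(1 <= i < b.+1) (1 * v ^+ i.-1) * \prod_(1 <= i < a.+1) (1 * v ^+ i.-1)
    * v ^+ (a * b) = v ^+ (n * (n - 1))./2.
Proof.
have prodE k : \prod_(1 <= i < k.+1) (1 * v ^+ i.-1) = v ^+ 'C(k, 2).
  rewrite big_add1 /= -bin2_sum; elim: k => [|k IH].
    by rewrite !big_geq.
  by rewrite !big_nat_recr //= IH mul1r exprD.
move=> <-; rewrite !prodE -!exprD subn1 -bin2; congr (_ ^+ _).
elim: b => [|b IH]; first by rewrite muln0 !addn0 bin0n add0n.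
by rewrite addnS !binS !bin1 -IH; lia.
Qed.

Section Transport.
Variables (lam : seq nat) (s : A).
Hypothesis pl : is_partition lam.
Local Notation k := (sumn lam).
Local Notation T0 := (TA k v).
Variables (w : 'S_k) (c : 'S_k -> A).
Hypothesis zw : z_el T0 v lam * TwA T0 w = \sum_u c u *: TwA T0 u.
Hypothesis zwz :
  z_el T0 v lam * TwA T0 w * z_el T0 v lam = (s * c 1%g) *: z_el T0 v lam.

Variables (R : comUnitRingType) (f : {rmorphism A -> R}) (H : algType R).
Variable T : nat -> H.
Hypothesis TR : relsA T k (f v).
Local Notation z := (z_el T (f v) lam).

Lemma transport_expand : z * TwA T w = \sum_u f (c u) *: TwA T u.
Proof.
have [phi [phiT phiZ]] := heckeA_lift TR.
rewrite -(phi_z_el phiZ pl v_unit phiT) -(phi_TwA phiT) -rmorphM zw rmorph_sum.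
by apply: eq_bigr => u _; rewrite phiZ (phi_TwA phiT).
Qed.

Lemma transport_corner : z * TwA T w * z = f (s * c 1%g) *: z.
Proof.
have [phi [phiT phiZ]] := heckeA_lift TR.
rewrite -(phi_z_el phiZ pl v_unit phiT) -(phi_TwA phiT).
by rewrite -!rmorphM zwz phiZ.
Qed.

Hypothesis reg : forall h : heckeA k v, (v + 1) *: h = 0 -> h = 0.

Lemma transport_dual : exists d p g,
  [/\ hecke_sub T (fun i => 0 < i < k)%N p, hecke_sub T (fun i => 0 < i < k)%N g
    & f (s * c 1%g) *: z = d *: (p * (dual_z_el T (f v) lam * g))].
Proof.
have [phi [phiT phiZ]] := heckeA_lift TR.
have phiz : phi (z_el T0 v lam) = z by apply: phi_z_el => //; apply: v_unit.
have phid : phi (dual_z_el T0 v lam) = dual_z_el T (f v) lam.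
  by apply: phi_dual_z_el => //; apply: v_unit.
have [d [p [g [hp hg e]]]] :=
  zhz_dual_z_el pl (TA_relsA k v) v_unit reg (TwA_hecke_sub _ w) zwz.
exists (f d), (phi p), (phi g); split.
- exact: (phi_hecke_sub phiZ phiT hp).
- exact: (phi_hecke_sub phiZ phiT hg).
by rewrite -phiz -phiZ e phiZ rmorphM (rmorphM phi _ g) phid.
Qed.

End Transport.

Section GenericCorner.
Variables (n : nat) (lam1 lam2 : seq nat) (s : A2).
Hypotheses (pl1 : is_partition lam1) (pl2 : is_partition lam2).
Hypothesis sumn12 : (sumn lam1 + sumn lam2 = n)%N.
Local Notation a := (sumn lam1).
Local Notation b := (sumn lam2).
Local Notation q := (v2%:F).
Local Notation Q := (tv2%:F).
Local Notation HK := (heckeB n Q q).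
Local Notation T := (TB n Q q).
Local Notation Ta := (fun i => T (a + i)%N).

Let an : (a <= n)%N. Proof. by rewrite -sumn12 leq_addr. Qed.
Let nab : (n - a = b)%N. Proof. by rewrite -sumn12 addKn. Qed.
Let TBr : relsB T n Q q. Proof. exact: TB_relsB. Qed.
Let TAr1 : relsA T a q.
Proof. by have := relsA_shift (a := 0) (k := a) an (relsB_A TBr). Qed.
Let TAr2 : relsA Ta b q.
Proof. by apply: relsA_shift (relsB_A TBr); rewrite sumn12. Qed.

Let dom : GRing.integral_domain_axiom {fraction A2}.
Proof. by move=> x y /eqP; rewrite mulf_eq0. Qed.

Let parB_neq0 (i : 'I_n) : parB Q q i != 0.
Proof.
by rewrite /parB; case: ifP => _; [apply: tv2_frac_neq0 | apply: v2_frac_neq0].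
Qed.

Let q_unit : q \is a GRing.unit. Proof. by rewrite unitfE v2_frac_neq0. Qed.

Lemma bispecht_corner (tr : {scalar HK}) : is_traceB tr ->
  is_schur_element tr (right_ideal (fun=> True) (specht_gen T Q q n lam1 lam2)) s%:F ->
  forall h, specht_gen T Q q n lam1 lam2 * h * specht_gen T Q q n lam1 lam2 =
    (s%:F * tr (specht_gen T Q q n lam1 lam2 * h)) *: specht_gen T Q q n lam1 lam2.
Proof.
move=> trB schur.
have nondeg x : (forall h, tr (h * x) = 0) -> x = 0.
  apply: (tr_nondegenerate (coxB n) (braidB TBr) (quadB TBr) (scalar_lin tr) trB
    parB_neq0 dom); exact: heckeB_span.
have reg (c : {fraction A2}) : c != 0 -> forall h : HK, c *: h = 0 -> h = 0.
  by move=> cn0 h /eqP; rewrite scaler_eq0 (negPf cn0) => /eqP.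
apply: (schur_corner nondeg schur) => h.
apply: (one_dim_corner nondeg schur) => {}h.
apply: (uhu_corner TBr an (reg _ tv1_frac_neq0)); last exact: heckeB_span.
- exact: z_el_sub.
- have := hecke_sub_shift (z_el_sub Ta q pl2); rewrite sumn12; exact.
- by move=> g; apply: (zhz_z_el pl1 TAr1 q_unit (reg _ v21_frac_neq0)).
- move=> g /hecke_sub_unshift; rewrite nab.
  exact: (zhz_z_el pl2 TAr2 q_unit (reg _ v21_frac_neq0)).
Qed.

Variables (w1 : 'S_a) (c1 : 'S_a -> A) (w2 : 'S_b) (c2 : 'S_b -> A).
Hypothesis zw1 : z_el (TA a v) v lam1 * TwA (TA a v) w1 = \sum_u c1 u *: TwA (TA a v) u.
Hypothesis zw2 : z_el (TA b v) v lam2 * TwA (TA b v) w2 = \sum_u c2 u *: TwA (TA b v) u.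

Let const : A2 :=
  \prod_(1 <= i < b.+1) (tv2 * v2 ^+ i.-1) * \prod_(1 <= i < a.+1) (1 * v2 ^+ i.-1)
    * v2 ^+ (a * b).

Let f : {rmorphism A -> {fraction A2}} :=
  [the {rmorphism A2 -> {fraction A2}} of @tofrac A2] \o
  [the {rmorphism A -> A2} of @laurentC A].

Definition test_elt (R : comUnitRingType) (H : algType R) (U : nat -> H) : H :=
  TwA U w1 * TwA (fun i => U (a + i)%N) w2 * h_ab U n a (n - a).

Lemma tr_specht_test (tr : {scalar HK}) : is_traceB tr ->
  tr (specht_gen T Q q n lam1 lam2 * test_elt T) =
  (const * laurentC (c1 1%g * c2 1%g))%:F.
Proof.
move=> trB; have lin := scalar_lin tr.
set z1 := z_el T q lam1; set z2 := z_el Ta q lam2.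
set g1 := TwA T w1; set g2 := TwA Ta w2.
have fv : f v = q by [].
have e1 : z1 * g1 = \sum_u f (c1 u) *: TwA T u.
  exact: (transport_expand pl1 zw1 (f := f) TAr1).
have e2 : z2 * g2 = \sum_u f (c2 u) *: TwA Ta u.
  exact: (transport_expand pl2 zw2 (f := f) TAr2).
have comm : z2 * g1 = g1 * z2.
  apply/esym; apply: (Ha_Hb_comm TBr an); first exact: TwA_hecke_sub.
  have := hecke_sub_shift (z_el_sub Ta q pl2); rewrite sumn12; exact.
have -> : specht_gen T Q q n lam1 lam2 * test_elt T =
    uhu T Q q n a * ((z1 * g1) * ((z2 * g2) * h_ab T n a (n - a))).
  rewrite /specht_gen /test_elt -/z1 -/z2 -/g1 -/g2.
  move: (uhu T Q q n a) (h_ab T n a (n - a)) z1 z2 g1 g2 comm {e1 e2}.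
  move=> e h z1 z2 g1 g2 comm.
  by rewrite !mulrA -(mulrA _ z2 g1) comm !mulrA.
have constE : const%:F =
    \prod_(1 <= i < b.+1) (Q * q ^+ i.-1) * \prod_(1 <= i < a.+1) (1 * q ^+ i.-1)
      * q ^+ (a * b).
  rewrite [LHS]tofracM [X in X * _]tofracM tofracXn !rmorph_prod.
  by congr (_ * _ * _); apply: eq_bigr => i _; rewrite rmorphM rmorphXn ?rmorph1.
have term u u' : tr (uhu T Q q n a *
   (f (c1 u) *: TwA T u * (f (c2 u') *: TwA Ta u' * h_ab T n a (n - a)))) =
   (u == 1%g)%:R * (u' == 1%g)%:R * (const * laurentC (c1 u * c2 u'))%:F.
  rewrite -!scalerAl -!scalerAr !linearZ /=.
  rewrite (tr_uhu_basis_eq TBr sumn12 (scalar_lin tr) trB) -constE.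
  by rewrite laurentCM !tofracM; ring.
rewrite e1 e2 mulr_suml mulr_sumr linear_sum (bigD1 1%g) //=.
rewrite [X in _ + X]big1 ?addr0 => [|u /negPf u1]; last first.
  rewrite mulr_suml !mulr_sumr linear_sum big1 // => u' _.
  by rewrite /= term u1 !mul0r.
rewrite mulr_suml !mulr_sumr linear_sum (bigD1 1%g) //=.
rewrite [X in _ + X]big1 ?addr0 => [|u /negPf u1]; last first.
  by rewrite term u1 mulr0 mul0r.
by rewrite term !eqxx !mul1r.
Qed.

End GenericCorner.

Lemma TB_out (R : comNzRingType) n (Q q : R) i : (n <= i)%N -> TB n Q q i = 0.
Proof. by move=> ni; rewrite /TB insubF // ltnNge ni. Qed.

Lemma heckeB_base_change (R R' : comNzRingType) (f : {rmorphism R -> R'}) n Q q :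
  exists phi : {rmorphism heckeB n Q q -> heckeB n (f Q) (f q)},
    (forall i, phi (TB n Q q i) = TB n (f Q) (f q) i) /\
    (forall a x, phi (a *: x) = f a *: phi x).
Proof.
have [phi [phiT phiZ]] := heckeB_lift (TB_relsB n (f Q) (f q)).
exists phi; split=> // i; have [/phiT //|ni] := ltnP i n.
by rewrite !TB_out ?rmorph0.
Qed.

Section BaseChangeSpecht.
Variables (n : nat) (lam1 lam2 : seq nat).
Hypotheses (pl1 : is_partition lam1) (pl2 : is_partition lam2).
Variables (R R' : comUnitRingType) (f : {rmorphism R -> R'}).
Variables (H : algType R) (H' : algType R') (phi : {rmorphism H -> H'}).
Variables (T : nat -> H) (T' : nat -> H') (Q q : R).
Hypothesis q_unit : q \is a GRing.unit.
Hypothesis phiT : forall i, phi (T i) = T' i.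
Hypothesis phiZ : forall a x, phi (a *: x) = f a *: phi x.

Lemma phi_specht_gen : phi (specht_gen T Q q n lam1 lam2) =
  specht_gen T' (f Q) (f q) n lam1 lam2.
Proof.
rewrite /specht_gen (rmorphM phi (_ * z_el _ _ _)) (rmorphM phi (uhu _ _ _ _ _)).
rewrite (phi_uhu phiZ phiT) (phi_z_el phiZ pl1 q_unit (T' := T')) //.
by rewrite (phi_z_el phiZ pl2 q_unit (T' := fun i => T' (sumn lam1 + i)%N)).
Qed.

Lemma phi_test_elt w1 w2 :
  phi (@test_elt n lam1 lam2 w1 w2 R H T) = @test_elt n lam1 lam2 w1 w2 R' H' T'.
Proof.
rewrite /test_elt !rmorphM.
rewrite (phi_TwA (T' := T')) //.
rewrite (phi_TwA (T' := fun i => T' (sumn lam1 + i)%N)) //.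
by congr (_ * _); apply: phi_TwA.
Qed.

End BaseChangeSpecht.

Section Specialization.
Variables (n : nat) (lam1 lam2 : seq nat).
Hypotheses (pl1 : is_partition lam1) (pl2 : is_partition lam2).
Hypothesis sumn12 : (sumn lam1 + sumn lam2 = n)%N.
Local Notation a := (sumn lam1).
Local Notation b := (sumn lam2).
Local Notation K := ({fraction A2}).
Local Notation HK := (heckeB n (tv2%:F) (v2%:F)).
Local Notation HB2 := (heckeB n tv2 v2).
Local Notation HB1 := (heckeB n 1 v).
Local Notation TK := (TB n (tv2%:F) (v2%:F)).
Local Notation T2 := (TB n tv2 v2).
Local Notation T1 := (TB n 1 v).

Variables (w1 : 'S_a) (c1 : 'S_a -> A) (w2 : 'S_b) (c2 : 'S_b -> A).
Hypothesis zw1 : z_el (TA a v) v lam1 * TwA (TA a v) w1 = \sum_u c1 u *: TwA (TA a v) u.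
Hypothesis zw2 : z_el (TA b v) v lam2 * TwA (TA b v) w2 = \sum_u c2 u *: TwA (TA b v) u.
Hypotheses (c1n0 : c1 1%g != 0) (c2n0 : c2 1%g != 0).
Local Notation x1 := (specht_gen T1 1 v n lam1 lam2).
Local Notation h1 := (@test_elt n lam1 lam2 w1 w2 A HB1 T1).

Variable s : A2.
Hypothesis hs : schurB n lam1 lam2 s.

Lemma specialized_corner : [/\
  x1 * h1 * x1 = (laurent_at1 s * v ^+ (n * (n - 1))./2 * (c1 1%g * c2 1%g)) *: x1
  & forall kappa : A, kappa *: x1 = 0 -> kappa = 0].
Proof.
have [tr [trB schur]] := hs.
have [phiK [phiKT phiKZ]] :=
  heckeB_base_change [the {rmorphism A2 -> K} of @tofrac A2] n tv2 v2.
have at1v2 : laurent_at1 v2 = v by apply: laurent_at1C.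
have at1tv2 : laurent_at1 tv2 = 1 by apply: laurent_at1X.
have [phi1 [phi1T phi1Z]] : exists phi : {rmorphism HB2 -> HB1},
    (forall i, phi (T2 i) = T1 i) /\
    (forall c x, phi (c *: x) = laurent_at1 c *: phi x).
  pose g := [the {rmorphism A2 -> A} of @laurent_at1 A].
  have := heckeB_base_change g n tv2 v2.
  by rewrite (at1v2 : g v2 = v) (at1tv2 : g tv2 = 1).
set x2 := specht_gen T2 tv2 v2 n lam1 lam2.
set h2 := @test_elt n lam1 lam2 w1 w2 A2 HB2 T2.
have phi1x : phi1 x2 = x1.
  rewrite (phi_specht_gen n pl1 pl2 tv2 v2_unit phi1T phi1Z) /=.
  by rewrite at1v2 at1tv2.
have phi1h : phi1 h2 = h1 by apply: phi_test_elt.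
have phiKx : phiK x2 = specht_gen TK (tv2%:F) (v2%:F) n lam1 lam2.
  exact: (phi_specht_gen n pl1 pl2 tv2 v2_unit phiKT phiKZ).
have phiKh : phiK h2 = @test_elt n lam1 lam2 w1 w2 K HK TK by apply: phi_test_elt.
have TKr := TB_relsB n (tv2%:F) (v2%:F).
have dom : GRing.integral_domain_axiom K by move=> x y /eqP; rewrite mulf_eq0.
have parn0 (i : 'I_n) : parB (tv2%:F) (v2%:F) i != 0.
  by rewrite /parB; case: ifP => _; [apply: tv2_frac_neq0 | apply: v2_frac_neq0].
have phiK_sum (c : {perm bool * 'I_n} -> A2) :
    phiK (\sum_(u in weylB n | predT u) c u *: Tw (@gensB n) (fun i : 'I_n => T2 i) u) =
    \sum_(u in weylB n | predT u) (c u)%:F *: Tw (@gensB n) (fun i : 'I_n => TK i) u.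
  rewrite rmorph_sum; apply: eq_bigr => u _; rewrite phiKZ rmorph_prod.
  by congr (_ *: _); apply: eq_bigr => i _; apply: phiKT.
have phiK_inj : injective phiK.
  apply: raddf_inj => x; have [c ->] := heckeB_span x.
  move=> /(etrans (esym (phiK_sum c))) e; rewrite big1 // => u /andP[uW _].
  have : (c u)%:F = 0.
    apply: (Tw_independent (coxB n) (braidB TKr) (quadB TKr) (scalar_lin tr) trB
      parn0 dom (c := fun u => (c u)%:F)) uW.
    by rewrite -[RHS]e; apply: eq_bigl => w; rewrite andbT.
  by move/eqP; rewrite tofrac_eq0 => /eqP ->; rewrite scale0r.
have trK x : exists t : A2, tr (phiK x) = t%:F.
  have [c ->] := heckeB_span x; exists (c 1%g).
  rewrite phiK_sum linear_sum (bigD1 1%g) ?group1 //= big1 ?addr0.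
    by rewrite linearZ /= [tr _]trB ?group1 // eqxx mulr1.
  move=> u /andP[/andP[uW _] /negPf u1].
  by rewrite linearZ /= [tr _]trB // u1 mulr0.
have tr_xh := tr_specht_test pl1 pl2 sumn12 zw1 zw2 trB.
set const := (X in X * laurentC (c1 1%g * c2 1%g)) in tr_xh.
have corner := bispecht_corner pl1 pl2 sumn12 trB schur.
have at1const : laurent_at1 const = v ^+ (n * (n - 1))./2.
  rewrite -(v_power_count sumn12) /const !rmorphM rmorphXn !rmorph_prod /=.
  rewrite at1v2; congr (_ * _ * _); apply: eq_bigr => i _.
    by rewrite rmorphM rmorphXn /= at1v2 at1tv2.
  by rewrite rmorphM rmorphXn rmorph1 /= at1v2.
clearbody const.
have corner2 : x2 * h2 * x2 = (s * (const * laurentC (c1 1%g * c2 1%g))) *: x2.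
  apply: phiK_inj; rewrite phiKZ (rmorphM phiK (x2 * h2)) (rmorphM phiK x2) phiKx phiKh.
  by rewrite corner tr_xh /= tofracM.
split.
  rewrite -phi1x -phi1h -2!(rmorphM phi1) corner2 phi1Z /=.
  by rewrite rmorphM rmorphM /= at1const laurent_at1C mulrA.
move=> kappa e.
have [y ey] : exists y, laurentC kappa *: x2 = (tv2 - 1) *: y.
  apply: (specialization_kernel phi1T phi1Z).
  by rewrite phi1Z /= laurent_at1C phi1x e.
have [t tE] := trK (y * h2).
have : laurentC kappa * (const * laurentC (c1 1%g * c2 1%g)) = (tv2 - 1) * t.
  apply/eqP; rewrite -tofrac_eq; apply/eqP.
  rewrite !(tofracM (laurentC kappa)) !(tofracM (tv2 - 1)) -tr_xh -tE -phiKx -phiKh.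
  rewrite -(rmorphM phiK) -[LHS]linearZ -[RHS]linearZ /=.
  rewrite -!phiKZ; congr (tr (phiK _)).
  by rewrite scalerAl ey -scalerAl.
move/(congr1 (@laurent_at1 A)); rewrite !rmorphM rmorphB rmorph1 /=.
rewrite at1tv2 subrr mul0r !laurent_at1C at1const.
move/eqP; rewrite !mulf_eq0 (negPf c1n0) (negPf c2n0) !orbF.
rewrite expf_eq0 => /orP[/eqP //|/andP[_ /eqP v0]].
by have := laurentX_neq0 int; rewrite -[laurentX int]/v v0 eqxx.
Qed.

End Specialization.

Section FScalar.
Variables (n : nat) (lam1 lam2 : seq nat).
Hypotheses (pl1 : is_partition lam1) (pl2 : is_partition lam2).
Hypothesis sumn12 : (sumn lam1 + sumn lam2 = n)%N.
Local Notation a := (sumn lam1).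
Local Notation b := (sumn lam2).
Local Notation H := (heckeB n 1 v).
Local Notation T := (TB n 1 v).
Local Notation Ta := (fun i => T (a + i)%N).
Local Notation z1 := (z_el T v lam1).
Local Notation z2 := (z_el Ta v lam2).

Variables (w1 : 'S_a) (c1 : 'S_a -> A) (s1 : A).
Variables (w2 : 'S_b) (c2 : 'S_b -> A) (s2 : A).
Hypothesis zwz1 : z_el (TA a v) v lam1 * TwA (TA a v) w1 * z_el (TA a v) v lam1 =
  (s1 * c1 1%g) *: z_el (TA a v) v lam1.
Hypothesis zwz2 : z_el (TA b v) v lam2 * TwA (TA b v) w2 * z_el (TA b v) v lam2 =
  (s2 * c2 1%g) *: z_el (TA b v) v lam2.
Hypothesis reg1 : forall h : heckeA a v, (v + 1) *: h = 0 -> h = 0.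
Hypothesis reg2 : forall h : heckeA b v, (v + 1) *: h = 0 -> h = 0.

Lemma f_scalar_corner f : f_scalar n lam1 lam2 f ->
  specht_gen T 1 v n lam1 lam2 * @test_elt n lam1 lam2 w1 w2 A H T
    * specht_gen T 1 v n lam1 lam2 =
  (f * (s1 * c1 1%g) * (s2 * c2 1%g)) *: specht_gen T 1 v n lam1 lam2.
Proof.
have an : (a <= n)%N by rewrite -sumn12 leq_addr.
have TBr := TB_relsB n (1 : A) v.
pose id_A : {rmorphism A -> A} := [the {rmorphism A -> A} of idfun].
have TAr1 : relsA T a (id_A v).
  by have := relsA_shift (a := 0) (k := a) an (relsB_A TBr).
have TAr2 : relsA Ta b (id_A v).
  by apply: relsA_shift (relsB_A TBr); rewrite sumn12.
case=> z [zL zC zE] zf.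
have hb x : hecke_sub Ta (fun i => 0 < i < b)%N x ->
    hecke_sub T (fun i => a < i < n)%N x.
  by move=> /hecke_sub_shift; rewrite sumn12.
have z1H : hecke_sub T (fun i => 0 < i < a)%N z1 by apply: z_el_sub.
have z2H : hecke_sub T (fun i => a < i < n)%N z2 by apply/hb/z_el_sub.
have g1H : hecke_sub T (fun i => 0 < i < a)%N (TwA T w1) by apply: TwA_hecke_sub.
have g2H : hecke_sub T (fun i => a < i < n)%N (TwA Ta w2) by apply/hb/TwA_hecke_sub.
have zgz1 : z1 * TwA T w1 * z1 = (s1 * c1 1%g) *: z1.
  exact: (transport_corner pl1 zwz1 (f := id_A) TAr1).
have zgz2 : z2 * TwA Ta w2 * z2 = (s2 * c2 1%g) *: z2.
  exact: (transport_corner pl2 zwz2 (f := id_A) TAr2).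
have [d1 [p1 [r1 [p1H r1H]]]] := transport_dual pl1 zwz1 (f := id_A) TAr1 reg1.
have [d2 [p2 [r2 [p2H r2H]]]] := transport_dual pl2 zwz2 (f := id_A) TAr2 reg2.
rewrite /= => e2 e1.
set k1 := s1 * c1 1%g in zgz1 e1 *; set k2 := s2 * c2 1%g in zgz2 e2 *.
set m1 := dual_z_el T v lam1 * r1 in e1; set m2 := dual_z_el Ta v lam2 * r2 in e2.
have mz : m1 * m2 * z = f *: (m1 * m2).
  by apply: zf; [exists r1 | exists r2 => //; apply: hb].
have HaL x := @Ha_HL A H T n a an x.
have kk : (k1 *: z1) * (k2 *: z2) = (k1 * k2) *: (z1 * z2).
  by rewrite -scalerAl -scalerAr scalerA.
have zzf : (k1 * k2) *: (z1 * z2 * z) = (f * (k1 * k2)) *: (z1 * z2).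
  have kz : (k1 * k2) *: (z1 * z2) = (d1 * d2) *: (p1 * p2 * (m1 * m2)).
    rewrite -kk e1 e2 -scalerAl -scalerAr scalerA; congr (_ *: _).
    have m1p2 : m1 * p2 = p2 * m1.
      apply: (Ha_Hb_comm TBr an); last exact: hb.
      apply: subalg_mul r1H; apply: subalg_mul; last exact: x_el_sub.
      apply: subalg_mul; first exact: y_el_sub.
      by rewrite -(sumn_conj_part pl1); apply: TwA_hecke_sub.
    move: m1 m2 m1p2 {e1 e2 mz} => m1 m2 m1p2.
    by rewrite !mulrA -(mulrA p1 m1 p2) m1p2 !mulrA.
  rewrite scalerAl kz -scalerAl -(mulrA (p1 * p2)) mz -scalerAr scalerA.
  rewrite (mulrC _ f) -scalerA.
  by rewrite kz scalerA.
have sandwich := uhu_sandwich TBr an z1H z2H g1H g2H.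
have -> : specht_gen T 1 v n lam1 lam2 * @test_elt n lam1 lam2 w1 w2 A H T
    * specht_gen T 1 v n lam1 lam2 =
  uhu T 1 v n a * (h_ab T n a (n - a) * uhu T 1 v n a) * ((k1 *: z1) * (k2 *: z2)).
  rewrite -zgz1 -zgz2 -sandwich /specht_gen /test_elt.
  by move: (uhu T 1 v n a) (TwA T w1) (TwA Ta w2) => u g1 g2; rewrite !mulrA.
rewrite [uhu T 1 v n a * (_ * _)]mulrA zE.
have zz : z * (z1 * z2) = z1 * z2 * z.
  apply: zC; apply: subalg_mul; first exact: (Ha_HL an z1H).
  exact: (Hb_HL an z2H).
rewrite kk /specht_gen; move: (uhu T 1 v n a) => u.
by rewrite -scalerAr -(mulrA u z) zz scalerAr zzf -scalerAr (mulrA u) mulrA -mulrA.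
Qed.

End FScalar.

Theorem theorem2p9 (n m : nat) (hnm : n = (2 * m)%N) (hn : (4 <= n)%N)
    (lam1 lam2 : seq nat) (hlam : is_bipartition n lam1 lam2)
    (f : A) (hf : f_scalar n lam1 lam2 f)
    (s : A2) (hs : schurB n lam1 lam2 s)
    (s1 : A) (hs1 : schurA lam1 s1)
    (s2 : A) (hs2 : schurA lam2 s2) :
  f%:F = v%:F ^+ (n * (n - 1))./2
           * ((laurent_at1 s)%:F / (s1%:F * s2%:F)) :> {fraction A}.
Proof.
case/and3P: hlam => pl1 pl2 /eqP sumn12.
have [s1n0 reg1 [w1 [c1 [c1n0 zw1 zwz1]]]] := schurA_corner pl1 hs1.
have [s2n0 reg2 [w2 [c2 [c2n0 zw2 zwz2]]]] := schurA_corner pl2 hs2.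
have [corner faithful] := specialized_corner pl1 pl2 sumn12 zw1 zw2 c1n0 c2n0 hs.
have := f_scalar_corner pl1 pl2 sumn12 zwz1 zwz2 reg1 reg2 hf.
rewrite corner => /esym/eqP; rewrite -subr_eq0 -scalerBl => /eqP/faithful/eqP.
rewrite subr_eq0 => /eqP e.
have {}e : f * (s1 * s2) = laurent_at1 s * v ^+ (n * (n - 1))./2.
  apply: (mulIf (mulf_neq0 c1n0 c2n0)); rewrite -e; ring.
apply: (mulIf (x := s1%:F * s2%:F)); first by rewrite mulf_neq0 ?tofrac_eq0.
rewrite -mulrA divfK; last by rewrite mulf_neq0 ?tofrac_eq0.
by rewrite -tofracXn -!tofracM e mulrC.
Qed.
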